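(* There is a constant $C>0$, independent of $s$ and $t$, such that for all $0<s\le t<1$ and all $\hat v\in H^2(\hat Q)$, $$|\hat v-\hat\pi_{\hat Q}\hat v|_{H^1(\hat Q)}\le C\,|\hat v|_{H^2(\hat Q)},$$ where $\hat Q=\hat Q_{s,t}$ is the quadrilateral with vertices $\hat A_1=(0,0)$, $\hat A_2=(1,0)$, $\hat A_3=(1-s,s)$, $\hat A_5=(0,t)$, and $\hat\pi_{\hat Q}\hat v\in P_1(\hat Q)$ is the interpolant determined by the averages of the vertex values of $\hat v$ at the endpoints of the edges of $\hat Q$ (defined in the context).
   Context: $P_1(\hat Q)$ is the space of polynomials of degree at most one on $\hat Q$. The edges of $\hat Q$ are $\hat e_1=\hat A_1\hat A_2$, $\hat e_2=\hat A_2\hat A_3$, $\hat e_6=\hat A_3\hat A_5$, $\hat e_5=\hat A_5\hat A_1$, and $\hat m_i$ is the midpoint of $\hat e_i$. For $\hat v\in H^2(\hat Q)$ (identified with its continuous representative), $\hat\pi_{\hat Q}\hat v$ is the unique function in $P_1(\hat Q)$ whose value at the midpoints $\hat m_1,\hat m_2,\hat m_5$ of $\hat e_1,\hat e_2,\hat e_5$ equals the average of the values of $\hat v$ at the two endpoints of the respective edge: $$\hat\pi_{\hat Q}\hat v(\hat m_1)=\tfrac12(\hat v(\hat A_1)+\hat v(\hat A_2)),\quad \hat\pi_{\hat Q}\hat v(\hat m_2)=\tfrac12(\hat v(\hat A_2)+\hat v(\hat A_3)),\quad \hat\pi_{\hat Q}\hat v(\hat m_5)=\tfrac12(\hat v(\hat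 A_5)+\hat v(\hat A_1)).$$ $|\cdot|_{H^k(\hat Q)}$ denotes the Sobolev semi-norm containing only the derivatives of order exactly $k$. *)

(* Defs.v *)
From HB Require Import structures.
From mathcomp Require Import all_boot all_order all_algebra.
From mathcomp Require Import all_classical all_reals all_analysis.

Set Implicit Arguments.
Unset Strict Implicit.
Unset Printing Implicit Defensive.

Import Order.TTheory GRing.Theory Num.Theory.
Import numFieldNormedType.Exports.

Local Open Scope classical_set_scope.
Local Open Scope ring_scope.

Definition lebesgue2 (R : realType) : set (R * R) -> \bar R :=
  (@lebesgue_measure R \x @lebesgue_measure R)%E.

Definition partial (R : realType) (i j : nat) (f : R * R -> R) : R * R -> R :=
  iter i (fun g => 'D_((1, 0) : R * R) g)
    (iter j (fun g => 'D_((0, 1) : R * R) g) f).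

Fixpoint Ck (R : realType) (k : nat) (f : R * R -> R) : Prop :=
  continuous f /\
  (if k is k'.+1 then
     [/\ forall p, derivable f p (1, 0),
         forall p, derivable f p (0, 1),
         Ck k' (partial 1 0 f)
       & Ck k' (partial 0 1 f)]
   else True).

Definition test_function (R : realType) (Q : set (R * R)) (phi : R * R -> R) :=
  [/\ forall k, Ck k phi,
      compact (closure [set p | phi p != 0])
    & closure [set p | phi p != 0] `<=` Q].

Definition L2 (R : realType) (Q : set (R * R)) (f : R * R -> R) : Prop :=
  measurable_fun Q f /\ finite_norm (@lebesgue2 R) 2%:E (f \_ Q).

Definition L2norm (R : realType) (Q : set (R * R)) (f : R * R -> R) : R :=
  fine ('N[@lebesgue2 R]_2%:E[EFin \o (f \_ Q)])%E.

(* [g] is square integrable on the open set [Q] and is the distributional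
   derivative of order [(i, j)] of [v] there. *)
Definition weak_partial (R : realType) (Q : set (R * R)) (i j : nat)
    (v g : R * R -> R) : Prop :=
  L2 Q g /\
  forall phi, test_function Q phi ->
    \int[@lebesgue2 R]_(p in Q) (v p * partial i j phi p) =
    (-1) ^+ (i + j) * \int[@lebesgue2 R]_(p in Q) (g p * phi p).

Definition sobolevH (R : realType) (k : nat) (Q : set (R * R))
    (v : R * R -> R) : Prop :=
  L2 Q v /\
  forall i j, (i + j <= k)%N -> exists g, weak_partial Q i j v g.

(* A chosen weak derivative: weak derivatives are unique almost everywhere, so
   the choice does not affect [L2norm]. The default value 0 is only used when
   there is none, hence never for [i + j <= k] when [sobolevH k Q v]. *)
Definition wpartial (R : realType) (Q : set (R * R)) (i j : nat)
    (v : R * R -> R) : R * R -> R :=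
  xget (fun=> 0) [set g | weak_partial Q i j v g].

Definition sobolev_seminorm (R : realType) (k : nat) (Q : set (R * R))
    (v : R * R -> R) : R :=
  Num.sqrt (\sum_(i < k.+1) L2norm Q (wpartial Q i (k - i) v) ^+ 2).

Definition continuous_representative (R : realType) (Q : set (R * R))
    (v u : R * R -> R) : Prop :=
  {within closure Q, continuous u} /\
  {ae @lebesgue2 R, forall p, Q p -> u p = v p}.

Definition A1 (R : realType) : R * R := (0, 0).
Definition A2 (R : realType) : R * R := (1, 0).
Definition A3 (R : realType) (s : R) : R * R := (1 - s, s).
Definition A5 (R : realType) (t : R) : R * R := (0, t).

(* For [0 < s <= t < 1] the polygon A1 A2 A3 A5 is convex, so it is the convex
   hull of its vertices. Its interior is the domain of the Sobolev spaces. *)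
Definition Qhat (R : realType) (s t : R) : set (R * R) :=
  interior (smallest (@convex_set R _) [set A1 R; A2 R; A3 s; A5 t]).

Definition midpoint (R : realType) (A B : R * R) : R * R :=
  2^-1 *: (A + B).

Definition P1 (R : realType) (f : R * R -> R) : Prop :=
  exists a b c : R, forall p, f p = a + b * p.1 + c * p.2.

(* The three conditions determine one element of [P1]; [xget] selects it. *)
Definition P1_interpolant (R : realType) (s t : R) (v : R * R -> R) :
    R * R -> R :=
  xget (fun=> 0) [set f |
    [/\ P1 f,
        f (midpoint (A1 R) (A2 R)) = (v (A1 R) + v (A2 R)) / 2,
        f (midpoint (A2 R) (A3 s)) = (v (A2 R) + v (A3 s)) / 2
      & f (midpoint (A5 t) (A1 R)) = (v (A5 t) + v (A1 R)) / 2]].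

(* Main.v *)
Require Import Defs.
From HB Require Import structures.
From mathcomp Require Import all_boot all_order all_algebra.
From mathcomp Require Import all_classical all_reals all_analysis.
From mathcomp Require Import unstable measurable_realfun.
From mathcomp Require Import ring lra.

Set Implicit Arguments.
Unset Strict Implicit.
Unset Printing Implicit Defensive.

Import Order.TTheory GRing.Theory Num.Theory.
Import numFieldNormedType.Exports.

Local Open Scope classical_set_scope.
Local Open Scope ring_scope.

(** Let w = v - pi. The interpolation conditions say that w takes alternating
    values l, -l, l, -l at the four vertices. Rescaling the Poincare inequality
    by the anisotropic box (0, 1) x (0, t), each component of the gradient of w
    stays, in L2 up to a constant independent of s and t, close to a number: g
    for the horizontal one, h for the vertical one. On a line, w then differs
    from the affine function of slope g (or h) by the L2 norm n of the second
    derivatives times a power of t. Applied to the edges A1 A2, A1 A5 and to the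
    two segments joining A2 and A3 through (1 - s, 0), this gives two relations
    between g, h and l. They form a linear system whose determinant
    t + s - s t is at least t, so that g and h are O(n / sqrt t), which is what
    the L2 bound of the gradient over a domain of area O(t) requires. *)

(** The constant must not depend on [s] and [t], so the usual compactness proof of Poincare-type
    inequalities is of no help: everything is explicit, and even Poincare comes from pointwise
    bounds along rows and columns. Two obstacles shape the rest. Weak derivatives are known only
    through test functions, so a fundamental theorem of calculus on almost every line has to be
    derived first; this works because the domain contains, with each point, the whole box between
    that point and the origin. Moreover the edges are null sets, on which first derivatives have no
    values: all estimates are made between generic points inside the domain, and only the continuity
    of the representative carries them to the vertices. Generic points of at most average energy are
    found from a strict bound on the energies; hence a number [n] larger than the squared norms of
    the second derivatives, which is let down to them at the very end. *)

(** * Smooth functions of one variable and compactly supported plateaus *)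

Section smooth1.
Variable R : realType.
Implicit Types (f g : R -> R) (a b x : R).

Fixpoint Ck1 (k : nat) f : Prop :=
  continuous f /\
  (if k is k'.+1 then (forall x, derivable f x 1) /\ Ck1 k' (derive1 f) else True).

Definition smooth1 f := forall k, Ck1 k f.

Lemma Ck1W k f : Ck1 k.+1 f -> Ck1 k f.
Proof.
elim: k f => [|k IH] f [fc [fd fk]]; first by split.
by split=> //; split=> //; exact: IH.
Qed.

Lemma Ck1D k f g : Ck1 k f -> Ck1 k g -> Ck1 k (f \+ g).
Proof.
elim: k f g => [|k IH] f g [fc fk] [gc gk]; split.
- by move=> x; apply: cvgD; [exact: fc|exact: gc].
- by [].
- by move=> x; apply: cvgD; [exact: fc|exact: gc].
have [[fd fk'] [gd gk']] := (fk, gk); split.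
  by move=> x; exact: derivableD.
suff -> : derive1 (f \+ g) = (derive1 f) \+ (derive1 g) by exact: IH.
by apply/funext => x; rewrite /= !derive1E; exact: deriveD.
Qed.

Lemma Ck1M k f g : Ck1 k f -> Ck1 k g -> Ck1 k (f \* g).
Proof.
elim: k f g => [|k IH] f g.
  by move=> [fc _] [gc _]; split => // x; apply: cvgM; [exact: fc|exact: gc].
move=> fk gk; have [fc [fd fk']] := fk; have [gc [gd gk']] := gk; split.
  by move=> x; apply: cvgM; [exact: fc|exact: gc].
split; first by move=> x; exact: derivableM.
suff -> : derive1 (f \* g) = ((derive1 f) \* g) \+ (f \* (derive1 g)).
  by apply: Ck1D; apply: IH => //; exact: Ck1W.
apply/funext => x; rewrite /= !derive1E.
rewrite (_ : 'D_1 _ x = f x *: 'D_1 g x + g x *: 'D_1 f x); last exact: deriveM.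
by rewrite /GRing.scale/=; ring.
Qed.

Lemma Ck1_cst k (c : R) : Ck1 k (cst c).
Proof.
elim: k c => [|k IH] c; split => //; [exact: cst_continuous|exact: cst_continuous|].
split; first by move=> x; exact: derivable_cst.
suff -> : derive1 (cst c : R -> R) = cst 0 by exact: IH.
by apply/funext => x; rewrite derive1E derive_cst.
Qed.

Lemma Ck1_affine k f (c d : R) : Ck1 k f -> Ck1 k (fun x => f (c * x + d)).
Proof.
have dcd (x : R) : is_derive x (1 : R) (fun x : R => c * x + d) c.
  have -> : (fun x : R => c * x + d) = (c \*: (@id R)) + cst d.
    by apply/funext.
  by apply: is_derive_eq; rewrite addr0 /GRing.scale/= mulr1.
have ccd : continuous (fun x : R => c * x + d).
  move=> x; apply: cvgD; last exact: cvg_cst.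
  by apply: cvgM; [exact: cvg_cst|exact: cvg_id].
elim: k f => [|k IH] f.
  move=> [fc _]; split=> // x.
  exact: (@continuous_comp _ _ _ (fun x : R => c * x + d) f x (ccd x) (fc _)).
move=> [fc [fd fk]]; split.
  move=> x.
  exact: (@continuous_comp _ _ _ (fun x : R => c * x + d) f x (ccd x) (fc _)).
have D (x : R) : is_derive x (1 : R) (fun x => f (c * x + d)) (c * (derive1 f) (c * x + d)).
    rewrite mulrC; apply: (@is_derive1_comp _ f (fun x => c * x + d)).
  by rewrite derive1E; exact: derivableP.
split; first by move=> x; exact: (@ex_derive _ _ _ _ _ _ _ (D x)).
suff -> : derive1 (fun x => f (c * x + d)) = cst c \* (fun x => (derive1 f) (c * x + d)).
  by apply: Ck1M; [exact: Ck1_cst|exact: IH].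
by apply/funext => x; rewrite derive1E (@derive_val _ _ _ _ _ _ _ (D x)).
Qed.

(** The classical flat function [exp (-1/x)], taken with all prefactors [x^-1 ^+ m] so that the
    family is closed under differentiation up to linear combinations; smoothness of all members is
    then one induction on the order. *)
Definition flat (m : nat) (x : R) : R :=
  if 0 < x then x^-1 ^+ m * expR (- x^-1) else 0.

Lemma flat_ge0 m x : 0 <= flat m x.
Proof.
by rewrite /flat; case: ltP => // x0; rewrite mulr_ge0 ?expR_ge0// exprn_ge0// invr_ge0 ltW.
Qed.

(** A single term of the exponential series beats the negative power with one factor [x] to spare.
    This linear decay gives the derivative at 0. *)
Lemma flat_le m x : 0 < x -> flat m x <= m.+1`!%:R * x.
Proof.
move=> x0; rewrite /flat x0 expRN ler_pdivrMr ?expR_gt0//.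
have y0 : 0 < x^-1 by rewrite invr_gt0.
have := expR_ge1Dxn m (ltW y0); set E := expR _ => hE.
have f0 : 0 < m.+1`!%:R :> R by rewrite ltr0n fact_gt0.
have {}hE : x^-1 ^+ m.+1 / m.+1`!%:R <= E by lra.
rewrite ler_pdivrMr// in hE.
have -> : x^-1 ^+ m = x * x^-1 ^+ m.+1.
  by rewrite [in RHS]exprS mulrA divff ?gt_eqF// mul1r.
apply: le_trans (ler_wpM2l (ltW x0) hE) _.
by rewrite [X in X <= _](_ : _ = m.+1`!%:R * x * E)//; ring.
Qed.

Lemma is_derive_flat m (x : R) :
  is_derive x (1 : R) (flat m) (- m%:R * flat m.+1 x + flat m.+2 x).
Proof.
have [x0|x0|->] := ltgtP x 0.
- apply: (@near_eq_is_derive _ _ _ (cst 0)).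
    near=> z; rewrite /flat ltNge ltW//; near: z; exact: lt_nbhsl.
  by apply: is_derive_eq; rewrite /flat ltNge ltW//= mulr0 addr0.
- apply: (@near_eq_is_derive _ _ _ (fun z : R => z^-1 ^+ m * expR (- z^-1))).
    near=> z; rewrite /flat ifT//; near: z; exact: lt_nbhsr.
  have xn0 : x != 0 by rewrite gt_eqF.
  have di : is_derive x (1 : R) (fun z : R => z^-1) (- x^-1 ^+ 2).
    have := @is_deriveV R id x 1 1 xn0 (is_derive_id x 1).
    by rewrite /GRing.scale/= mulr1 exprVn.
  have de : is_derive x (1 : R) (fun z => expR (- z^-1)) (expR (- x^-1) * x^-1 ^+ 2).
    have dn : is_derive x (1 : R) (fun z : R => - z^-1) (x^-1 ^+ 2).
      by have := is_deriveN di; rewrite opprK.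
    exact: (@is_derive1_comp R expR (fun z => - z^-1)).
  have dp : is_derive x (1 : R) (fun z : R => z^-1 ^+ m) (- m%:R * x^-1 ^+ m.+1).
    have := @is_deriveX _ _ (fun z : R => z^-1 : R) m x 1 _ di.
    rewrite (_ : _ ^+ m = (fun z : R => z^-1 ^+ m)); last first.
      by apply/funext => z; rewrite fctE.
    move=> /is_derive_eq; apply; rewrite /GRing.scale/=.
    case: m => [|m]; first by rewrite mulr0n oppr0 !mul0r.
    by rewrite -pred_Sn !exprS; ring.
  have := @is_deriveM _ _ (fun z : R => z^-1 ^+ m : R) (fun z : R => expR (- z^-1)) x 1 _ _ dp de.
  move=> /is_derive_eq; apply; rewrite /GRing.scale/= /flat x0 !exprS; ring.
- have -> : - m%:R * flat m.+1 0 + flat m.+2 0 = 0.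
    by rewrite /flat ltxx mulr0 addr0.
  have h : h^-1 *: ((flat m \o shift 0) (h *: (1:R)) - flat m 0) @[h --> 0^'] --> (0:R).
    (* At 0 the difference quotient of [flat m] is [flat m.+1], so that [flat_le] gives the limit
       0. *)
    have fh h : h != 0 -> h^-1 *: ((flat m \o shift 0) (h *: (1:R)) - flat m 0) = flat m.+1 h.
      move=> h0; rewrite /flat /= ltxx subr0 addr0 /GRing.scale/= mulr1.
      by case: ifP => //; rewrite ?mulr0// mulrA exprS.
    apply: (@cvg_trans _ (flat m.+1 h @[h --> 0^'])).
      apply: near_eq_cvg; near=> h; rewrite fh//; near: h; exact: nbhs_dnbhs_neq.
    apply/cvgr0Pnorm_le => e e0; near=> h.
    rewrite ger0_norm ?flat_ge0//.
    have [h0|h0] := leP h 0; first by rewrite /flat ltNge h0 ltW.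
    apply: le_trans (flat_le m.+1 h0) _.
    rewrite -ler_pdivlMl ?ltr0n ?fact_gt0//.
    apply: le_trans (ler_norm _) _; near: h; apply: dnbhs0_le.
    by rewrite mulr_gt0// invr_gt0 ltr0n fact_gt0.
  by apply: DeriveDef; [apply/cvg_ex; exists 0|apply: cvg_lim].
Unshelve. all: by end_near. Qed.

Lemma Ck1_flat k m : Ck1 k (flat m).
Proof.
elim: k m => [|k IH] m.
  split=> // x; apply: differentiable_continuous; apply/derivable1_diffP.
  exact: (@ex_derive _ _ _ _ _ _ _ (is_derive_flat m x)).
split.
  move=> x; apply: differentiable_continuous; apply/derivable1_diffP.
  exact: (@ex_derive _ _ _ _ _ _ _ (is_derive_flat m x)).
split; first by move=> x; exact: (@ex_derive _ _ _ _ _ _ _ (is_derive_flat m x)).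
suff -> : derive1 (flat m) = (cst (- m%:R) \* flat m.+1) \+ flat m.+2.
  by apply: Ck1D => //; apply: Ck1M => //; exact: Ck1_cst.
by apply/funext => x; rewrite derive1E (@derive_val _ _ _ _ _ _ _ (is_derive_flat m x)).
Qed.

(* Vanishes outside [[a + 1/(n+1), b - 1/(n+1)]] and tends to the indicator
   of the open interval. *)
Definition plateau (a b : R) (n : nat) (x : R) : R :=
  flat 0 (n.+1%:R * (x - a) - 1) * flat 0 (n.+1%:R * (b - x) - 1).

Lemma smooth_plateau a b n : smooth1 (plateau a b n).
Proof.
move=> k; rewrite (_ : plateau a b n =
    (fun x => flat 0 (n.+1%:R * x + (- n.+1%:R * a - 1))) \*
    (fun x => flat 0 (- n.+1%:R * x + (n.+1%:R * b - 1)))).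
  by apply: Ck1M; apply: Ck1_affine; exact: Ck1_flat.
by apply/funext => x; rewrite /plateau /=; congr (flat 0 _ * flat 0 _); ring.
Qed.

Lemma plateau_ge0 a b n x : 0 <= plateau a b n x.
Proof. by rewrite mulr_ge0// flat_ge0. Qed.

Lemma flat0_le1 x : flat 0 x <= 1.
Proof.
rewrite /flat; case: ltP => // x0; rewrite expr0 mul1r expR_le1 oppr_le0.
by rewrite invr_ge0 ltW.
Qed.

Lemma plateau_le1 a b n x : plateau a b n x <= 1.
Proof. by rewrite mulr_ile1// ?flat_ge0// flat0_le1. Qed.

Lemma plateau_eq0 a b n x :
  ~~ (a + n.+1%:R^-1 <= x <= b - n.+1%:R^-1) -> plateau a b n x = 0.
Proof.
have n0 : 0 < n.+1%:R :> R by rewrite ltr0n.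
rewrite negb_and -!ltNge => /orP[h|h]; rewrite /plateau.
  rewrite {1}/flat ifF ?mul0r//; apply/negbTE; rewrite -leNgt subr_le0.
  by rewrite -ler_pdivlMl// mulr1 lerBlDl ltW.
rewrite {2}/flat ifF ?mulr0//; apply/negbTE; rewrite -leNgt subr_le0.
by rewrite -ler_pdivlMl// mulr1 lerBlDl -lerBlDr ltW.
Qed.

Lemma flat0_cvg1 (c : R) : 0 < c -> flat 0 (n.+1%:R * c - 1) @[n --> \oo] --> (1:R).
Proof.
move=> c0.
have hy : n.+1%:R * c - 1 @[n --> \oo] --> +oo.
  apply/cvgryPge => A; near=> n.
  rewrite lerBrDr -ler_pdivrMr//.
  apply: (@le_trans _ _ n%:R); last by rewrite ler_nat.
  by near: n; exact: nbhs_infty_ger.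
have hi : (n.+1%:R * c - 1)^-1 @[n --> \oo] --> (0:R).
  have hpos : \forall n \near \oo, 0 < n.+1%:R * c - 1.
    by move/cvgryPgt : hy; apply.
  exact: (gtr0_cvgV0 hpos).2 hy.
apply: (@cvg_trans _ (expR (- (n.+1%:R * c - 1)^-1) @[n --> \oo])).
  apply: near_eq_cvg; near=> n; rewrite /flat expr0 mul1r ifT//.
  by near: n; move/cvgryPgt : hy; apply.
have := cvg_comp _ _ (cvgN hi) (@continuous_expR R (- 0)).
by rewrite oppr0 expR0; apply.
Unshelve. all: by end_near. Qed.

Lemma plateau_cvg a b x : plateau a b n x @[n --> \oo] --> (\1_(`]a, b[%classic) x : R).
Proof.
rewrite indicE mem_setE in_itv/=; case: (boolP (a < x < b)) => [/andP[ax xb]|h].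
  rewrite (_ : true%:R = 1 * 1 :> R); last by rewrite mulr1.
  by apply: cvgM; apply: flat0_cvg1; rewrite subr_gt0.
rewrite (_ : (fun n => plateau a b n x) = cst 0); first exact: cvg_cst.
apply/funext => n; apply: plateau_eq0; apply: contra h => /andP[h1 h2].
have n0 : 0 < n.+1%:R^-1 :> R by rewrite invr_gt0 ltr0n.
apply/andP; split; first by rewrite (lt_le_trans _ h1)// ltrDl.
by rewrite (le_lt_trans h2)// gtrBl.
Qed.

End smooth1.

(** * Products of one-variable functions as test functions on the plane *)

Section tensor.
Variable R : realType.
Implicit Types (a b : R -> R).

Definition tensor a b (p : R * R) : R := a p.1 * b p.2.

Lemma is_derive_tensor1 a b (p : R * R) : (forall x, derivable a x 1) ->
  is_derive p ((1, 0) : R * R) (tensor a b) (tensor (derive1 a) b p).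
Proof.
move=> da.
have := (derivableP (da p.1)); rewrite -derive1E => -[da1 da2].
have E : (fun h : R => h^-1 *: ((tensor a b \o shift p) (h *: ((1, 0) : R * R)) - tensor a b p))
       = (fun h : R => (h^-1 *: ((a \o shift p.1) (h *: (1:R)) - a p.1)) * b p.2).
  apply/funext => h; rewrite /tensor /= /GRing.scale/= mulr0 add0r; ring.
have h : h^-1 *: ((tensor a b \o shift p) (h *: ((1, 0) : R * R)) - tensor a b p) @[h --> 0^'] --> tensor (derive1 a) b p.
  rewrite E /tensor; apply: cvgMl.
  by rewrite -da2 /derive; exact: da1.
by apply: DeriveDef; [apply/cvg_ex; eexists; exact: h|apply: cvg_lim].
Qed.

Lemma is_derive_tensor2 a b (p : R * R) : (forall x, derivable b x 1) ->
  is_derive p ((0, 1) : R * R) (tensor a b) (tensor a (derive1 b) p).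
Proof.
move=> db.
have := (derivableP (db p.2)); rewrite -derive1E => -[da1 da2].
have E : (fun h : R => h^-1 *: ((tensor a b \o shift p) (h *: ((0, 1) : R * R)) - tensor a b p))
       = (fun h : R => a p.1 * (h^-1 *: ((b \o shift p.2) (h *: (1:R)) - b p.2))).
  apply/funext => h; rewrite /tensor /= /GRing.scale/= mulr0 add0r; ring.
have h : h^-1 *: ((tensor a b \o shift p) (h *: ((0, 1) : R * R)) - tensor a b p) @[h --> 0^'] --> tensor a (derive1 b) p.
  rewrite E /tensor; apply: cvgMr.
  by rewrite -da2 /derive; exact: da1.
by apply: DeriveDef; [apply/cvg_ex; eexists; exact: h|apply: cvg_lim].
Qed.

Lemma smooth1_derivable a : smooth1 a -> forall x, derivable a x 1.
Proof. by move=> /(_ 1%N)[_ [da _]]. Qed.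

Lemma smooth1_derive a : smooth1 a -> smooth1 (derive1 a).
Proof. by move=> sa k; case: (sa k.+1) => _ []. Qed.

Lemma smooth1_continuous a : smooth1 a -> continuous a.
Proof. by move=> /(_ 0%N)[]. Qed.

Lemma partial10_tensor a b : smooth1 a ->
  'D_((1, 0) : R * R) (tensor a b) = tensor (derive1 a) b.
Proof.
move=> sa; apply/funext => p.
have d := is_derive_tensor1 b p (smooth1_derivable sa).
exact: (@derive_val _ _ _ _ _ _ _ d).
Qed.

Lemma partial01_tensor a b : smooth1 b ->
  'D_((0, 1) : R * R) (tensor a b) = tensor a (derive1 b).
Proof.
move=> sb; apply/funext => p.
have d := is_derive_tensor2 a p (smooth1_derivable sb).
exact: (@derive_val _ _ _ _ _ _ _ d).
Qed.

Lemma continuous_tensor a b : continuous a -> continuous b ->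
  continuous (tensor a b).
Proof.
move=> ca cb p; apply: cvgM.
  by apply: (@continuous_comp _ _ _ fst a); [exact: cvg_fst|exact: ca].
by apply: (@continuous_comp _ _ _ snd b); [exact: cvg_snd|exact: cb].
Qed.

Lemma Ck_tensor k a b : smooth1 a -> smooth1 b -> Ck k (tensor a b).
Proof.
elim: k a b => [|k IH] a b sa sb; split => //.
- exact: continuous_tensor (smooth1_continuous sa) (smooth1_continuous sb).
- exact: continuous_tensor (smooth1_continuous sa) (smooth1_continuous sb).
split.
- move=> p; have d := is_derive_tensor1 b p (smooth1_derivable sa).
  exact: (@ex_derive _ _ _ _ _ _ _ d).
- move=> p; have d := is_derive_tensor2 a p (smooth1_derivable sb).
  exact: (@ex_derive _ _ _ _ _ _ _ d).
- rewrite /partial /= partial10_tensor//; apply: IH => //.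
  exact: smooth1_derive.
- rewrite /partial /= partial01_tensor//; apply: IH => //.
  exact: smooth1_derive.
Qed.

Lemma test_function_tensor (Q : set (R * R)) (c d e f : R) a b :
  smooth1 a -> smooth1 b ->
  (forall x, ~~ (c <= x <= d) -> a x = 0) ->
  (forall y, ~~ (e <= y <= f) -> b y = 0) ->
  `[c, d] `*` `[e, f] `<=` Q ->
  test_function Q (tensor a b).
Proof.
move=> sa sb a0 b0 BQ.
have cB : compact (`[c, d] `*` `[e, f]).
  by apply: compact_setX; exact: segment_compact.
have sB : closure [set p | tensor a b p != 0] `<=` `[c, d] `*` `[e, f].
  have clB : closed (`[c, d] `*` `[e, f]).
    by apply: compact_closed => //; exact: norm_hausdorff.
  rewrite [X in _ `<=` X]((closure_id _).1 clB); apply: closure_subset.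
  move=> [x y]/=; rewrite /tensor/= => ab0; split => /=; rewrite in_itv/=.
    by apply/negPn/negP => /a0 xE; rewrite xE mul0r eqxx in ab0.
  by apply/negPn/negP => /b0 xE; rewrite xE mulr0 eqxx in ab0.
split.
- by move=> k; exact: Ck_tensor.
- by apply: (subclosed_compact _ cB sB); exact: closed_closure.
- exact: subset_trans sB BQ.
Qed.

Lemma derive1_supp (c d : R) a : smooth1 a ->
  (forall x, ~~ (c <= x <= d) -> a x = 0) ->
  (forall x, ~~ (c <= x <= d) -> derive1 a x = 0).
Proof.
move=> sa a0 x; rewrite negb_and -!ltNge => h.
have ax : \forall z \near x, a z = cst 0 z.
  case/orP: h => h.
    near=> z; apply: a0; rewrite negb_and -ltNge; apply/orP; left.
    near: z; exact: lt_nbhsl.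
  near=> z; apply: a0; rewrite negb_and -!ltNge; apply/orP; right.
  near: z; exact: lt_nbhsr.
by rewrite derive1E (near_eq_derive (1 : R) ax) derive_cst.
Unshelve. all: by end_near. Qed.

Local Notation mu := (@lebesgue_measure R).

Lemma continuous_integrable_itv (f : R -> R) (c d : R) : continuous f ->
  mu.-integrable `[c, d] (EFin \o f).
Proof.
move=> cf; apply: continuous_compact_integrable; first exact: segment_compact.
exact: continuous_subspaceT.
Qed.

(** The antiderivative taken from the left vanishes before [c]; the zero mean makes it vanish beyond
    [d] too. Zero mean thus singles out the derivatives among test functions, which is how
    [box_derivative] uses it. *)
Lemma smooth1_antiderivative (c d : R) (f : R -> R) : c < d -> smooth1 f ->
  (forall x, ~~ (c <= x <= d) -> f x = 0) ->
  (\int[mu]_(x in `[c, d]) f x = 0)%R ->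
  exists2 a, smooth1 a /\ (forall x, ~~ (c <= x <= d) -> a x = 0) &
    derive1 a = f.
Proof.
move=> cd sf f0 If.
have cf := smooth1_continuous sf.
(* Starting at [c - 1] keeps every [x >= c], the point [c] included, strictly to the right of the
   lower limit, as the fundamental theorem requires. *)
pose a x := (\int[mu]_(t in `[(c - 1)%R, x]) f t)%R.
have ac x : x < c -> a x = 0.
  move=> xc; rewrite /a /Rintegral integral0_eq// => t /=.
  rewrite in_itv/= => /andP[_ tx]; rewrite f0//.
  by rewrite negb_and -ltNge (le_lt_trans tx xc).
have ad x : d < x -> a x = 0.
  move=> dx; rewrite -If /a Rintegral_mkcond [RHS]Rintegral_mkcond.
  apply: eq_Rintegral => t _; rewrite !patchE !mem_setE !in_itv/=.
  case: (boolP (c <= t <= d)) => [/andP[ct td]|/f0 ->]; last by case: ifP.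
  by rewrite ifT//; apply/andP; split; lra.
have a0 x : ~~ (c <= x <= d) -> a x = 0.
  by rewrite negb_and -!ltNge => /orP[/ac|/ad].
have da x : derivable a x 1 /\ derive1 a x = f x.
  have [xc|xc] := ltP x c.
    have axE : \forall z \near x, cst 0 z = a z.
      by near=> z; rewrite ac//; near: z; exact: lt_nbhsl.
    have [d1 d2] := near_eq_is_derive axE (is_derive_cst (0:R) x (1:R)).
    by split => //; rewrite derive1E d2 f0// negb_and -ltNge xc.
  apply: (@continuous_FTC1_closed _ f (c - 1) x (x + 1)).
  - by rewrite ltrDl.
  - exact: continuous_integrable_itv.
  - lra.
  - exact: cf.
have a'f : derive1 a = f by apply/funext => x; case: (da x).
exists a => //; split => //.
have ca : continuous a.
  move=> x; apply: differentiable_continuous; apply/derivable1_diffP.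
  exact: (da x).1.
case=> [|k]; split => //; split; first by move=> x; exact: (da x).1.
rewrite -/(Ck1 k _) a'f; exact: sf.
Unshelve. all: by end_near. Qed.
End tensor.

(** * Almost-everywhere bookkeeping *)

Section ae.
Context d (T : measurableType d) (R : realType).
Variable mu : {measure set T -> \bar R}.

Lemma ae_imply (P Q : T -> Prop) : (forall x, P x -> Q x) ->
  {ae mu, forall x, P x} -> {ae mu, forall x, Q x}.
Proof. by move=> PQ; apply: filterS. Qed.

Lemma ae_imply2 (P Q S : T -> Prop) : (forall x, P x -> Q x -> S x) ->
  {ae mu, forall x, P x} -> {ae mu, forall x, Q x} -> {ae mu, forall x, S x}.
Proof. by move=> PQ; apply: filterS2. Qed.

Lemma ae_eq_integrable (f g : T -> \bar R) : measurable_fun setT g ->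
  ae_eq mu setT f g -> mu.-integrable setT f -> mu.-integrable setT g.
Proof.
move=> mg fg /integrableP[mf foo]; apply/integrableP; split => //.
rewrite (ae_eq_integral (abse \o f))//; [exact: measurableT_comp..|].
exact/ae_eq_sym/ae_eq_abse.
Qed.

End ae.

(** * Functions whose integrals over intervals or rectangles vanish *)

Section uniqueness.
Variable R : realType.
Local Notation mu := (@lebesgue_measure R).

Lemma rat_between (x y : R) : x < y -> exists q : rat, x < ratr q < y.
Proof. by move=> xy; have [q] := rat_in_itvoo xy; rewrite in_itv/=; exists q. Qed.

(** By Lebesgue differentiation the primitive [F] has derivative [h] almost everywhere. [F] is
    constant on the rationals, so at a point of differentiability its value and its difference
    quotients can be computed along rationals. Rational endpoints let [integral2_itv_eq0] discard
    only countably many null sets. *)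
Lemma integral_rat_itv_eq0 (h : R -> R) : mu.-integrable setT (EFin \o h) ->
  (forall p q : rat, \int[mu]_(x in `]ratr p, ratr q[) h x = 0) ->
  {ae mu, forall x, h x = 0}.
Proof.
move=> ih h0.
have ihS (A : set R) : measurable A -> mu.-integrable A (EFin \o h).
  by move=> mA; apply: (integrableS _ _ _ ih).
pose F x := (\int[mu]_(t in [set` `]-oo, x]]) (h t))%R.
have : {ae mu, forall x, derivable F x 1 /\ derive1 F x = h x}.
  apply: FTC1Ny; first by move=> y; exact: ihS.
  exact: open_integrable_locally openT ih.
have Fpq (p q : rat) : (p < q)%O -> F (ratr p) = F (ratr q).
  move=> pq; apply/esym/eqP; rewrite -subr_eq0; apply/eqP.
  rewrite /F Rintegral_itvB ?bnd_simp//; [|exact: ihS|by rewrite ler_rat ltW].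
  rewrite -Rintegral_itv_bndo_bndc ?h0//; exact: ihS.
have Fr (p : rat) : F (ratr p) = F 0.
  have [p0|p0|->] := ltgtP p 0; last by rewrite rmorph0.
  - by rewrite (Fpq _ _ p0) rmorph0.
  - by rewrite -(Fpq _ _ p0) rmorph0.
apply: ae_imply => x [dF <-].
have cF : {for x, continuous F}.
  by apply: differentiable_continuous; apply/derivable1_diffP.
have Fx : F x = F 0.
  apply/eqP/negPn/negP => /eqP Fx0.
  have /cvgrPdist_lt/(_ `|F x - F 0|) : F z @[z --> x] --> F x by exact: cF.
  rewrite normr_gt0 subr_eq0 => /(_ (introN eqP Fx0)).
  move=> /nbhs_ballP[e /= e0 he].
  have [q /andP[xq qxe]] := @rat_between x (x + e) (ltac:(by rewrite ltrDl)).
  have := he (ratr q); rewrite Fr ltxx /ball/= => /(_ _)/negP; apply => //.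
  by rewrite ltr_norml; apply/andP; split; lra.
apply/eqP/negPn/negP => /eqP F'x.
move: dF => /derivableP; rewrite -derive1E => -[dF1 dF2].
have : h^-1 *: ((F \o shift x) (h *: (1:R)) - F x) @[h --> 0^'] --> derive1 F x.
  by rewrite -dF2; exact: dF1.
move=> /cvgrPdist_lt/(_ `|derive1 F x|); rewrite normr_gt0 => /(_ (introN eqP F'x)).
move=> /nbhs_ballP[e /= e0 he].
have [q /andP[xq qxe]] := @rat_between x (x + e) (ltac:(by rewrite ltrDl)).
have E : (ratr q - x)^-1 *: ((F \o shift x) ((ratr q - x) *: (1 : R)) - F x) = 0.
  by rewrite /= [_ *: (1 : R)]mulr1 subrK Fr Fx subrr scaler0.
have A : ball (0:R) e (ratr q - x).
  by rewrite /ball/= sub0r normrN ltr_norml; apply/andP; split; lra.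
have B : ratr q - x != 0 by rewrite subr_eq0 gt_eqF.
have {}he : `|derive1 F x - 0| < `|derive1 F x|.
  by rewrite -[X in _ - X]E; exact: he A B.
by rewrite subr0 ltxx in he.
Qed.

Local Notation mu2 := (mu \x mu)%E.

(** Two uses of the one-variable statement: for almost every [x] the integrals of [h (x, y)] over
    all rational [y]-intervals vanish simultaneously, hence the section at [x] vanishes almost
    everywhere. Tonelli for [|h|] concludes. *)
Lemma integral2_itv_eq0 (h : R * R -> R) : mu2.-integrable setT (EFin \o h) ->
  (forall a b c d : R,
     \int[mu2]_p (h p * (\1_(`]a, b[%classic) p.1 * \1_(`]c, d[%classic) p.2)) = 0) ->
  {ae mu2, forall p, h p = 0}.
Proof.
move=> ih h0.
pose hI (a b : R) p := h p * (\1_(`]a, b[%classic) p.2 : R).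
have mh : measurable_fun setT h by apply/measurable_EFinP; exact: measurable_int ih.
have ihI a b : mu2.-integrable setT (EFin \o hI a b).
  apply: (le_integrable _ _ _ ih) => //.
    apply/measurable_EFinP; apply: measurable_funM => //.
    by apply: measurableT_comp => //; exact: measurable_snd.
  move=> p _; rewrite /= lee_fin /hI normrM ler_piMr// indicE.
  by case: (_ \in _); rewrite ?normr0 ?normr1.
pose c (a b : R) x := fine (\int[mu]_y (hI a b (x, y))%:E)%E.
have cE a b : ae_eq mu setT (EFin \o c a b) (fubini_F mu (EFin \o hI a b)).
  have := integrable_ae measurableT (integrable_fubini_F (ihI a b)).
  by apply: ae_imply => y /(_ I) fy _; rewrite /c /= fineK.
have mc a b : measurable_fun setT (c a b).
  apply: measurableT_comp => //.
  exact: measurable_fubini_F (ihI a b).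
have ic a b : mu.-integrable setT (EFin \o c a b).
  apply: (ae_eq_integrable _ (ae_eq_sym (cE a b))).
  - by apply/measurable_EFinP; exact: mc.
  - exact: integrable_fubini_F.
have c0 a b : {ae mu, forall y, c a b y = 0}.
  apply: integral_rat_itv_eq0 => // p q.
  rewrite Rintegral_mkcond -[RHS](h0 (ratr p) (ratr q) a b).
  pose k z := hI a b z * (\1_(`]ratr p, ratr q[%classic) z.1 : R).
  have ik : mu2.-integrable setT (EFin \o k).
    apply: (le_integrable _ _ _ (ihI a b)) => //.
      apply/measurable_EFinP; apply: measurable_funM => //.
        by apply/measurable_EFinP; exact: measurable_int (ihI a b).
      by apply: measurableT_comp => //; exact: measurable_fst.
    move=> z _; rewrite /= lee_fin /k normrM ler_piMr// indicE.
    by case: (_ \in _); rewrite ?normr0 ?normr1.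
  transitivity (\int[mu2]_z k z); last first.
    by apply: eq_Rintegral => z _; rewrite /k /hI /= mulrA mulrAC.
  rewrite /Rintegral -(integral12_prod_meas1 ik); congr fine.
  apply: ae_eq_integral => //.
  - apply/measurable_EFinP/measurable_restrict => //.
    exact: measurable_funS (mc a b).
  - exact: (measurable_fubini_F ik).
  have := cE a b; apply: ae_imply => y /(_ I) cy _; rewrite /fubini_F /=.
  rewrite patchE; case: ifPn => yI.
    transitivity (fubini_F mu (EFin \o hI a b) y); first exact: cy.
    apply: eq_integral => x _; rewrite /k /= indicE.
    by rewrite yI mulr1.
  rewrite integral0_eq// => x _; rewrite /k /= indicE.
  by rewrite (negbTE yI) mulr0.
have c0' : {ae mu, forall y, forall n : nat, 
    if unpickle n is Some (p, q) then c (ratr p) (ratr q) y = 0 else True}.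
  apply/ae_foralln => n.
  by case: (unpickle n) => [[p q]|]; [exact: c0|exact: aeW].
have h0' : {ae mu, forall x, (\int[mu]_y `|(h (x, y))%:E| = 0)%E}.
  have := ae_integrable1 ih; move: c0'; apply: ae_imply2 => y cy iy.
  apply/(ae_eq_integral_abs mu measurableT).
    by case/integrableP : iy.
  have : {ae mu, forall x, h (y, x) = 0}.
    apply: integral_rat_itv_eq0 => // p q.
    have := cy (pickle (p, q)); rewrite pickleK /c /hI => <-.
    rewrite Rintegral_mkcond /Rintegral; congr fine; apply: eq_integral => x _.
    by rewrite /= patchE indicE; case: ifP; rewrite ?mulr1 ?mulr0.
  by apply: ae_imply => x hx _; rewrite /= hx.
have : (\int[mu2]_p `|(h p)%:E| = 0)%E.
  have mah : measurable_fun setT (fun p => `|(h p)%:E|)%E.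
    by apply/measurableT_comp => //; exact/measurable_EFinP.
  transitivity (\int[mu]_x fubini_F mu (fun p => `|(h p)%:E|)%E x)%E.
    exact: fubini_tonelli1.
  rewrite (ae_eq_integral (cst 0%E))//; first by rewrite integral0.
    exact: measurable_fun_fubini_tonelli_F.
  by move: h0'; apply: ae_imply => x hx _; rewrite /fubini_F.
move/(ae_eq_integral_abs mu2 measurableT (measurable_int _ ih)).
by apply: ae_imply => p /(_ I)/= [].
Qed.

End uniqueness.

(** * Exchange of the two coordinates, and sections of null sets *)

Section swap.
Variable R : realType.
Local Notation mu := (@lebesgue_measure R).
Local Notation mu2 := (mu \x mu)%E.
Local Notation swap := (@swap R R).

Lemma measurable_preswap (A : set (R * R)) : measurable A -> measurable (swap @^-1` A).
Proof. by move=> mA; rewrite -[X in measurable X]setTI; exact: measurable_swap. Qed.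

Lemma tonelli1 (f : R * R -> \bar R) : measurable_fun setT f ->
  (forall p, 0 <= f p)%E ->
  (\int[mu2]_p f p = \int[mu]_x \int[mu]_y f (x, y))%E.
Proof. by move=> mf f0; exact: fubini_tonelli1. Qed.

Lemma tonelli2 (f : R * R -> \bar R) : measurable_fun setT f ->
  (forall p, 0 <= f p)%E ->
  (\int[mu2]_p f p = \int[mu]_y \int[mu]_x f (x, y))%E.
Proof. by move=> mf f0; exact: fubini_tonelli2. Qed.

Lemma ge0_integral_swap (f : R * R -> \bar R) : measurable_fun setT f ->
  (forall p, 0 <= f p)%E -> (\int[mu2]_p f (swap p) = \int[mu2]_p f p)%E.
Proof.
move=> mf f0.
have mfs : measurable_fun setT (f \o swap).
  by apply: measurableT_comp => //; exact: measurable_swap.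
rewrite (tonelli2 mf f0).
exact: (@tonelli1 (f \o swap) mfs (fun p => f0 _)).
Qed.

Lemma integral_swap (f : R * R -> \bar R) : measurable_fun setT f ->
  (\int[mu2]_p f (swap p) = \int[mu2]_p f p)%E.
Proof.
move=> mf.
have E1 := ge0_integral_swap (measurable_funepos mf) (fun p => funepos_ge0 f p).
have E2 := ge0_integral_swap (measurable_funeneg mf) (fun p => funeneg_ge0 f p).
rewrite (_ : (fun p => f (swap p)) = f \o swap)// integralE [RHS]integralE.
by rewrite funepos_comp funeneg_comp -[in RHS]E1 -[in RHS]E2.
Qed.

Lemma Rintegral_swap (Q : set (R * R)) (f : R * R -> R) : measurable Q ->
  measurable_fun Q f ->
  \int[mu2]_(p in swap @^-1` Q) f (swap p) = \int[mu2]_(p in Q) f p.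
Proof.
move=> mQ mf; rewrite Rintegral_mkcond [RHS]Rintegral_mkcond.
rewrite /Rintegral -(integral_swap (f := fun p => ((f \_ Q) p)%:E)); last first.
  by apply/measurable_EFinP; exact: (measurable_restrictT f mQ).1.
by congr fine; apply: eq_integral => p _; rewrite !patchE.
Qed.

Lemma measure_swap (A : set (R * R)) : measurable A ->
  mu2 (swap @^-1` A) = mu2 A.
Proof.
move=> mA; have mSA := measurable_preswap mA.
transitivity (\int[mu2]_p (\1_(swap @^-1` A) p)%:E)%E.
  by rewrite integral_indic// setIT.
transitivity (\int[mu2]_p (\1_A p)%:E)%E; last by rewrite integral_indic// setIT.
rewrite -(ge0_integral_swap (f := fun p => (\1_A p)%:E)).
- by [].
- by apply/measurable_EFinP; exact: measurable_indic.
- by move=> p; rewrite lee_fin.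
Qed.

Lemma ae_xsection (N : set (R * R)) : measurable N -> mu2 N = 0 ->
  {ae mu, forall x, mu (xsection N x) = 0}.
Proof.
move=> mN N0.
have : (\int[mu]_x `|mu (xsection N x)| = 0)%E.
  by under eq_integral do rewrite gee0_abs//; exact: N0.
move/(ae_eq_integral_abs mu measurableT (measurable_fun_xsection mu mN)).1.
by apply: ae_imply => x /(_ I).
Qed.

Lemma ae_ysection (N : set (R * R)) : measurable N -> mu2 N = 0 ->
  {ae mu, forall y, mu (ysection N y) = 0}.
Proof.
move=> mN N0.
have := ae_xsection (measurable_preswap mN) (etrans (measure_swap mN) N0).
apply: ae_imply => y; suff -> : ysection N y = xsection (swap @^-1` N) y by [].
by apply/seteqP; split => x; rewrite /ysection /xsection /= !inE.
Qed.

Lemma ae_xsection_notin (N : set (R * R)) : measurable N -> mu2 N = 0 ->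
  {ae mu, forall x, {ae mu, forall y, ~ N (x, y)}}.
Proof.
move=> mN N0; have := ae_xsection mN N0; apply: ae_imply => x Nx.
exists (xsection N x); split => //; first exact: measurable_xsection.
by move=> y /= /contrapT Nxy; rewrite /xsection/= inE.
Qed.

Lemma ae_ysection_notin (N : set (R * R)) : measurable N -> mu2 N = 0 ->
  {ae mu, forall y, {ae mu, forall x, ~ N (x, y)}}.
Proof.
move=> mN N0; have := ae_ysection mN N0; apply: ae_imply => x Nx.
exists (ysection N x); split => //; first exact: measurable_ysection.
by move=> y /= /contrapT Nxy; rewrite /ysection/= inE.
Qed.

Lemma setX_null (A : set R) : measurable A -> mu A = 0 ->
  mu2 (A `*` setT) = 0 /\ mu2 (setT `*` A) = 0.
Proof. by move=> mA A0; rewrite !product_measure1E//= A0 mul0e mule0. Qed.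

End swap.

(** * Generic points of small value, and the Cauchy-Schwarz inequality *)

Section real_estimates.
Variable R : realType.
Local Notation mu := (@lebesgue_measure R).

Lemma ae_exists_itv (a b : R) (P : R -> Prop) : a < b ->
  {ae mu, forall x, P x} -> exists2 x, a < x < b & P x.
Proof.
move=> ab [N [mN N0 PN]]; apply: contrapT => h.
have : `]a, b[ `<=` N.
  move=> x /=; rewrite in_itv/= => xab; apply: PN => /= Px; apply: h.
  by exists x.
move=> abN; have : (mu `]a, b[%classic <= mu N)%E.
  by apply: le_measure => //; rewrite inE//; exact: measurable_itv.
rewrite [X in (_ <= X)%E](_ : mu N = 0%E)// lebesgue_measure_itv/= lte_fin ab.
by rewrite -EFinB lee_fin leNgt subr_gt0 ab.
Qed.

(** Otherwise [f] would exceed [m / (b - a)] almost everywhere and its integral would be at least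
    [m]. The property [P] lets the point avoid exceptional sets. *)
Lemma ae_exists_le (a b m : R) (f : R -> R) (P : R -> Prop) : a < b ->
  measurable_fun `]a, b[ f -> (forall x, 0 <= f x) ->
  (\int[mu]_(x in `]a, b[) (f x)%:E < m%:E)%E ->
  {ae mu, forall x, P x} ->
  exists x, [/\ a < x < b, P x & f x <= m / (b - a)].
Proof.
move=> ab mf f0 fm Pae; apply: contrapT => h.
have ba : 0 < b - a by rewrite subr_gt0.
have : (\int[mu]_(x in `]a, b[) (m / (b - a))%:E <= \int[mu]_(x in `]a, b[) (f x)%:E)%E.
  apply: ae_ge0_le_integral => //.
  - move=> x _; rewrite lee_fin divr_ge0//; last exact: ltW.
    rewrite -lee_fin; apply: le_trans (ltW fm); apply: integral_ge0 => z _.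
    by rewrite lee_fin.
  - by move=> x _; rewrite lee_fin.
  - exact/measurable_EFinP.
  move: Pae; apply: ae_imply => x Px xab; rewrite lee_fin ltW// ltNge.
  apply/negP => fx; apply: h; exists x; split => //.
apply/negP; rewrite -ltNge integral_cst//= lebesgue_measure_itv/= lte_fin ab.
by rewrite -EFinB -EFinM divfK ?gt_eqF.
Qed.

Lemma cauchy_schwarz d (T : measurableType d) (nu : {measure set T -> \bar R})
    (D : set T) (f : T -> R) (l m : R) : measurable D ->
  measurable_fun D f -> 0 < l -> 0 < m -> (nu D <= l%:E)%E ->
  (\int[nu]_(x in D) (f x ^+ 2)%:E <= m%:E)%E ->
  (\int[nu]_(x in D) (`|f x|)%:E <= (Num.sqrt (l * m))%:E)%E.
Proof.
move=> mD mf l0 m0 nuD fm.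
(* The weight that minimises [k / 2 * m + k^-1 / 2 * l]; the minimum is [sqrt (l * m)]. *)
pose k := Num.sqrt (l / m).
have k0 : 0 < k by rewrite sqrtr_gt0 divr_gt0.
have le_amgm (z : R) : `|z| <= k / 2 * z ^+ 2 + k^-1 / 2.
  have k1 : k * k^-1 = 1 by rewrite divff ?gt_eqF.
  have : 0 <= k * (`|z| - k^-1) ^+ 2 by rewrite mulr_ge0 ?sqr_ge0 ?ltW.
  have -> : k * (`|z| - k^-1) ^+ 2 = k * z ^+ 2 - 2 * (k * k^-1) * `|z| + k * k^-1 * k^-1.
    by rewrite -[in RHS](real_normK (num_real z)); ring.
  rewrite k1; lra.
apply: (@le_trans _ _ (\int[nu]_(x in D) ((k / 2)%:E * (f x ^+ 2)%:E + (k^-1 / 2)%:E))%E).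
  apply: ge0_le_integral => //.
  - exact/measurable_EFinP/measurableT_comp.
  - apply: emeasurable_funD => //; apply: emeasurable_funM => //.
    by apply/measurable_EFinP; exact: measurable_funX.
  by move=> x _; rewrite -EFinM -EFinD lee_fin.
have mf2 : measurable_fun D (fun x => (f x ^+ 2)%:E).
  by apply/measurable_EFinP; exact: measurable_funX.
have kk : 0 <= k / 2 by rewrite divr_ge0 ?ltW.
have kk' : 0 <= k^-1 / 2 by rewrite divr_ge0 ?invr_ge0 ?ltW.
rewrite ge0_integralD//; last 2 first.
- by move=> x _; rewrite -EFinM lee_fin mulr_ge0 ?sqr_ge0.
- exact: emeasurable_funM.
rewrite ge0_integralZl//; last by move=> x _; rewrite lee_fin sqr_ge0.
rewrite integral_cst//.
apply: (@le_trans _ _ ((k / 2)%:E * m%:E + (k^-1 / 2)%:E * l%:E)%E).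
  apply: leeD.
    by apply: lee_wpmul2l.
  by apply: lee_wpmul2l.
rewrite -!EFinM -EFinD lee_fin.
have sl : Num.sqrt l ^+ 2 = l by rewrite sqr_sqrtr ?ltW.
have sm : Num.sqrt m ^+ 2 = m by rewrite sqr_sqrtr ?ltW.
have sl0 : Num.sqrt l != 0 by rewrite gt_eqF// sqrtr_gt0.
have sm0 : Num.sqrt m != 0 by rewrite gt_eqF// sqrtr_gt0.
have -> : k = Num.sqrt l / Num.sqrt m by rewrite /k sqrtrM ?ltW// sqrtrV ?ltW.
rewrite sqrtrM; last exact: ltW.
suff -> : Num.sqrt l / Num.sqrt m / 2 * m + (Num.sqrt l / Num.sqrt m)^-1 / 2 * l
    = Num.sqrt l * Num.sqrt m by [].
rewrite -[X in _ * X + _]sm -[X in _ + _ * X]sl; field.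
by rewrite sl0 sm0.
Qed.

End real_estimates.

(** * Passing to the limit under bounded factors *)

Section bounded_convergence.
Context d (T : measurableType d) (R : realType).
Variable nu : {measure set T -> \bar R}.

Lemma integrableM_bounded (h u : T -> R) (C : R) :
  nu.-integrable setT (EFin \o h) -> measurable_fun setT u ->
  (forall x, `|u x| <= C) -> nu.-integrable setT (EFin \o (h \* u)).
Proof.
move=> ih mu uC.
have mh : measurable_fun setT h by apply/measurable_EFinP; case/integrableP : ih.
apply: (@le_integrable _ _ _ _ _ measurableT _ (fun x => (C%:E * (h x)%:E)%E)).
- by apply/measurable_EFinP; exact: measurable_funM.
- move=> x _; rewrite /= lee_fin !normrM mulrC ler_wpM2r//.
  exact: le_trans (uC x) (ler_norm C).
- exact: integrableZl.
Qed.

Lemma Rintegral_bounded_cvg (h : T -> R) (u_ : nat -> T -> R) (u : T -> R) (C : R) :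
  nu.-integrable setT (EFin \o h) ->
  (forall n, measurable_fun setT (u_ n)) -> measurable_fun setT u ->
  (forall n x, `|u_ n x| <= C) -> (forall x, u_ n x @[n --> \oo] --> u x) ->
  \int[nu]_x (h x * u_ n x) @[n --> \oo] --> \int[nu]_x (h x * u x).
Proof.
move=> ih mu_ mu uC ucvg.
have mh : measurable_fun setT h by apply/measurable_EFinP; case/integrableP : ih.
have iC : nu.-integrable setT (fun x => (C%:E * `|(h x)%:E|)%E).
  by apply: integrableZl => //; exact: integrable_abse.
have m1 n : measurable_fun setT (fun x => (h x * u_ n x)%:E).
  by apply/measurable_EFinP; exact: measurable_funM.
have m2 : measurable_fun setT (fun x => (h x * u x)%:E).
  by apply/measurable_EFinP; exact: measurable_funM.
have c1 : {ae nu, forall x, setT x -> (h x * u_ n x)%:E @[n --> \oo] --> (h x * u x)%:E}.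
  apply: aeW => x _; apply: cvg_EFin; first exact: nearW.
  exact: (cvgM (cvg_cst (h x)) (ucvg x)).
have d1 : {ae nu, forall x n, setT x -> (`|(h x * u_ n x)%:E| <= C%:E * `|(h x)%:E|)%E}.
  by apply: aeW => x n _; rewrite /= lee_fin normrM mulrC ler_wpM2r.
have [i_hu _ cvg] := dominated_convergence measurableT m1 m2 c1 iC d1.
apply: fine_cvg; rewrite fineK//.
exact: (integrable_fin_num measurableT i_hu).
Qed.

End bounded_convergence.

(** * Primitives along rows and integration by parts *)

Section product.
Variable R : realType.
Local Notation mu := (@lebesgue_measure R).
Local Notation mu2 := (mu \x mu)%E.

Lemma integrableST (A : set R) (h : R -> R) : measurable A ->
  mu.-integrable setT (EFin \o h) -> mu.-integrable A (EFin \o h).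
Proof. by move=> mA ih; apply: (integrableS _ _ _ ih). Qed.

Lemma continuous_integrable_oo (f : R -> R) (c d : R) : continuous f ->
  mu.-integrable `]c, d[ (EFin \o f).
Proof.
move=> cf; apply: (integrableS _ _ _ (continuous_integrable_itv c d cf)) => //.
exact: subset_itv_oo_cc.
Qed.

Lemma measurable_fst_comp (u : R -> R) : measurable_fun setT u ->
  measurable_fun setT (fun p : R * R => u p.1).
Proof. by move=> mu; apply: measurableT_comp => //; exact: measurable_fst. Qed.

Lemma measurable_snd_comp (u : R -> R) : measurable_fun setT u ->
  measurable_fun setT (fun p : R * R => u p.2).
Proof. by move=> mu; apply: measurableT_comp => //; exact: measurable_snd. Qed.

Lemma Rintegral_fubini (h : R * R -> R) : mu2.-integrable setT (EFin \o h) ->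
  (\int[mu2]_p (h p)%:E = \int[mu]_y \int[mu]_x (h (x, y))%:E)%E.
Proof. by move=> ih; apply/esym; exact: (integral21_prod_meas1 ih). Qed.

Lemma integrable_section (h : R * R -> R) : mu2.-integrable setT (EFin \o h) ->
  {ae mu, forall y, mu.-integrable setT (fun x => (h (x, y))%:E)}.
Proof. by move=> ih; exact: (ae_integrable2 ih). Qed.

Definition prim (g : R * R -> R) (p : R * R) : R :=
  \int[mu]_(xi in `]0%R, p.1[) g (xi, p.2).

Lemma measurable_indic_oo :
  measurable_fun setT (fun p : R * R => \1_(`]0%R, p.1[%classic) p.2 : R).
Proof.
rewrite (_ : (fun p => _) = \1_[set p : R * R | 0 < p.2 < p.1]); last first.
  apply/funext => q; rewrite !indicE mem_setE in_itv/=.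
  have -> : (q \in [set q : R * R | 0 < q.2 < q.1]) = (0 < q.2 < q.1).
    by apply/idP/idP => [/set_mem//|q0]; apply/mem_set.
  by [].
apply: measurable_indic.
rewrite (_ : mkset _ = [set q : R * R | 0 < q.2] `&` [set q | q.2 < q.1]); last first.
  by apply/seteqP; split => q /=; [move=> /andP[]|move=> [-> ->]].
have m0 : measurable_fun setT (fun _ : R * R => 0 : R) by exact: measurable_cst.
have h1 : measurable ((fun q : R * R => 0 < q.2) @^-1` [set true]).
  by rewrite -[X in measurable X]setTI; exact: (measurable_fun_ltr m0 measurable_snd).
have h2 : measurable ((fun q : R * R => q.2 < q.1) @^-1` [set true]).
  rewrite -[X in measurable X]setTI.
  exact: (measurable_fun_ltr measurable_snd measurable_fst).
exact: measurableI.
Qed.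

Lemma measurable_prim (g : R * R -> R) : measurable_fun setT g ->
  measurable_fun setT (prim g).
Proof.
move=> mg.
(* The moving endpoint becomes an indicator in an extra variable: the primitive is then a
   parametrised integral over the whole line, and Tonelli gives the measurability of its positive
   and negative parts. *)
pose T (q : (R * R) * R) : R := g (q.2, q.1.2) * \1_(`]0%R, q.1.1[%classic) q.2.
have mT : measurable_fun setT T.
  apply: measurable_funM.
    apply: measurableT_comp => //; apply: measurable_fun_pair.
      exact: measurable_snd.
    by apply: (measurableT_comp measurable_snd); exact: measurable_fst.
  have mi : measurable_fun setT (fun q : (R * R) * R => (q.1.1, q.2)).
    apply: measurable_fun_pair; last exact: measurable_snd.
    by apply: (measurableT_comp measurable_fst); exact: measurable_fst.
  exact: (measurableT_comp measurable_indic_oo mi).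
have -> : prim g = (fun p => fine (fubini_F mu ((EFin \o T)^\+) p - fubini_F mu ((EFin \o T)^\-) p)%E).
  apply/funext => p; rewrite /prim Rintegral_mkcond /Rintegral integralE; congr fine.
  rewrite /fubini_F; congr (_ - _)%E; apply: eq_integral => x _;
    rewrite !unlock /T /= patchE indicE; case: ifP; rewrite ?mulr1 ?mulr0//.
apply: measurableT_comp => //; apply: emeasurable_funB.
- apply: (@measurable_fun_fubini_tonelli_F _ _ _ _ _ mu) => //.
  by apply: measurable_funepos; apply/measurable_EFinP.
- apply: (@measurable_fun_fubini_tonelli_F _ _ _ _ _ mu) => //.
  by apply: measurable_funeneg; apply/measurable_EFinP.
Qed.

Lemma measurable_section (g : R * R -> R) (y : R) : measurable_fun setT g ->
  measurable_fun setT (fun x : R => (g (x, y))%:E).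
Proof.
move=> mg; apply/measurable_EFinP; apply: (measurableT_comp mg).
by apply: measurable_fun_pair; [exact: measurable_id|exact: measurable_cst].
Qed.

Lemma fine_abs_le (z : \bar R) : (`|fine z|%:E <= `|z|)%E.
Proof. by case: z => [r| |] /=; rewrite ?lexx ?normr0 ?leey. Qed.

Lemma prim_le (g : R * R -> R) (x y : R) : measurable_fun setT g ->
  (`|prim g (x, y)|%:E <= \int[mu]_xi `|(g (xi, y))%:E|)%E.
Proof.
move=> mg; have mgy := measurable_section y mg.
apply: le_trans (fine_abs_le _) _.
apply: le_trans (le_abse_integral _ _ _) _ => //; first exact: measurable_funTS.
apply: ge0_subset_integral => //.
exact: measurableT_comp.
Qed.

Lemma integrable_tensor (u v : R -> R) : mu.-integrable setT (EFin \o u) ->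
  mu.-integrable setT (EFin \o v) -> mu2.-integrable setT (EFin \o tensor u v).
Proof.
move=> iu iv.
have mu' : measurable_fun setT u by apply/measurable_EFinP; case/integrableP : iu.
have mv : measurable_fun setT v by apply/measurable_EFinP; case/integrableP : iv.
have muv : measurable_fun setT (tensor u v).
  by apply: measurable_funM; [exact: measurable_fst_comp|exact: measurable_snd_comp].
apply: (integrable12ltyP _ _ _).2; first exact/measurable_EFinP.
have iV : (\int[mu]_y `|(v y)%:E| < +oo)%E by case/integrableP : iv.
have iU : (\int[mu]_y `|(u y)%:E| < +oo)%E by case/integrableP : iu.
have -> : (\int[mu]_x \int[mu]_y `|(EFin \o tensor u v) (x, y)| =
   (\int[mu]_x (`|(u x)%:E| * \int[mu]_y `|(v y)%:E|))%E)%E.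
  apply: eq_integral => x _; rewrite -ge0_integralZl//.
  - by apply: eq_integral => y _; rewrite /tensor /= normrM EFinM.
  - by apply: measurableT_comp => //; exact/measurable_EFinP.
rewrite ge0_integralZr//; last 2 first.
- by apply: measurableT_comp => //; exact/measurable_EFinP.
- exact: integral_ge0.
by apply: lte_mul_pinfty => //; [exact: integral_ge0|rewrite ge0_fin_numE//; exact: integral_ge0].
Qed.

Lemma smooth1_bounded (c d : R) (a : R -> R) : smooth1 a ->
  (forall x, ~~ (c <= x <= d) -> a x = 0) -> exists C, forall x, `|a x| <= C.
Proof.
move=> sa a0; have [cd|dc] := leP c d; last first.
  exists 0 => x; rewrite a0 ?normr0//; apply/negP => /andP[cx xd].
  by have := le_trans cx xd; rewrite leNgt dc.
have ca : {within `[c, d], continuous (fun x => `|a x|)}.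
  apply: continuous_subspaceT => x; apply: continuous_comp.
    exact: smooth1_continuous.
  exact: norm_continuous.
have [z _ hz] := EVT_max cd ca.
exists `|a z| => x; case: (boolP (c <= x <= d)) => xcd.
  by apply: hz; rewrite in_itv.
by rewrite a0// normr0.
Qed.

Lemma smooth1_FTC2 (a : R -> R) (y X : R) : y < X -> smooth1 a ->
  (\int[mu]_(x in `]y, X[) (derive1 a x)%:E = (a X)%:E - (a y)%:E)%E.
Proof.
move=> yX sa.
have ca' : continuous (derive1 a) by exact/smooth1_continuous/smooth1_derive.
rewrite -(@integral_itv_bndoo _ y X _ true false); last first.
  apply/measurable_EFinP; apply: measurable_funTS.
  exact: continuous_measurable_fun.
apply: continuous_FTC2 => //.
- exact: continuous_subspaceT.
- split.
  + by move=> x _; exact: smooth1_derivable.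
  + by apply: cvg_at_right_filter; exact: smooth1_continuous.
  + by apply: cvg_at_left_filter; exact: smooth1_continuous.
Qed.

(** Fubini on the triangle [0 < xi < x < X]: for fixed [xi] the integral of [derive1 a] over []xi,
    X[] is [- a xi], since [a X = 0]. The primitive itself is never differentiated. *)
Lemma prim_by_parts (g : R -> R) (a : R -> R) (X C : R) :
  mu.-integrable setT (EFin \o g) -> smooth1 a -> a X = 0 ->
  (forall x, `|a x| <= C) ->
  \int[mu]_(x in `]0%R, X[) ((\int[mu]_(xi in `]0%R, x[) g xi) * derive1 a x) =
  - \int[mu]_(xi in `]0%R, X[) (g xi * a xi).
Proof.
move=> ig sa aX aC.
have ca' : continuous (derive1 a) by exact/smooth1_continuous/smooth1_derive.
pose u := (derive1 a) \_ `]0, X[.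
have iu : mu.-integrable setT (EFin \o u).
  rewrite /u -restrict_EFin; apply/(integrable_mkcond _ _).1 => //.
  exact: continuous_integrable_oo.
pose w (p : R * R) : R := \1_(`]0%R, p.1[%classic) p.2.
have mw : measurable_fun setT w by exact: measurable_indic_oo.
have ik : mu2.-integrable setT (EFin \o (tensor u g \* w)).
  apply: (@integrableM_bounded _ _ _ _ _ _ 1) => //; first exact: integrable_tensor.
  by move=> p; rewrite /w indicE; case: (_ \in _); rewrite ?normr1 ?normr0.
have igS (A : set R) : measurable A -> mu.-integrable A (EFin \o g).
  by move=> mA; apply: (integrableS _ _ _ ig).
have H : (\int[mu]_x \int[mu]_y (tensor u g (x, y) * w (x, y))%:E =
          \int[mu]_y \int[mu]_x (tensor u g (x, y) * w (x, y))%:E)%E.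
  exact: (Fubini ik).
rewrite Rintegral_mkcond [in RHS]Rintegral_mkcond.
transitivity (fine (\int[mu]_x \int[mu]_y (tensor u g (x, y) * w (x, y))%:E)%E).
  congr fine; apply: eq_integral => x _.
  transitivity (\int[mu]_(y in `]0%R, x[) ((u x)%:E * (g y)%:E))%E; last first.
    rewrite integral_mkcond; apply: eq_integral => y _.
    rewrite patchE /tensor /w /= indicE.
    by case: ifP; rewrite ?mulr1 ?mulr0 ?EFinM.
  have m0x : measurable (`]0, x[%classic : set R) by exact: measurable_itv.
  rewrite [RHS](@integralZl _ (measurableTypeR R) R mu _ m0x _ (igS _ m0x) (u x)).
  rewrite patchE /u patchE; case: ifP => _; last by rewrite mul0e.
  rewrite [RHS]muleC EFinM; congr (_ * _)%E; apply: fineK.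
  exact: (@integrable_fin_num _ (measurableTypeR R) R mu _ m0x _ (igS _ m0x)).
rewrite H -Rintegral_mkcond.
have m0X : measurable (`]0, X[%classic : set R) by exact: measurable_itv.
have iga : mu.-integrable `]0, X[ (EFin \o (fun xi => g xi * a xi)).
  have ma : measurable_fun setT a.
    by apply: continuous_measurable_fun; exact: smooth1_continuous.
  have igaT : mu.-integrable setT (EFin \o (fun xi => g xi * a xi)).
    exact: (@integrableM_bounded _ (measurableTypeR R) R mu g a C ig ma aC).
  exact: integrableST m0X igaT.
rewrite -mulN1r -(@RintegralZl _ (measurableTypeR R) R mu _ _ (-1) m0X iga).
rewrite Rintegral_mkcond; congr fine; apply: eq_integral => y _.
rewrite patchE mulN1r; case: ifPn => [|yX]; last first.
  apply: integral0_eq => x _; rewrite /tensor /u /w /= patchE.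
  rewrite mem_setE in_itv/= in yX; rewrite indicE !mem_setE !in_itv/=.
  case: (boolP (0 < x < X)) => [/andP[x0 xX]|_]; last by rewrite !mul0r.
  case: (boolP (0 < y < x)) => [/andP[y0 yx]|_]; last by rewrite mulr0.
  by rewrite y0 (lt_trans yx xX) in yX.
rewrite mem_setE/= in_itv/= => /andP[y0 yX].
transitivity (\int[mu]_(x in `]y, X[) ((g y)%:E * (derive1 a x)%:E))%E.
  rewrite [RHS]integral_mkcond; apply: eq_integral => x _.
  rewrite /tensor /u /w /= !patchE indicE !mem_setE !in_itv/=.
  case: (boolP (y < x < X)) => [/andP[yx xX]|yxX].
    by rewrite y0 yx xX (lt_trans y0 yx) mulr1 mulrC EFinM.
  case: (boolP (0 < x < X)) => [/andP[x0 xX]|_]; last by rewrite !mul0r.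
  by move: yxX; rewrite xX andbT => /negbTE ->; rewrite andbF mulr0.
have myX : measurable (`]y, X[%classic : set R) by exact: measurable_itv.
have ia' : mu.-integrable `]y, X[ (EFin \o derive1 a).
  exact: continuous_integrable_oo.
rewrite [LHS](@integralZl _ (measurableTypeR R) R mu _ myX _ ia' (g y)).
transitivity ((g y)%:E * ((a X)%:E - (a y)%:E))%E; first by congr (_ * _)%E; exact: smooth1_FTC2.
by rewrite aX sub0e -EFinN -EFinM mulrN.
Qed.

End product.

(** * Row integrals, and the weak derivative of a row primitive on a box *)

Section box.
Variable R : realType.
Local Notation mu := (@lebesgue_measure R).
Local Notation mu2 := (mu \x mu)%E.

Definition avg (h : R * R -> R) (y : R) : R := \int[mu]_x h (x, y).

Lemma measurable_tonelli2 (f : R * R -> \bar R) : measurable_fun setT f ->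
  (forall p, 0 <= f p)%E ->
  measurable_fun setT (fun y : R => \int[mu]_x f (x, y))%E.
Proof.
move=> mf f0.
exact: (@measurable_fun_fubini_tonelli_G _ _ (measurableTypeR R) (measurableTypeR R) R mu f mf f0).
Qed.

Lemma integrable_avg (h : R * R -> R) : mu2.-integrable setT (EFin \o h) ->
  mu.-integrable setT (EFin \o avg h).
Proof.
move=> ih; have mh : measurable_fun setT h by apply/measurable_EFinP; case/integrableP : ih.
have mah : measurable_fun setT (fun p => `|(h p)%:E|)%E.
  by apply/measurableT_comp => //; exact/measurable_EFinP.
have mavg : measurable_fun setT (avg h).
  rewrite (_ : avg h = fine \o fubini_G mu (EFin \o h))//.
  apply: measurableT_comp => //; exact: (measurable_fubini_G ih).
apply/integrableP; split; first by apply/measurable_EFinP; exact: mavg.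
apply: (@le_lt_trans _ _ (\int[mu2]_p `|(h p)%:E|)%E); last by case/integrableP : ih.
rewrite (tonelli2 mah)//; apply: ge0_le_integral => //.
- by apply: measurableT_comp => //; apply/measurable_EFinP; exact: mavg.
- exact: (measurable_tonelli2 mah (fun p => abse_ge0 _)).
- move=> y _; apply: le_trans (fine_abs_le _) _.
  apply: le_abse_integral => //.
  exact: measurable_section.
Qed.

Lemma Rintegral_avg (h : R * R -> R) : mu2.-integrable setT (EFin \o h) ->
  \int[mu2]_p h p = \int[mu]_y avg h y.
Proof.
move=> ih; rewrite /Rintegral Rintegral_fubini//; congr fine.
have mh : measurable_fun setT h by apply/measurable_EFinP; case/integrableP : ih.
apply: ae_eq_integral => //.
- exact: (measurable_fubini_G ih).
- by case/integrableP : (integrable_avg ih).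
have := integrable_section ih; apply: ae_imply => y iy _.
rewrite /avg /Rintegral fineK//.
exact: (@integrable_fin_num _ (measurableTypeR R) R mu _ _ _ iy).
Qed.

Lemma avgM (h : R * R -> R) (v : R -> R) (y : R) :
  mu.-integrable setT (fun x => (h (x, y))%:E) ->
  avg (fun p => h p * v p.2) y = avg h y * v y.
Proof.
move=> ih.
exact: (@RintegralZr _ (measurableTypeR R) R mu setT (fun x => h (x, y)) (v y) measurableT ih).
Qed.

Lemma Rintegral_tensor (u v : R -> R) : mu.-integrable setT (EFin \o u) ->
  mu.-integrable setT (EFin \o v) ->
  \int[mu2]_p tensor u v p = (\int[mu]_x u x) * \int[mu]_y v y.
Proof.
move=> iu iv; rewrite Rintegral_avg; last exact: integrable_tensor.
transitivity (\int[mu]_y ((\int[mu]_x u x) * v y)).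
  apply: eq_Rintegral => y _.
  exact: (@RintegralZr _ (measurableTypeR R) R mu setT u (v y) measurableT iu).
exact: (@RintegralZl _ (measurableTypeR R) R mu setT v _ measurableT iv).
Qed.

Lemma ae_eq_Rintegral2 (h k : R * R -> R) :
  mu2.-integrable setT (EFin \o h) -> mu2.-integrable setT (EFin \o k) ->
  {ae mu, forall y, avg h y = avg k y} ->
  \int[mu2]_p h p = \int[mu2]_p k p.
Proof.
move=> ih ik hk; rewrite (Rintegral_avg ih) (Rintegral_avg ik); congr fine.
apply: ae_eq_integral => //.
- by case/integrableP : (integrable_avg ih).
- by case/integrableP : (integrable_avg ik).
by move: hk; apply: ae_imply => y /= -> _.
Qed.

Lemma measurable_indic_itv (a b : R) :
  measurable_fun setT (\1_(`]a, b[%classic) : R -> R).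
Proof. by apply: measurable_indic; exact: measurable_itv. Qed.

Lemma integrable_indic_itv (a b : R) :
  mu.-integrable setT (EFin \o (\1_(`]a, b[%classic) : R -> R)).
Proof.
apply/integrableP; split; first by apply/measurable_EFinP; exact: measurable_indic_itv.
under eq_integral do rewrite /= ger0_norm//.
rewrite integral_indic//= setIT lebesgue_measure_itv/=.
by case: ifP => _; rewrite -?EFinB ltry.
Qed.

Lemma indic_itvE (a b x : R) :
  \1_(`]a, b[%classic) x = (if a < x < b then 1 else 0) :> R.
Proof. by rewrite indicE mem_setE in_itv/=; case: ifP. Qed.

Section prim_box.
Variables (X Y : R) (g : R * R -> R).
Hypothesis ig : mu2.-integrable setT (EFin \o g).
Let mg : measurable_fun setT g.
Proof. by apply/measurable_EFinP; case/integrableP : ig. Qed.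

Let w := tensor (\1_(`]0, X[%classic) : R -> R) (\1_(`]0, Y[%classic) : R -> R).

(** On each row the primitive is at most the integral of [|g|] over that row, which is integrable in
    [y]; the cut-off [w] bounds the length of the row. *)
Lemma integrable_prim : mu2.-integrable setT (EFin \o (fun p => prim g p * w p)).
Proof.
have mw : measurable_fun setT w.
  apply: measurable_funM.
    by apply: measurable_fst_comp; exact: measurable_indic_itv.
  by apply: measurable_snd_comp; exact: measurable_indic_itv.
have mpw : measurable_fun setT (fun p => prim g p * w p).
  by apply: measurable_funM => //; exact: measurable_prim.
have mag : measurable_fun setT (fun p => `|(g p)%:E|)%E.
  by apply/measurableT_comp => //; exact/measurable_EFinP.
have mI : measurable_fun setT (fun y : R => \int[mu]_xi `|(g (xi, y))%:E|)%E.
  exact: (measurable_tonelli2 mag (fun p => abse_ge0 _)).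
have mi : measurable_fun setT (fun x : R => (\1_(`]0, X[%classic) x : R)%:E).
  by apply/measurable_EFinP; exact: measurable_indic_itv.
have iX : (\int[mu]_x (\1_(`]0, X[%classic) x : R)%:E < +oo)%E.
  rewrite integral_indic//= setIT lebesgue_measure_itv/=.
  by case: ifP => _; rewrite -?EFinB ltry.
apply/integrableP; split; first by apply/measurable_EFinP.
rewrite (tonelli2 (f := fun p => `|(prim g p * w p)%:E|%E))//; last first.
  by apply/measurableT_comp => //; exact/measurable_EFinP.
have step (x y : R) : (`|(prim g (x, y) * w (x, y))%:E| <=
    (\1_(`]0, X[%classic) x : R)%:E * \int[mu]_xi `|(g (xi, y))%:E|)%E.
  rewrite /= normrM EFinM muleC /w /tensor/= !indic_itvE.
  have I0 : (0 <= \int[mu]_xi `|(g (xi, y))%:E|)%E by exact: integral_ge0.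
  case: ifP => _; last by rewrite mul0r normr0 !mul0e.
  rewrite mul1r mul1e; case: ifP => _; last by rewrite normr0 mul0e.
  by rewrite normr1 mul1e; exact: prim_le.
apply: (@le_lt_trans _ _ (\int[mu]_y ((\int[mu]_x (\1_(`]0, X[%classic) x : R)%:E) *
    \int[mu]_xi `|(g (xi, y))%:E|))%E).
  apply: ge0_le_integral => //.
  - by move=> y _; exact: integral_ge0.
  - apply: (measurable_tonelli2 (f := fun p => `|(prim g p * w p)%:E|%E)) => //.
    by apply/measurableT_comp => //; exact/measurable_EFinP.
  - by apply: emeasurable_funM.
  move=> y _; rewrite -ge0_integralZr//; last first.
    by apply: integral_ge0.
  apply: ge0_le_integral => //.
  - apply/measurableT_comp => //; exact: (@measurable_section _ (fun p => prim g p * w p)).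
  - by apply: emeasurable_funM.
have I0 (y : R) : (0 <= \int[mu]_xi `|(g (xi, y))%:E|)%E by exact: integral_ge0.
have iX0 : (0 <= \int[mu]_x (\1_(`]0, X[%classic) x : R)%:E)%E.
  by apply: integral_ge0 => x _; rewrite lee_fin.
rewrite (@ge0_integralZl _ (measurableTypeR R) R mu setT measurableT
  (fun y : R => \int[mu]_xi `|(g (xi, y))%:E|)%E mI _ (fun y _ => I0 y) iX0).
rewrite -(tonelli2 mag)//.
apply: lte_mul_pinfty; [exact: iX0|by rewrite ge0_fin_numE|].
by case/integrableP : ig.
Qed.

Lemma prim_test (a b : R -> R) (c d e k : R) : smooth1 a -> smooth1 b ->
  (forall x, ~~ (c <= x <= d) -> a x = 0) ->
  (forall y, ~~ (e <= y <= k) -> b y = 0) ->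
  0 < c -> d < X -> 0 < e -> k < Y ->
  \int[mu2]_p (prim g p * w p * tensor (derive1 a) b p) =
  - \int[mu2]_p (g p * tensor a b p).
Proof.
move=> sa sb a0 b0 c0 dX e0 kY.
have [A aA] := smooth1_bounded sa a0.
have [A' aA'] := smooth1_bounded (smooth1_derive sa) (derive1_supp sa a0).
have [B bB] := smooth1_bounded sb b0.
have ms (u v : R -> R) : smooth1 u -> smooth1 v -> measurable_fun setT (tensor u v).
  move=> su sv; apply: measurable_funM.
    apply: measurable_fst_comp; apply: continuous_measurable_fun.
    exact: smooth1_continuous.
  apply: measurable_snd_comp; apply: continuous_measurable_fun.
  exact: smooth1_continuous.
have bd (u v : R -> R) U V : (forall x, `|u x| <= U) -> (forall x, `|v x| <= V) ->
    forall p, `|tensor u v p| <= U * V.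
  by move=> uU vV p; rewrite /tensor normrM ler_pM.
have ik1 := integrableM_bounded integrable_prim (ms _ _ (smooth1_derive sa) sb) (bd _ _ _ _ aA' bB).
have ik2 := integrableM_bounded ig (ms _ _ sa sb) (bd _ _ _ _ aA bB).
rewrite -mulN1r -(RintegralZl _ measurableT ik2).
have ik3 : mu2.-integrable setT (EFin \o (fun p => -1 * (g p * tensor a b p))).
  exact: (integrableZl measurableT (-1) ik2).
apply: ae_eq_Rintegral2 => //.
have aX : a X = 0 by rewrite a0// negb_and -!ltNge dX orbT.
pose k1 p := prim g p * w p * tensor (derive1 a) b p.
pose k2 p := g p * tensor a b p.
have avg_eq (y : R) : mu.-integrable setT (fun x => (g (x, y))%:E) ->
    mu.-integrable setT (fun x => (k1 (x, y))%:E) ->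
    mu.-integrable setT (fun x => (k2 (x, y))%:E) ->
    avg k1 y = avg (fun p => -1 * k2 p) y.
  move=> iy i1 i2.
  have -> : avg (fun p => -1 * k2 p) y = -1 * avg k2 y.
    exact: (@RintegralZl _ (measurableTypeR R) R mu setT _ (-1) measurableT i2).
  have [by0|by0] := eqVneq (b y) 0.
    rewrite /avg (_ : (fun x => k1 (x, y)) = cst 0); last first.
      by apply/funext => x; rewrite /k1 /tensor/= by0 !mulr0.
    rewrite (_ : (fun x => k2 (x, y)) = cst 0); last first.
      by apply/funext => x; rewrite /k2 /tensor/= by0 !mulr0.
    by rewrite /Rintegral integral0 mulr0.
  have yY : 0 < y < Y.
    apply: contraNT by0 => yY; rewrite b0//; apply: contra yY => /andP[ey yk].
    by rewrite (lt_le_trans e0 ey) (le_lt_trans yk kY).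
  (* On this row [b y] is a nonzero constant factor; dividing by it leaves exactly
     [prim_by_parts]. *)
  apply: (mulIf (invr_neq0 by0)); rewrite -mulrA.
  have e1 : \int[mu]_x (k1 (x, y) * (b y)^-1) = avg k1 y * (b y)^-1.
    exact: (@RintegralZr _ (measurableTypeR R) R mu setT _ _ measurableT i1).
  have e2 : \int[mu]_x (k2 (x, y) * (b y)^-1) = avg k2 y * (b y)^-1.
    exact: (@RintegralZr _ (measurableTypeR R) R mu setT _ _ measurableT i2).
  rewrite -e1 -e2 mulN1r.
  have := prim_by_parts iy sa aX aA.
  rewrite [X in X = _ -> _]Rintegral_mkcond [X in _ = - X -> _]Rintegral_mkcond.
  have -> : (fun x => k1 (x, y) * (b y)^-1) =
      (fun x => (\int[mu]_(xi in `]0, x[) g (xi, y)) * derive1 a x) \_ `]0, X[.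
    apply/funext => x; rewrite patchE mem_setE in_itv/= /k1 /w /tensor/= !indic_itvE.
    by case: ifP => _; rewrite ?mul0r ?mulr0 ?mul0r// yY !mulr1 -mulrA mulfK.
  have -> : (fun x => k2 (x, y) * (b y)^-1) = (fun x => g (x, y) * a x) \_ `]0, X[.
    apply/funext => x; rewrite patchE mem_setE in_itv/= /k2 /tensor/=.
    rewrite -mulrA mulfK//; case: ifPn => // xX; rewrite a0 ?mulr0//.
    apply: contra xX => /andP[cx xd].
    by rewrite (lt_le_trans c0 cx) (le_lt_trans xd dX).
  by [].
have h2 := integrable_section ik2; have h3 := integrable_section ig.
have h23 : {ae mu, forall y, mu.-integrable setT (fun x => (k2 (x, y))%:E) /\
    mu.-integrable setT (fun x => (g (x, y))%:E)}.
  by move: h2 h3; apply: ae_imply2 => y.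
have h1 := integrable_section ik1.
by move: h1 h23; apply: ae_imply2 => y i1 [i2 i3]; exact: avg_eq.
Qed.

End prim_box.
End box.


(** * Functions with an integrable weak derivative on a box *)

Section box_derivative.
Variable R : realType.
Local Notation mu := (@lebesgue_measure R).
Local Notation mu2 := (mu \x mu)%E.

(* Weak derivatives are only ever tested against products [a x * b y], which
   reduces their theory to one variable at a time. *)
Definition tensor_derivative (Q : set (R * R)) (f g : R * R -> R) : Prop :=
  forall (a b : R -> R) (c d e k : R), smooth1 a -> smooth1 b ->
    (forall x, ~~ (c <= x <= d) -> a x = 0) ->
    (forall y, ~~ (e <= y <= k) -> b y = 0) ->
    `[c, d] `*` `[e, k] `<=` Q ->
    \int[mu2]_(p in Q) (f p * tensor (derive1 a) b p) =
    - \int[mu2]_(p in Q) (g p * tensor a b p).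

Lemma tensor_bounded (a b : R -> R) (c d e k : R) : smooth1 a -> smooth1 b ->
  (forall x, ~~ (c <= x <= d) -> a x = 0) ->
  (forall y, ~~ (e <= y <= k) -> b y = 0) ->
  measurable_fun setT (tensor a b) /\ exists C, forall p, `|tensor a b p| <= C.
Proof.
move=> sa sb a0 b0; split.
  apply: measurable_funM.
    apply: measurable_fst_comp; apply: continuous_measurable_fun.
    exact: smooth1_continuous.
  apply: measurable_snd_comp; apply: continuous_measurable_fun.
  exact: smooth1_continuous.
have [A aA] := smooth1_bounded sa a0.
have [B bB] := smooth1_bounded sb b0.
by exists (A * B) => p; rewrite /tensor normrM ler_pM.
Qed.

Lemma Rintegral_avgM (h : R * R -> R) (v : R -> R) (C : R) :
  mu2.-integrable setT (EFin \o h) -> measurable_fun setT v ->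
  (forall y, `|v y| <= C) ->
  \int[mu]_y (avg h y * v y) = \int[mu2]_p (h p * v p.2).
Proof.
move=> ih mv vC.
have mv2 : measurable_fun setT (fun p : R * R => v p.2) by exact: measurable_snd_comp.
have ihv := integrableM_bounded ih mv2 (fun p => vC p.2).
have iav := @integrableM_bounded _ (measurableTypeR R) R mu _ v C (integrable_avg ih) mv vC.
rewrite (Rintegral_avg ihv); congr fine; apply: ae_eq_integral => //.
- by case/integrableP : iav.
- by case/integrableP : (integrable_avg ihv).
have := integrable_section ih; apply: ae_imply => y iy _.
by congr (_%:E); apply/esym; exact: avgM.
Qed.

(* [f - prim g] has vanishing weak derivative in the first variable, hence is
   almost everywhere a function of the second variable alone. *)
Lemma box_derivative (X Y : R) (f g : R * R -> R) : 0 < X -> 0 < Y ->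
  mu2.-integrable setT (EFin \o f) -> mu2.-integrable setT (EFin \o g) ->
  (forall (a b : R -> R) (c d e k : R), smooth1 a -> smooth1 b ->
    (forall x, ~~ (c <= x <= d) -> a x = 0) ->
    (forall y, ~~ (e <= y <= k) -> b y = 0) ->
    0 < c -> d < X -> 0 < e -> k < Y ->
    \int[mu2]_p (f p * tensor (derive1 a) b p) =
    - \int[mu2]_p (g p * tensor a b p)) ->
  exists kappa : R -> R,
    {ae mu2, forall p, 0 < p.1 < X -> 0 < p.2 < Y -> f p - prim g p = kappa p.2}.
Proof.
move=> X0 Y0 if_ ig fg.
pose iX := \1_(`]0, X[%classic) : R -> R.
pose iY := \1_(`]0, Y[%classic) : R -> R.
pose w := tensor iX iY.
have mXY : measurable_fun setT w.
  apply: measurable_funM.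
    by apply: measurable_fst_comp; exact: measurable_indic_itv.
  by apply: measurable_snd_comp; exact: measurable_indic_itv.
have ind1 (A : set R) x : `|\1_A x| <= 1 :> R.
  by rewrite indicE; case: (_ \in _); rewrite ?normr1 ?normr0.
have w1 p : `|w p| <= 1.
  by rewrite /w /tensor normrM mulr_ile1//; exact: ind1.
pose D p := (f p - prim g p) * w p.
have iD : mu2.-integrable setT (EFin \o D).
  have i1 := integrableM_bounded if_ mXY w1.
  have i2 := integrable_prim X Y ig.
  rewrite (_ : EFin \o D =
      ((EFin \o (f \* w)%R) \- (EFin \o (fun p => prim g p * w p)%R))%E).
    exact: integrableB.
  by apply/funext => p; rewrite /D /= mulrBl EFinB.
have D0 p : ~~ ((0 < p.1 < X) && (0 < p.2 < Y)) -> D p = 0.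
  rewrite negb_and /D /w /tensor /iX /iY !indic_itvE => /orP[]/negbTE ->.
    by rewrite mul0r mulr0.
  by rewrite !mulr0.
have Dtest (a b : R -> R) (c d e k : R) : smooth1 a -> smooth1 b ->
    (forall x, ~~ (c <= x <= d) -> a x = 0) ->
    (forall y, ~~ (e <= y <= k) -> b y = 0) ->
    0 < c -> d < X -> 0 < e -> k < Y ->
    \int[mu2]_p (D p * tensor (derive1 a) b p) = 0.
  move=> sa sb a0 b0 c0 dX e0 kY.
  have E1 := fg _ _ _ _ _ _ sa sb a0 b0 c0 dX e0 kY.
  have E2 := prim_test ig sa sb a0 b0 c0 dX e0 kY.
  have [mt [C tC]] := tensor_bounded (smooth1_derive sa) sb (derive1_supp sa a0) b0.
  have i1 := integrableM_bounded if_ mt tC.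
  have i2 := integrableM_bounded (integrable_prim X Y ig) mt tC.
  transitivity (\int[mu2]_p (f p * tensor (derive1 a) b p) -
    \int[mu2]_p (prim g p * w p * tensor (derive1 a) b p)); last by rewrite E1 E2 subrr.
  rewrite -(RintegralB measurableT i1 i2); apply: eq_Rintegral => p _.
  rewrite /D mulrBl mulrBl /=; congr (_ - _).
  rewrite -mulrA; congr (_ * _); rewrite /w /tensor /iX /iY !indic_itvE.
  case: (boolP (c <= p.1 <= d)) => [/andP[cp pd]|pcd]; last first.
    by rewrite (derive1_supp sa a0 pcd) !mul0r mulr0.
  case: (boolP (e <= p.2 <= k)) => [/andP[ep pk]|pek]; last first.
    by rewrite (b0 _ pek) !mulr0.
  rewrite (lt_le_trans c0 cp) (le_lt_trans pd dX) (lt_le_trans e0 ep).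
  by rewrite (le_lt_trans pk kY) !mul1r.
pose m := \int[mu]_x (iX x * iX x).
have iXX x : iX x * iX x = iX x.
  by rewrite /iX indic_itvE; case: ifP; rewrite ?mulr1 ?mulr0.
have iiX : mu.-integrable setT (EFin \o iX) by exact: integrable_indic_itv.
have miX : measurable_fun setT iX by exact: measurable_indic_itv.
have iXE : \int[mu]_x iX x = X.
  rewrite /Rintegral integral_indic//= setIT lebesgue_measure_itv/= lte_fin X0.
  by rewrite -EFinB subr0.
have mE : m = X by rewrite -[RHS]iXE; apply: eq_Rintegral => x _; exact: iXX.
pose L (a b : R) := \int[mu]_x (iX x * \1_(`]a, b[%classic) x).
(* A test in [x] is a derivative only if its mean is 0. Correcting [plateau a b n] by a multiple of
   [plateau 0 X n] achieves this. In the limit the integral of [D] over the rectangle is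
   proportional to the length [L a b], so [D] does not see [x] inside the box. *)
have Dlim (a b c d : R) : 0 <= a -> b <= X -> 0 <= c -> d <= Y ->
   \int[mu2]_p (D p * tensor (\1_(`]a, b[%classic) : R -> R) (\1_(`]c, d[%classic) : R -> R) p) * X =
   L a b * \int[mu2]_p (D p * (\1_(`]c, d[%classic) p.2 : R)).
  move=> a0 bX c0 dY.
  pose l_ n := \int[mu]_x (iX x * plateau a b n x).
  pose m_ n := \int[mu]_x (iX x * plateau 0 X n x).
  pose u_ n : R -> R := (plateau a b n \* cst (m_ n)) \+ (plateau 0 X n \* cst (- l_ n)).
  have mb a' b' n : measurable_fun setT (plateau a' b' n : R -> R).
    apply: continuous_measurable_fun; apply: smooth1_continuous.
    exact: smooth_plateau.
  have plateau1 a' b' n (x : R) : `|plateau a' b' n x| <= 1.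
    by rewrite ger0_norm ?plateau_ge0// plateau_le1.
  have l_cvg : l_ n @[n --> \oo] --> L a b.
    apply: (@Rintegral_bounded_cvg _ (measurableTypeR R) R mu iX _ _ 1) => //.
    - by move=> n; exact: mb.
    - by move=> x; exact: plateau_cvg.
  have m_cvg : m_ n @[n --> \oo] --> X.
    rewrite -mE.
    apply: (@Rintegral_bounded_cvg _ (measurableTypeR R) R mu iX _ _ 1) => //.
    - by move=> n; exact: mb.
    - by move=> x; exact: plateau_cvg.
  have plateauX a' b' n : `|\int[mu]_x (iX x * plateau a' b' n x)| <= X.
    have ib := @integrableM_bounded _ (measurableTypeR R) R mu iX _ 1 iiX (mb a' b' n) (plateau1 a' b' n).
    rewrite ger0_norm; last first.
      by apply: Rintegral_ge0 => x _; rewrite mulr_ge0 ?plateau_ge0// /iX indicE.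
    rewrite -[leRHS]iXE; apply: le_Rintegral => //.
    by move=> x _; rewrite ler_piMr ?plateau_le1// /iX indicE.
  have su n : smooth1 (u_ n).
    move=> k; apply: Ck1D; apply: Ck1M; [exact: smooth_plateau|exact: Ck1_cst|
      exact: smooth_plateau|exact: Ck1_cst].
  have mu_ n : measurable_fun setT (u_ n).
    by apply: continuous_measurable_fun; exact: smooth1_continuous (su n).
  have u_bd n x : `|u_ n x| <= X + X.
    apply: le_trans (ler_normD _ _) _; apply: lerD; rewrite normrM /cst ?normrN.
      by apply: le_trans (ler_pM _ _ (plateau1 _ _ _ _) (plateauX _ _ _)) _; rewrite ?mul1r.
    by apply: le_trans (ler_pM _ _ (plateau1 _ _ _ _) (plateauX _ _ _)) _; rewrite ?mul1r.
  have bsupp (a' b' : R) n (x : R) : 0 <= a' -> b' <= X ->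
      ~~ (n.+1%:R^-1 <= x <= X - n.+1%:R^-1) -> plateau a' b' n x = 0.
    move=> a'0 b'X h; apply: plateau_eq0; apply: contra h => /andP[h1 h2].
    by move: h1 h2; move: (n.+1%:R^-1) => e' h1 h2; apply/andP; split; lra.
  have u0 n x : ~~ (n.+1%:R^-1 <= x <= X - n.+1%:R^-1) -> u_ n x = 0.
    by move=> h; rewrite /u_ /= !bsupp// !mul0r addr0.
  have bint (a' b' : R) n : 0 <= a' -> b' <= X ->
      \int[mu]_(x in `[n.+1%:R^-1, X - n.+1%:R^-1]) plateau a' b' n x =
      \int[mu]_x (iX x * plateau a' b' n x).
    move=> a'0 b'X; rewrite Rintegral_mkcond; apply: eq_Rintegral => x _.
    rewrite patchE mem_setE in_itv/=; case: ifPn => h; last by rewrite bsupp ?mulr0.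
    rewrite /iX indic_itvE ifT ?mul1r//.
    have n0 : 0 < n.+1%:R^-1 :> R by rewrite invr_gt0 ltr0n.
    move: h => /andP[h1 h2]; apply/andP; split; first exact: lt_le_trans n0 h1.
    by apply: le_lt_trans h2 _; rewrite gtrBl.
  have uint n : \int[mu]_(x in `[n.+1%:R^-1, X - n.+1%:R^-1]) u_ n x = 0.
    set I := [set` _].
    have ip a' b' : mu.-integrable I (EFin \o plateau a' b' n).
      by apply: continuous_integrable_itv; exact: smooth1_continuous (smooth_plateau _ _ _).
    have mI : measurable I by exact: measurable_itv.
    have E1 : \int[mu]_(x in I) (plateau a b n x * m_ n) = l_ n * m_ n.
      rewrite (@RintegralZr _ (measurableTypeR R) R mu I _ _ mI (ip a b)).
      by rewrite bint.
    have E2 : \int[mu]_(x in I) (plateau 0 X n x * - l_ n) = m_ n * - l_ n.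
      rewrite (@RintegralZr _ (measurableTypeR R) R mu I _ _ mI (ip 0 X)).
      by rewrite bint.
    have j1 := @integrableZr _ (measurableTypeR R) R mu I mI (m_ n) _ (ip a b).
    have j2 := @integrableZr _ (measurableTypeR R) R mu I mI (- l_ n) _ (ip 0 X).
    have E3 := @RintegralD _ (measurableTypeR R) R mu I _ _ mI j1 j2.
    by rewrite [LHS]E3 [X in X + _]E1 [X in _ + X]E2 mulrN (mulrC (m_ n)) subrr.
  (* Only for large [n], once the interval outside which [u_ n] vanishes is nondegenerate. *)
  have zero : \forall n \near \oo,
      \int[mu2]_p (D p * tensor (u_ n) (plateau c d n) p) = 0.
    have [N _ hN] : \forall n \near \oo, n.+1%:R^-1 < X / 2.
      have X2 : 0 < X / 2 by rewrite divr_gt0.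
      exact: near_infty_natSinv_lt (PosNum X2).
    exists N => // n /hN nX.
    have n0 : 0 < n.+1%:R^-1 :> R by rewrite invr_gt0 ltr0n.
    have cd : n.+1%:R^-1 < X - n.+1%:R^-1.
      by move: nX; move: (n.+1%:R^-1) => e' nX; lra.
    have [A [sA A0] A'u] := smooth1_antiderivative cd (su n) (u0 n) (uint n).
    rewrite -A'u; apply: (Dtest _ _ _ _ _ _ sA (smooth_plateau c d n) A0).
    - by move=> y; exact: plateau_eq0.
    - by [].
    - by rewrite gtrBl.
    - by rewrite ltr_wpDl.
    - by rewrite (lt_le_trans _ dY)// gtrBl.
  pose v := tensor ((\1_(`]a, b[%classic) \* cst X) \+ (iX \* cst (- L a b)))
    (\1_(`]c, d[%classic) : R -> R).
  have m1 (a' b' : R) : measurable_fun setT (\1_(`]a', b'[%classic) : R -> R).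
    exact: measurable_indic_itv.
  have mv : measurable_fun setT v.
    apply: measurable_funM; last exact: measurable_snd_comp.
    apply: measurable_fst_comp; apply: measurable_funD; exact: measurable_funM.
  have lim : \int[mu2]_p (D p * tensor (u_ n) (plateau c d n) p) @[n --> \oo] -->
      \int[mu2]_p (D p * v p).
    apply: (Rintegral_bounded_cvg (C := X + X)) => //.
    - move=> n; apply: measurable_funM; first exact: measurable_fst_comp.
      exact: measurable_snd_comp.
    - move=> n p; rewrite /tensor normrM -[leRHS]mulr1 ler_pM//.
    - move=> p; apply: cvgM; last exact: plateau_cvg.
      apply: cvgD; apply: cvgM; [exact: plateau_cvg|exact: m_cvg|exact: plateau_cvg|].
      exact: cvgN.
  have Dv : \int[mu2]_p (D p * v p) = 0.
    have z : \int[mu2]_p (D p * tensor (u_ n) (plateau c d n) p) @[n --> \oo] --> (0 : R).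
      exact: cvg_near_cst zero.
    exact: (cvg_unique _ lim z).
  have m2 : measurable_fun setT (tensor (\1_(`]a, b[%classic) : R -> R) (\1_(`]c, d[%classic) : R -> R)).
    by apply: measurable_funM; [exact: measurable_fst_comp|exact: measurable_snd_comp].
  have b2 p : `|tensor (\1_(`]a, b[%classic) : R -> R) (\1_(`]c, d[%classic) : R -> R) p| <= 1.
    by rewrite /tensor normrM mulr_ile1.
  have i2 := integrableM_bounded iD m2 b2.
  have m3 := measurable_snd_comp (m1 c d).
  have i3 := integrableM_bounded iD m3 (fun p => ind1 _ p.2).
  apply/eqP; rewrite -subr_eq0 -[X in _ == X]Dv mulrC [L _ _ * _]mulrC.
  rewrite [X * _]mulrC -(RintegralZr _ measurableT i2) -(RintegralZr _ measurableT i3).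
  rewrite -(RintegralB measurableT (integrableZr measurableT X i2) (integrableZr measurableT (L a b) i3)).
  apply/eqP; apply: eq_Rintegral => p _; rewrite /v /tensor /=.
  case: (boolP ((0 < p.1 < X) && (0 < p.2 < Y))) => [/andP[p1 p2]|/D0 ->]; last first.
    by rewrite !mul0r subr0.
  by rewrite /cst /iX (indic_itvE 0 X) p1; ring.
(* The only candidate: if [D] depends on [y] alone in the box, its value is its mean over the
   row. *)
pose kappa y := avg D y * X^-1.
have ikappa : mu.-integrable setT (EFin \o kappa).
  exact: (@integrableZr _ (measurableTypeR R) R mu setT measurableT X^-1 _ (integrable_avg iD)).
have ikX := integrable_tensor iiX ikappa.
pose H p := D p - tensor iX kappa p.
have iH : mu2.-integrable setT (EFin \o H).
  rewrite (_ : EFin \o H = ((EFin \o D) \- (EFin \o tensor iX kappa))%E)//.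
  exact: integrableB.
have H0 : {ae mu2, forall p, H p = 0}.
  apply: integral2_itv_eq0 => // a b c d.
  (* [Dlim] concerns rectangles inside the box. Since [D] vanishes outside the box, and [iX] outside
     []0, X[], clipping changes no integral. *)
  pose a' := Num.max a 0; pose b' := Num.min b X.
  pose c' := Num.max c 0; pose d' := Num.min d Y.
  have clip (u v z w' : R) : 0 < z < w' ->
      \1_(`]u, v[%classic) z = \1_(`]Num.max u 0, Num.min v w'[%classic) z :> R.
    move=> /andP[z0 zw]; rewrite !indic_itvE gt_max lt_min z0 zw.
    by rewrite !andbT.
  have m1 : measurable_fun setT (\1_(`]a, b[%classic) : R -> R).
    exact: measurable_indic_itv.
  have m1' : measurable_fun setT (\1_(`]c, d[%classic) : R -> R).
    exact: measurable_indic_itv.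
  have m2 : measurable_fun setT (tensor (\1_(`]a, b[%classic) : R -> R) (\1_(`]c, d[%classic) : R -> R)).
    by apply: measurable_funM; [exact: measurable_fst_comp|exact: measurable_snd_comp].
  have b2 p : `|tensor (\1_(`]a, b[%classic) : R -> R) (\1_(`]c, d[%classic) : R -> R) p| <= 1.
    by rewrite /tensor normrM mulr_ile1.
  have i1 := integrableM_bounded iD m2 b2.
  have i2 := integrableM_bounded ikX m2 b2.
  transitivity (\int[mu2]_p (D p * tensor (\1_(`]a, b[%classic) : R -> R) (\1_(`]c, d[%classic) : R -> R) p)
     - \int[mu2]_p (tensor iX kappa p * tensor (\1_(`]a, b[%classic) : R -> R) (\1_(`]c, d[%classic) : R -> R) p)).
    rewrite -(RintegralB measurableT i1 i2); apply: eq_Rintegral => p _.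
    by rewrite /H /= mulrBl.
  have a'0 : 0 <= a' by rewrite le_max lexx orbT.
  have c'0 : 0 <= c' by rewrite le_max lexx orbT.
  have b'X : b' <= X by rewrite ge_min lexx orbT.
  have d'Y : d' <= Y by rewrite ge_min lexx orbT.
  have Dl := Dlim a' b' c' d' a'0 b'X c'0 d'Y.
  have E1 : \int[mu2]_p (D p * tensor (\1_(`]a', b'[%classic) : R -> R) (\1_(`]c', d'[%classic) : R -> R) p)
     = \int[mu2]_p (D p * tensor (\1_(`]a, b[%classic) : R -> R) (\1_(`]c, d[%classic) : R -> R) p).
    apply: eq_Rintegral => p _.
    case: (boolP ((0 < p.1 < X) && (0 < p.2 < Y))) => [/andP[p1 p2]|/D0 ->]; last by rewrite !mul0r.
    by rewrite /tensor -(clip _ _ _ _ p1) -(clip _ _ _ _ p2).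
  have E2 : \int[mu2]_p (D p * (\1_(`]c', d'[%classic) p.2 : R))
     = \int[mu2]_p (D p * (\1_(`]c, d[%classic) p.2 : R)).
    apply: eq_Rintegral => p _.
    case: (boolP ((0 < p.1 < X) && (0 < p.2 < Y))) => [/andP[p1 p2]|/D0 ->]; last by rewrite !mul0r.
    by rewrite -(clip _ _ _ _ p2).
  have E3 : L a' b' = L a b.
    apply: eq_Rintegral => x _; rewrite /iX.
    case: (boolP (0 < x < X)) => xX; first by rewrite -(clip _ _ _ _ xX).
    by rewrite [\1_(`]0, X[%classic) x]indic_itvE (negbTE xX) !mul0r.
  rewrite E1 E2 E3 in Dl.
  have E4 : \int[mu2]_p (tensor iX kappa p * tensor (\1_(`]a, b[%classic) : R -> R) (\1_(`]c, d[%classic) : R -> R) p)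
     = L a b * (\int[mu2]_p (D p * (\1_(`]c, d[%classic) p.2 : R)) / X).
    have ib1 := @integrableM_bounded _ (measurableTypeR R) R mu iX _ 1 iiX m1 (ind1 _).
    have ib2 := @integrableM_bounded _ (measurableTypeR R) R mu kappa _ 1 ikappa m1' (ind1 _).
    transitivity (\int[mu2]_p tensor (iX \* (\1_(`]a, b[%classic) : R -> R)) (kappa \* (\1_(`]c, d[%classic) : R -> R)) p).
      by apply: eq_Rintegral => p _; rewrite /tensor /= mulrACA.
    rewrite (Rintegral_tensor ib1 ib2); congr (_ * _).
    rewrite -(Rintegral_avgM iD m1' (ind1 _)).
    have ib3 := @integrableM_bounded _ (measurableTypeR R) R mu _ _ 1 (integrable_avg iD) m1' (ind1 _).
    rewrite -(@RintegralZr _ (measurableTypeR R) R mu setT _ X^-1 measurableT ib3).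
    by apply: eq_Rintegral => y _; rewrite /kappa /= mulrAC.
  by rewrite E4 mulrA -Dl mulfK ?subrr// gt_eqF.
exists kappa; move: H0; apply: ae_imply => p; rewrite /H /D => Hp p1 p2.
move: Hp; rewrite /w /tensor /iX /iY !indic_itvE p1 p2 !mulr1.
by rewrite mul1r => /eqP; rewrite subr_eq0 => /eqP.
Qed.

End box_derivative.

(** * Absolute continuity on almost every line *)

Section acl.
Variable R : realType.
Local Notation mu := (@lebesgue_measure R).
Local Notation mu2 := (mu \x mu)%E.

(** Closure under decreasing the coordinates puts the whole box below a point of [Q] inside [Q], so
    that results on boxes cover [Q]. The quadrilateral has this property because [s <= t] prevents
    its upper side A5 A3 from rising. *)
Definition lower_open (Q : set (R * R)) : Prop :=
  [/\ open Q, measurable Q, (forall p, Q p -> 0 < p.1 /\ 0 < p.2) &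
     forall x y x' y' : R, Q (x, y) -> 0 < x' <= x -> 0 < y' <= y -> Q (x', y')].

(* With [c = 0] this is half of the fundamental theorem of calculus on almost
   every horizontal segment; the slope [c] is for comparing [f] with an affine
   function. *)
Definition ftc_off (Q N : set (R * R)) (f g : R * R -> R) : Prop :=
  forall y x1 x2 c : R, Q (x1, y) -> Q (x2, y) -> x1 < x2 ->
    ~ N (x1, y) -> ~ N (x2, y) ->
    (`|f (x2, y) - f (x1, y) - c * (x2 - x1)|%:E <=
     \int[mu]_(xi in `]x1, x2[) `|g (xi, y) - c|%:E)%E.

Lemma prim_diff_le (g : R -> R) (x1 x2 c : R) : 0 < x1 -> x1 < x2 ->
  mu.-integrable setT (EFin \o g) ->
  (`|\int[mu]_(x in `]0%R, x2[) g x - \int[mu]_(x in `]0%R, x1[) g x - c * (x2 - x1)|%:E <=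
   \int[mu]_(x in `]x1, x2[) `|g x - c|%:E)%E.
Proof.
move=> x10 x12 ig.
have igS (A : set R) : measurable A -> mu.-integrable A (EFin \o g).
  by move=> mA; exact: integrableST.
have m12 : measurable (`]x1, x2[%classic : set R) by exact: measurable_itv.
have ic : mu.-integrable `]x1, x2[ (EFin \o cst c).
  by apply: continuous_integrable_oo; exact: cst_continuous.
have E1 : \int[mu]_(x in `]0%R, x2[) g x - \int[mu]_(x in `]0%R, x1[) g x =
    \int[mu]_(x in `]x1, x2[) g x.
  have m01 : measurable (`]0, x1[%classic : set R) by exact: measurable_itv.
  rewrite [X in _ - X](@Rintegral_itv_bndo_bndc R (BRight 0) x1 g (igS _ m01)).
  have m02 : measurable (`]0, x2[%classic : set R) by exact: measurable_itv.
  have h1 : (BRight 0 <= BRight x1 :> itv_bound R)%O by rewrite bnd_simp ltW.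
  have h2 : (BRight x1 <= BLeft x2 :> itv_bound R)%O by rewrite bnd_simp.
  exact: (@Rintegral_itvB R g (BRight 0) (BLeft x2) x1 (igS _ m02) h1 h2).
have E2 : \int[mu]_(x in `]x1, x2[) cst c x = c * (x2 - x1).
  by rewrite Rintegral_cst//= lebesgue_measure_itv/= lte_fin x12 -EFinB.
rewrite E1 -E2 -(@RintegralB _ (measurableTypeR R) R mu _ _ _ m12 (igS _ m12) ic).
have mgc : measurable_fun `]x1, x2[ (fun x => (g x - c)%:E).
  by case/integrableP : (@integrableB _ (measurableTypeR R) R mu _ m12 _ _ (igS _ m12) ic).
apply: le_trans (fine_abs_le _) _.
exact: le_abse_integral.
Qed.

Lemma ae_snd (P : R -> Prop) : {ae mu, forall y, P y} ->
  {ae mu2, forall p, P p.2}.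
Proof.
move=> [N [mN N0 PN]]; exists (setT `*` N); split.
- exact: measurableX.
- exact: (setX_null mN N0).2.
- by move=> p /= h; split => //; exact: PN.
Qed.

(** Two points of a row lie in a common box, where the unknown [kappa] cancels from the increment.
    Boxes with rational upper corners are countable, so one null set [N] serves them all; as [Q] is
    open, they still reach every point of [Q]. *)
Lemma tensor_derivative_ftc (Q : set (R * R)) (f g : R * R -> R) :
  lower_open Q -> mu2.-integrable Q (EFin \o f) -> mu2.-integrable Q (EFin \o g) ->
  tensor_derivative Q f g ->
  exists N, [/\ measurable N, mu2 N = 0 & ftc_off Q N f g].
Proof.
move=> [oQ mQ Q0 Qd] if_ ig fg.
pose f0 := f \_ Q; pose g0 := g \_ Q.
have if0 : mu2.-integrable setT (EFin \o f0).
  by rewrite /f0 -restrict_EFin; apply/(integrable_mkcond _ _).1.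
have ig0 : mu2.-integrable setT (EFin \o g0).
  by rewrite /g0 -restrict_EFin; apply/(integrable_mkcond _ _).1.
have restr (h t : R * R -> R) : \int[mu2]_(p in Q) (h p * t p) =
    \int[mu2]_p ((h \_ Q) p * t p).
  rewrite Rintegral_mkcond; apply: eq_Rintegral => p _.
  by rewrite !patchE; case: ifP; rewrite ?mul0r.
have box (X Y : R) : Q (X, Y) -> exists kappa : R -> R,
    {ae mu2, forall p, 0 < p.1 < X -> 0 < p.2 < Y -> f0 p - prim g0 p = kappa p.2}.
  move=> QXY; have [/= X0 Y0] := Q0 _ QXY.
  apply: box_derivative => // a b c d e k sa sb a0 b0 c0 dX e0 kY.
  rewrite -!restr; apply: fg => //; first exact: a0.
    exact: b0.
  move=> [x y] [/=]; rewrite !in_itv/= => /andP[cx xd] /andP[ey yk].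
  apply: (Qd _ _ _ _ QXY); apply/andP; split.
  - exact: lt_le_trans c0 cx.
  - by apply: le_trans xd _; exact: ltW.
  - exact: lt_le_trans e0 ey.
  - by apply: le_trans yk _; exact: ltW.
have /choice[kappa kappaP] : forall n : nat, exists kappa : R -> R,
    {ae mu2, forall p, if unpickle n is Some (X, Y) then
      Q (ratr X, ratr Y) -> 0 < p.1 < ratr X -> 0 < p.2 < ratr Y ->
      f0 p - prim g0 p = kappa p.2 else True}.
  move=> n; case: (unpickle n) => [[X Y]|]; last by exists (cst 0); exact: aeW.
  have [QXY|nQ] := pselect (Q (ratr X, ratr Y)).
    by have [k hk] := box _ _ QXY; exists k; move: hk; apply: ae_imply => p + _.
  by exists (cst 0); apply: aeW.
have all := ae_foralln kappaP.
have sec := ae_snd (integrable_section ig0).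
have [N [mN N0 PN]] : {ae mu2, forall p, (forall n, if unpickle n is Some (X, Y) then
      Q (ratr X, ratr Y) -> 0 < p.1 < ratr X -> 0 < p.2 < ratr Y ->
      f0 p - prim g0 p = kappa n p.2 else True) /\
   mu.-integrable setT (fun x => (g0 (x, p.2))%:E)}.
  by move: all sec; apply: ae_imply2 => p.
exists N; split => // y x1 x2 c Q1 Q2 x12 N1 N2.
have [x10 y0] := Q0 _ Q1; have [x20 _] := Q0 _ Q2; rewrite /= in x10 x20 y0.
have good p : ~ N p -> (forall n, if unpickle n is Some (X, Y) then
      Q (ratr X, ratr Y) -> 0 < p.1 < ratr X -> 0 < p.2 < ratr Y ->
      f0 p - prim g0 p = kappa n p.2 else True) /\
   mu.-integrable setT (fun x => (g0 (x, p.2))%:E).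
  by move=> Np; apply: contrapT => h; apply: Np; exact: PN.
have [k1 i1] := good _ N1; have [k2 _] := good _ N2; rewrite /= in i1.
have [X [Y [x2X yY QXY]]] : exists X Y : rat,
    [/\ x2 < ratr X, y < ratr Y & Q (ratr X, ratr Y)].
  have := oQ; rewrite openE => /(_ _ Q2); rewrite /interior.
  move=> /nbhs_ballP[e /= e0 he].
  have [X /andP[xX Xe]] := @rat_between R x2 (x2 + e) (ltac:(by rewrite ltrDl)).
  have [Y /andP[yY Ye]] := @rat_between R y (y + e) (ltac:(by rewrite ltrDl)).
  exists X, Y; split => //; apply: he; split; rewrite /ball/=.
    by rewrite ltr_norml; apply/andP; split; lra.
  by rewrite ltr_norml; apply/andP; split; lra.
have := k1 (pickle (X, Y)); have := k2 (pickle (X, Y)); rewrite pickleK /=.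
move=> /(_ QXY); rewrite x20 x2X y0 yY => /(_ erefl erefl) K2.
move=> /(_ QXY); rewrite x10 (lt_trans x12 x2X) => /(_ erefl erefl) K1.
have fE (x : R) : Q (x, y) -> f0 (x, y) = f (x, y).
  by move=> Qx; rewrite /f0 patchE mem_set.
have -> : f (x2, y) - f (x1, y) = prim g0 (x2, y) - prim g0 (x1, y).
  by rewrite -!fE//; lra.
apply: le_trans (prim_diff_le c x10 x12 i1) _.
rewrite le_eqVlt; apply/orP; left; apply/eqP; apply: eq_integral => x.
rewrite inE/= in_itv/= => /andP[x1x xx2]; rewrite /g0 patchE mem_set//.
apply: (Qd _ _ _ _ Q2); apply/andP; split => //; last exact: ltW.
exact: lt_trans x1x.
Qed.

End acl.

(** * Pointwise oscillation bounds from row and column energies *)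

Section oscillation.
Variable R : realType.
Local Notation mu := (@lebesgue_measure R).
Local Notation mu2 := (mu \x mu)%E.

Lemma cauchy_schwarz0 (D : set R) (f : R -> R) (l m : R) :
  measurable D -> measurable_fun D f -> 0 < l -> 0 <= m -> (mu D <= l%:E)%E ->
  (\int[mu]_(x in D) (f x ^+ 2)%:E <= m%:E)%E ->
  (\int[mu]_(x in D) (`|f x|)%:E <= (Num.sqrt (l * m))%:E)%E.
Proof.
move=> mD mf l0 m0 muD fm.
apply/lee_addgt0Pr => e e0.
(* The earlier inequality takes a positive bound. Enlarging [m] by [e ^+ 2 / l] costs at most [e],
   as [sqrt (l * m + e ^+ 2) <= sqrt (l * m) + e]. *)
have e2 : 0 < e ^+ 2 / l by rewrite divr_gt0 ?exprn_gt0.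
have m1 : 0 < m + e ^+ 2 / l by rewrite ltr_wpDl.
have fm1 : (\int[mu]_(x in D) (f x ^+ 2)%:E <= (m + e ^+ 2 / l)%:E)%E.
  by apply: le_trans fm _; rewrite lee_fin lerDl ltW.
have cs := @cauchy_schwarz R _ (measurableTypeR R) mu D f l _ mD mf l0 m1 muD fm1.
apply: le_trans cs _.
have lm0 : 0 <= l * m by exact: mulr_ge0 (ltW l0) m0.
rewrite -EFinD lee_fin -(ler_pXn2r (n := 2)) ?nnegrE ?sqrtr_ge0//; last first.
  by rewrite addr_ge0 ?sqrtr_ge0//; exact: ltW.
rewrite sqr_sqrtr; last by rewrite mulr_ge0//; [exact: ltW|exact: addr_ge0 m0 (ltW e2)].
rewrite mulrDr mulrCA divff ?gt_eqF// mulr1 sqrrD sqr_sqrtr//.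
by rewrite lerD2r lerDl mulrn_wge0// mulr_ge0 ?sqrtr_ge0//; exact: ltW.
Qed.

Lemma measureU_null (A B : set (R * R)) : measurable A -> measurable B ->
  mu2 A = 0 -> mu2 B = 0 -> mu2 (A `|` B) = 0.
Proof.
move=> mA mB A0 B0; apply/eqP; rewrite -measure_le0.
by apply: le_trans (measureU2 mu2 mA mB) _; rewrite /= A0 B0 adde0.
Qed.

(** The energy of the row at height [y]. [fine] makes it 0 on rows of infinite energy; by
    [ae_rowint] these form a null set when the total energy is finite. *)
Definition rowint (K : R * R -> R) (y : R) : R :=
  fine (\int[mu]_x (K (x, y) ^+ 2)%:E)%E.

Lemma rowint_ge0 K y : 0 <= rowint K y.
Proof. by apply: fine_ge0; apply: integral_ge0 => x _; rewrite lee_fin sqr_ge0. Qed.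

Section rowint.
Variable K : R * R -> R.
Hypothesis mK : measurable_fun setT K.
Let mK2 : measurable_fun setT (fun p => (K p ^+ 2)%:E).
Proof. by apply/measurable_EFinP; exact: measurable_funX. Qed.
Let K20 p : (0 <= (K p ^+ 2)%:E)%E.
Proof. by rewrite lee_fin sqr_ge0. Qed.

Lemma measurable_rowint : measurable_fun setT (rowint K).
Proof.
have := measurable_tonelli2 mK2 K20.
by move=> m; apply: (measurableT_comp _ m).
Qed.

Lemma integral_rowint_le :
  (\int[mu]_y (rowint K y)%:E <= \int[mu2]_p (K p ^+ 2)%:E)%E.
Proof.
rewrite (tonelli2 mK2 K20); apply: ge0_le_integral => //.
- by move=> y _; rewrite lee_fin rowint_ge0.
- by apply/measurable_EFinP; exact: measurable_rowint.
- exact: (measurable_tonelli2 mK2 K20).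
move=> y _; rewrite /rowint.
have : (0 <= \int[mu]_x (K (x, y) ^+ 2)%:E)%E by exact: integral_ge0.
by case: (\int[mu]_x _)%E => [r| |]//; rewrite leey.
Qed.

Lemma ae_rowint : (\int[mu2]_p (K p ^+ 2)%:E < +oo)%E ->
  {ae mu, forall y, (\int[mu]_x (K (x, y) ^+ 2)%:E = (rowint K y)%:E)%E}.
Proof.
rewrite (tonelli2 mK2 K20) => Koo.
have : mu.-integrable setT (fun y : R => \int[mu]_x (K (x, y) ^+ 2)%:E)%E.
  apply/integrableP; split; first exact: (measurable_tonelli2 mK2 K20).
  by under eq_integral do rewrite gee0_abs ?integral_ge0//.
move=> /(integrable_ae measurableT); apply: ae_imply => y /(_ I) fy.
by rewrite /rowint fineK.
Qed.

End rowint.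

(** The one-dimensional Sobolev embedding, with the distance of the two points replaced by the width
    [a] of the domain; [p y] stands for the energy of the derivative on the row. *)
Definition rowlip (Q N : set (R * R)) (a : R) (K : R * R -> R) (p : R -> R) :=
  forall x1 x2 y : R, Q (x1, y) -> Q (x2, y) -> ~ N (x1, y) -> ~ N (x2, y) ->
    `|K (x1, y) - K (x2, y)| <= Num.sqrt (a * p y).

Definition collip (Q N : set (R * R)) (b : R) (K : R * R -> R) (p : R -> R) :=
  forall x y1 y2 : R, Q (x, y1) -> Q (x, y2) -> ~ N (x, y1) -> ~ N (x, y2) ->
    `|K (x, y1) - K (x, y2)| <= Num.sqrt (b * p x).

Lemma rowlip_ftc (Q N : set (R * R)) (a : R) (K K1 : R * R -> R) : 0 < a ->
  (forall p, Q p -> 0 < p.1 < a) -> measurable N -> mu2 N = 0 ->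
  measurable_fun setT K1 -> (\int[mu2]_p (K1 p ^+ 2)%:E < +oo)%E ->
  ftc_off Q N K K1 ->
  exists N', [/\ measurable N', mu2 N' = 0 & rowlip Q N' a K (rowint K1)].
Proof.
move=> a0 Qa mN N0 mK1 K1oo ftc.
have [M [mM M0 PM]] := ae_snd (ae_rowint mK1 K1oo).
exists (N `|` M); split; [exact: measurableU|exact: measureU_null|].
have lt12 x1 x2 y : x1 < x2 -> Q (x1, y) -> Q (x2, y) ->
    ~ (N `|` M) (x1, y) -> ~ (N `|` M) (x2, y) ->
    `|K (x2, y) - K (x1, y)| <= Num.sqrt (a * rowint K1 y).
  move=> x12 Q1 Q2 /not_orP[N1 M1] /not_orP[N2 _].
  have ry : (\int[mu]_x (K1 (x, y) ^+ 2)%:E = (rowint K1 y)%:E)%E.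
    by apply: contrapT => h; apply: M1; exact: PM.
  have := ftc y x1 x2 0 Q1 Q2 x12 N1 N2; rewrite mul0r subr0 -lee_fin => /le_trans; apply.
  have [/andP[x10 _] /andP[_ x2a]] := (Qa _ Q1, Qa _ Q2); rewrite /= in x10 x2a.
  have m12 : measurable (`]x1, x2[%classic : set R) by exact: measurable_itv.
  have msec : measurable_fun setT (fun x : R => K1 (x, y)).
    by apply/measurable_EFinP; exact: measurable_section.
  under eq_integral do rewrite subr0.
  apply: cauchy_schwarz0 => //.
  - exact: measurable_funTS.
  - exact: rowint_ge0.
  - by rewrite lebesgue_measure_itv/= lte_fin x12 -EFinB lee_fin; lra.
  rewrite -ry; apply: ge0_subset_integral => //.
  - by apply/measurable_EFinP; exact: measurable_funX.
  - by move=> x _; rewrite lee_fin sqr_ge0.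
move=> x1 x2 y Q1 Q2 N1 N2; have [x12|x21|->] := ltgtP x1 x2.
- by rewrite distrC; exact: lt12.
- exact: lt12.
- by rewrite subrr normr0 sqrtr_ge0.
Qed.

Lemma ae_fst (P : R -> Prop) : {ae mu, forall x, P x} ->
  {ae mu2, forall p, P p.1}.
Proof.
move=> [N [mN N0 PN]]; exists (N `*` setT); split.
- exact: measurableX.
- exact: (setX_null mN N0).1.
- by move=> p /= h; split => //; exact: PN.
Qed.

Lemma ae_notin (N : set (R * R)) : measurable N -> mu2 N = 0 ->
  {ae mu2, forall p, ~ N p}.
Proof.
by move=> mN N0; exists N; split => // p /contrapT.
Qed.

(* Since [Q] is closed under decreasing either coordinate, [p] is joined inside
   [Q] to a point of the small box by an L-shaped path. *)
Lemma oscillation (Q N : set (R * R)) (a b m1 m2 : R) (K : R * R -> R)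
    (p1 p2 : R -> R) :
  lower_open Q -> 0 < a -> 0 < b ->
  (forall x y, 0 < x < a / 2 -> 0 < y < b / 2 -> Q (x, y)) ->
  measurable N -> mu2 N = 0 ->
  measurable_fun setT p1 -> (forall y, 0 <= p1 y) ->
  measurable_fun setT p2 -> (forall x, 0 <= p2 x) ->
  (\int[mu]_y (p1 y)%:E < m1%:E)%E -> (\int[mu]_x (p2 x)%:E < m2%:E)%E ->
  rowlip Q N a K p1 -> collip Q N b K p2 ->
  exists k0 : R, {ae mu2, forall p, Q p ->
    `|K p - k0| <= Num.sqrt (a * p1 p.2) + Num.sqrt (b * p2 p.1) +
      (Num.sqrt (a * (m1 / (b / 2))) + Num.sqrt (b * (m2 / (a / 2))))}.
Proof.
move=> [_ _ Q0 Qd] a0 b0 Qab mN N0 mp1 p10 mp2 p20 p1m p2m row col.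
have a2 : 0 < a / 2 by rewrite divr_gt0.
have b2 : 0 < b / 2 by rewrite divr_gt0.
have sub (p : R -> R) (m c : R) : (forall y, 0 <= p y) -> measurable_fun setT p ->
    (\int[mu]_y (p y)%:E < m%:E)%E -> (\int[mu]_(y in `]0%R, c[) (p y)%:E < m%:E)%E.
  move=> p0 mp; apply: le_lt_trans; apply: ge0_subset_integral => //.
  - exact/measurable_EFinP.
  - by move=> x _; rewrite lee_fin.
(* The centre [(xq, yq)] is taken in the small box, on a generic row and a generic column of at most
   average energy. This produces [m1 / (b / 2)] and [m2 / (a / 2)]. *)
have [yq [yq0 yqN yqp]] := ae_exists_le b2 (measurable_funTS mp1) p10
  (sub _ _ _ p10 mp1 p1m) (ae_ysection_notin mN N0).
have Px : {ae mu, forall x, {ae mu, forall y, ~ N (x, y)} /\ ~ N (x, yq)}.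
  by move: (ae_xsection_notin mN N0) yqN; apply: ae_imply2 => x.
have [xq [xq0 [xqN qN] xqp]] := ae_exists_le a2 (measurable_funTS mp2) p20
  (sub _ _ _ p20 mp2 p2m) Px.
rewrite !subr0 in yqp xqp.
have Qq : Q (xq, yq) by exact: Qab.
exists (K (xq, yq)).
have c1 : Num.sqrt (a * p1 yq) <= Num.sqrt (a * (m1 / (b / 2))).
  by apply: ler_wsqrtr; rewrite ler_pM2l.
have c2 : Num.sqrt (b * p2 xq) <= Num.sqrt (b * (m2 / (a / 2))).
  by apply: ler_wsqrtr; rewrite ler_pM2l.
have good : {ae mu2, forall p, ~ N p /\ (~ N (xq, p.2) /\ ~ N (p.1, yq))}.
  have h1 : {ae mu2, forall p, ~ N (xq, p.2) /\ ~ N (p.1, yq)}.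
    by move: (ae_snd xqN) (ae_fst yqN); apply: ae_imply2 => p.
  by move: (ae_notin mN N0) h1; apply: ae_imply2 => p.
move: good; apply: ae_imply => -[x y] /= [Np [N1 N2]] Qp.
have [/= x0 y0] := Q0 _ Qp.
have [/andP[xq00 _] /andP[yq00 _]] := (xq0, yq0).
have s1 : 0 <= Num.sqrt (a * p1 y) by exact: sqrtr_ge0.
have s2 : 0 <= Num.sqrt (b * p2 x) by exact: sqrtr_ge0.
have s3 : 0 <= Num.sqrt (a * p1 yq) by exact: sqrtr_ge0.
have s4 : 0 <= Num.sqrt (b * p2 xq) by exact: sqrtr_ge0.
(* The corner of the path must lie in [Q]: [(xq, y)] does when it is to the left of the given point,
   and otherwise [(x, yq)] is to the left of the centre. *)
have [xqx|xxq] := leP xq x.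
  have Qc : Q (xq, y) by apply: (Qd _ _ _ _ Qp); rewrite ?xq00 ?y0 ?lexx.
  have r := row _ _ _ Qp Qc Np N1; have c := col _ _ _ Qc Qq N1 qN.
  apply: le_trans (ler_distD (K (xq, y)) _ _) _.
  by move: r c c1 c2 s1 s2 s3 s4; clear; lra.
have Qc : Q (x, yq) by apply: (Qd _ _ _ _ Qq); rewrite ?x0 ?yq00 ?lexx ?ltW.
have r := row _ _ _ Qc Qq N2 qN; have c := col _ _ _ Qp Qc Np N2.
apply: le_trans (ler_distD (K (x, yq)) _ _) _.
by move: r c c1 c2 s1 s2 s3 s4; clear; lra.
Qed.

End oscillation.

(** * The anisotropic Poincare inequality, and increments along a line up to a vertex *)

Section line.
Variable R : realType.
Local Notation mu := (@lebesgue_measure R).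
Local Notation mu2 := (mu \x mu)%E.

Lemma ge0_integral_tensor (u v : R -> R) :
  measurable_fun setT u -> measurable_fun setT v ->
  (forall x, 0 <= u x) -> (forall y, 0 <= v y) ->
  (\int[mu2]_p (tensor u v p)%:E = (\int[mu]_x (u x)%:E) * (\int[mu]_y (v y)%:E))%E.
Proof.
move=> mu_ mv u0 v0.
have mt : measurable_fun setT (fun p => (tensor u v p)%:E).
  apply/measurable_EFinP; apply: measurable_funM; first exact: measurable_fst_comp.
  exact: measurable_snd_comp.
rewrite (tonelli1 mt); last by move=> p; rewrite lee_fin mulr_ge0.
have v0' : (0 <= \int[mu]_y (v y)%:E)%E by apply: integral_ge0 => y _; rewrite lee_fin.
have mv' : measurable_fun setT (EFin \o v) by exact/measurable_EFinP.
have mu' : measurable_fun setT (EFin \o u) by exact/measurable_EFinP.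
transitivity (\int[mu]_x ((u x)%:E * \int[mu]_y (v y)%:E))%E.
  apply: eq_integral => x _.
  exact: (@ge0_integralZl_EFin _ (measurableTypeR R) R mu setT measurableT (EFin \o v)
    (fun y _ => v0 y) mv' (u x) (u0 x)).
exact: (@ge0_integralZr _ (measurableTypeR R) R mu setT measurableT (EFin \o u) mu' _
    (fun y _ => u0 y) v0').
Qed.

Lemma integral_inv_sqrt (L x1 x2 : R) : x1 < x2 -> x2 < L ->
  (\int[mu]_(x in `]x1, x2[) ((Num.sqrt (L - x))^-1)%:E <= (2 * Num.sqrt (L - x1))%:E)%E.
Proof.
move=> x12 x2L.
pose F (x : R) : R := - 2 * Num.sqrt (L - x).
have dF (x : R) : x < L -> is_derive x (1 : R) F (Num.sqrt (L - x))^-1.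
  move=> xL; have Lx : 0 < L - x by rewrite subr_gt0.
  have d1 : is_derive x (1 : R) (fun x : R => L - x) (- 1).
    have := @is_deriveB _ _ _ (cst L) id x 1 0 1 (is_derive_cst _ _ _) (is_derive_id _ _).
    by rewrite sub0r.
  have d2 := @is_derive1_comp R Num.sqrt (fun x => L - x) x _ _ (is_derive1_sqrt Lx) d1.
  have d3 := @is_deriveZ _ _ _ _ (- 2) x 1 _ d2.
  have -> : F = (- 2) \*: (Num.sqrt \o (fun x : R => L - x)) by apply/funext.
  apply: (is_derive_eq d3); rewrite /GRing.scale/=; field.
  by rewrite gt_eqF// sqrtr_gt0.
have cf (x : R) : x < L -> {for x, continuous (fun x : R => (Num.sqrt (L - x))^-1)}.
  move=> xL; apply: cvgV; first by rewrite gt_eqF// sqrtr_gt0 subr_gt0.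
  apply: continuous_comp; last exact: sqrt_continuous.
  by apply: cvgB; [exact: cvg_cst|exact: cvg_id].
have mf : measurable_fun `]x1, x2[ (fun x : R => ((Num.sqrt (L - x))^-1)%:E).
  apply/measurable_EFinP; apply: open_continuous_measurable_fun => //.
  by move=> x; rewrite inE/= in_itv/= => /andP[_ xx2]; apply: cf; exact: lt_trans x2L.
rewrite -(@integral_itv_bndoo _ x1 x2 _ true false)//.
have cF (x : R) : x < L -> {for x, continuous F}.
  move=> xL; apply: differentiable_continuous; apply/derivable1_diffP.
  exact: (@ex_derive _ _ _ _ _ _ _ (dF x xL)).
rewrite (@continuous_FTC2 R (fun x : R => (Num.sqrt (L - x))^-1) F x1 x2 x12).
- rewrite -EFinB lee_fin /F.
  have : 0 <= Num.sqrt (L - x2) by exact: sqrtr_ge0.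
  by lra.
- apply: continuous_in_subspaceT => x; rewrite inE/= in_itv/= => /andP[_ xx2].
  by apply: cf; exact: le_lt_trans x2L.
- split.
  + move=> x; rewrite in_itv/= => /andP[_ xx2].
    exact: (@ex_derive _ _ _ _ _ _ _ (dF x (lt_trans xx2 x2L))).
  + by apply: cvg_at_right_filter; apply: cF; exact: lt_trans x2L.
  + by apply: cvg_at_left_filter; apply: cF.
- move=> x; rewrite in_itv/= => /andP[_ xx2].
  by rewrite derive1E (@derive_val _ _ _ _ _ _ _ (dF x (lt_trans xx2 x2L))).
Qed.

Section estimates.
Variables (Q : set (R * R)) (a b m1 m2 c0 k0 : R) (K : R * R -> R) (p1 p2 : R -> R).
Hypothesis loQ : lower_open Q.
Hypotheses (a0 : 0 < a) (b0 : 0 < b) (c00 : 0 <= c0).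
Hypothesis Qab : forall p, Q p -> 0 < p.1 < a /\ 0 < p.2 < b.
Hypothesis mK : measurable_fun setT K.
Hypotheses (mp1 : measurable_fun setT p1) (p10 : forall y, 0 <= p1 y).
Hypotheses (mp2 : measurable_fun setT p2) (p20 : forall x, 0 <= p2 x).
Hypothesis p1m : (\int[mu]_y (p1 y)%:E < m1%:E)%E.
Hypothesis p2m : (\int[mu]_x (p2 x)%:E < m2%:E)%E.
Hypothesis bound : {ae mu2, forall p, Q p ->
  `|K p - k0| <= Num.sqrt (a * p1 p.2) + Num.sqrt (b * p2 p.1) + c0}.

(** Each term of the pointwise bound depends on at most one variable, so its square integrates over
    the box []0, a[ x ]0, b[] to a product. The factor 3 comes from [(u + v + c0) ^+ 2 <= 3 * (u ^+
    2 + v ^+ 2 + c0 ^+ 2)]. *)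
Lemma oscillation_L2 :
  (\int[mu2]_(p in Q) ((K p - k0) ^+ 2)%:E <=
   (3 * (a ^+ 2 * m1 + b ^+ 2 * m2 + a * b * c0 ^+ 2))%:E)%E.
Proof.
have [_ mQ _ _] := loQ.
pose ia := \1_(`]0, a[%classic) : R -> R.
pose ib := \1_(`]0, b[%classic) : R -> R.
have mia : measurable_fun setT ia by exact: measurable_indic_itv.
have mib : measurable_fun setT ib by exact: measurable_indic_itv.
have ia0 x : 0 <= ia x by rewrite /ia indicE.
have ib0 x : 0 <= ib x by rewrite /ib indicE.
have iI (c : R) : 0 < c -> (\int[mu]_x (\1_(`]0, c[%classic) x : R)%:E = c%:E)%E.
  move=> c_gt0; rewrite integral_indic//= setIT lebesgue_measure_itv/= lte_fin c_gt0.
  by rewrite -EFinB subr0.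
have mt (u v : R -> R) : measurable_fun setT u -> measurable_fun setT v ->
    measurable_fun setT (tensor u v).
  by move=> ? ?; apply: measurable_funM; [exact: measurable_fst_comp|exact: measurable_snd_comp].
pose G1 := tensor ia p1; pose G2 := tensor p2 ib; pose G3 := tensor ia ib.
have G10 p : 0 <= G1 p by exact: mulr_ge0.
have G20 p : 0 <= G2 p by exact: mulr_ge0.
have G30 p : 0 <= G3 p by exact: mulr_ge0.
have mG1 : measurable_fun setT G1 by exact: mt.
have mG2 : measurable_fun setT G2 by exact: mt.
have mG3 : measurable_fun setT G3 by exact: mt.
pose G p := 3 * a * G1 p + 3 * b * G2 p + 3 * c0 ^+ 2 * G3 p.
have ca : 0 <= 3 * a by rewrite mulr_ge0// ltW.
have cb : 0 <= 3 * b by rewrite mulr_ge0// ltW.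
have cc : 0 <= 3 * c0 ^+ 2 by rewrite mulr_ge0// sqr_ge0.
have G0 p : 0 <= G p by rewrite !addr_ge0// mulr_ge0.
have mG : measurable_fun setT G.
  by apply: measurable_funD; [apply: measurable_funD|]; exact: measurable_funM.
apply: (@le_trans _ _ (\int[mu2]_(p in Q) (G p)%:E)%E).
  apply: ae_ge0_le_integral => //.
  - by move=> p _; rewrite lee_fin sqr_ge0.
  - apply/measurable_EFinP; apply: measurable_funX; apply: measurable_funB => //.
    exact: measurable_funTS.
  - by move=> p _; rewrite lee_fin.
  - by apply/measurable_EFinP; exact: measurable_funTS.
  move: bound; apply: ae_imply => -[x y] /= bp Qp; rewrite lee_fin.
  have [/= xa yb] := Qab Qp.
  rewrite /G /G1 /G2 /G3 /tensor /ia /ib /= !indic_itvE xa yb.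
  have := bp Qp; rewrite -(real_normK (num_real (K (x, y) - k0))).
  have u2 : Num.sqrt (a * p1 y) ^+ 2 = a * p1 y by rewrite sqr_sqrtr// mulr_ge0// ltW.
  have v2 : Num.sqrt (b * p2 x) ^+ 2 = b * p2 x by rewrite sqr_sqrtr// mulr_ge0// ltW.
  move: u2 v2 (sqrtr_ge0 (a * p1 y)) (sqrtr_ge0 (b * p2 x)).
  move: (Num.sqrt (a * p1 y)) (Num.sqrt (b * p2 x)) (normr_ge0 (K (x, y) - k0)).
  move: (`|K (x, y) - k0|) => z u v z0 u2 v2 u0 v0 zuv.
  apply: (@le_trans _ _ ((u + v + c0) ^+ 2)).
    by rewrite ler_pXn2r// nnegrE !addr_ge0.
  rewrite mul1r !mulr1 -[3 * a * _]mulrA -[3 * b * _]mulrA -u2 -v2.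
  have h1 : 0 <= (u - v) ^+ 2 by exact: sqr_ge0.
  have h2 : 0 <= (u - c0) ^+ 2 by exact: sqr_ge0.
  have h3 : 0 <= (v - c0) ^+ 2 by exact: sqr_ge0.
  have -> : (u + v + c0) ^+ 2 = 3 * u ^+ 2 + 3 * v ^+ 2 + 3 * c0 ^+ 2 -
    (u - v) ^+ 2 - (u - c0) ^+ 2 - (v - c0) ^+ 2 by ring.
  by move: h1 h2 h3; move: ((u - v) ^+ 2) ((u - c0) ^+ 2) ((v - c0) ^+ 2) => A B C; lra.
apply: (@le_trans _ _ (\int[mu2]_p (G p)%:E)%E).
  apply: ge0_subset_integral => //.
  - by apply/measurable_EFinP.
  - by move=> p _; rewrite lee_fin.
have eG : (\int[mu2]_p (G p)%:E = (3 * a)%:E * \int[mu2]_p (G1 p)%:E +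
    (3 * b)%:E * \int[mu2]_p (G2 p)%:E + (3 * c0 ^+ 2)%:E * \int[mu2]_p (G3 p)%:E)%E.
  have mE (H : R * R -> R) : measurable_fun setT H -> measurable_fun setT (fun p => (H p)%:E).
    by move=> mH; apply/measurable_EFinP.
  rewrite -!ge0_integralZl_EFin//; try by [apply: mE|move=> p _; rewrite lee_fin].
  rewrite -ge0_integralD//; last 4 first.
  - by move=> p _; rewrite -EFinM lee_fin mulr_ge0.
  - by apply: emeasurable_funM => //; exact: mE.
  - by move=> p _; rewrite -EFinM lee_fin mulr_ge0.
  - by apply: emeasurable_funM => //; exact: mE.
  rewrite -ge0_integralD//.
  - by move=> p _; rewrite -!EFinM -EFinD lee_fin addr_ge0// mulr_ge0.
  - by apply: emeasurable_funD; apply: emeasurable_funM => //; exact: mE.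
  - by move=> p _; rewrite -EFinM lee_fin mulr_ge0.
  - by apply: emeasurable_funM => //; exact: mE.
rewrite eG !ge0_integral_tensor// iI// iI//.
have -> : 3 * (a ^+ 2 * m1 + b ^+ 2 * m2 + a * b * c0 ^+ 2) =
   3 * a * (a * m1) + 3 * b * (m2 * b) + 3 * c0 ^+ 2 * (a * b) by ring.
rewrite 2!EFinD [(3 * c0 ^+ 2 * (a * b))%:E]EFinM [(a * b)%:E]EFinM.
apply: leeD => //; apply: leeD.
  rewrite [X in (_ <= X)%E]EFinM; apply: lee_wpmul2l; first by rewrite lee_fin.
  by rewrite [X in (_ <= X)%E]EFinM; apply: lee_wpmul2l; [rewrite lee_fin ltW|exact: ltW].
rewrite [X in (_ <= X)%E]EFinM; apply: lee_wpmul2l; first by rewrite lee_fin.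
by rewrite [X in (_ <= X)%E]EFinM; apply: lee_wpmul2r; [rewrite lee_fin ltW|exact: ltW].
Qed.

Variables (N : set (R * R)) (f : R * R -> R) (kap L xs : R).
Hypotheses (mN : measurable N) (N0 : mu2 N = 0).
Hypotheses (ftc : ftc_off Q N f K) (col : collip Q N b K p2).
Hypotheses (kap0 : 0 < kap) (xs0 : 0 <= xs).
Hypothesis cone : forall x y, xs < x < L -> 0 < y < kap * (L - x) -> Q (x, y).

(* [K (x, y0)] is compared with [K (x, y)] for a well-chosen height
   [y < kap * (L - x)]; the resulting singularity [(L - x) ^ (-1/2)] at the
   vertex is integrable. *)
Lemma line_bound (y0 : R) : {ae mu, forall x, ~ N (x, y0)} ->
  {ae mu, forall x, xs < x < L -> Q (x, y0) ->
    `|K (x, y0) - k0| <= 2 * Num.sqrt (b * p2 x) + c0 +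
      Num.sqrt (a * m1 / kap) * (Num.sqrt (L - x))^-1}.
Proof.
move=> Ny0.
have [M [mM M0 PM]] := bound.
have good : {ae mu, forall x, {ae mu, forall y, ~ N (x, y) /\
    (Q (x, y) -> `|K (x, y) - k0| <= Num.sqrt (a * p1 y) + Num.sqrt (b * p2 x) + c0)}}.
  move: (ae_xsection_notin mN N0) (ae_xsection_notin mM M0).
  apply: ae_imply2 => x; apply: ae_imply2 => y Nxy Mxy; split => //.
  by move=> Qxy; apply: contrapT => h; apply: Mxy; apply: PM => /= /(_ Qxy).
have sub (c : R) : (\int[mu]_(y in `]0%R, c[) (p1 y)%:E < m1%:E)%E.
  apply: le_lt_trans p1m; apply: ge0_subset_integral => //.
  - exact/measurable_EFinP.
  - by move=> x _; rewrite lee_fin.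
move: Ny0 good; apply: ae_imply2 => x Nx0 gx /andP[xsx xL] Qx0.
have Lx : 0 < L - x by rewrite subr_gt0.
have kLx : 0 < kap * (L - x) by rewrite mulr_gt0.
have [y [/andP[y_gt0 yk] [Nxy bxy] p1y]] :=
  ae_exists_le kLx (measurable_funTS mp1) p10 (sub _) gx.
rewrite subr0 in p1y.
have Qxy : Q (x, y) by apply: cone; rewrite ?xsx ?y_gt0.
(* The column energy is paid twice, in the bound at [(x, y)] and for moving back to the height [y0];
   hence the factor 2. *)
have h1 := bxy Qxy; have h2 := col Qx0 Qxy Nx0 Nxy.
have m10 : 0 <= m1.
  rewrite -lee_fin; apply: le_trans (ltW p1m); apply: integral_ge0 => z _.
  by rewrite lee_fin.
have h3 : Num.sqrt (a * p1 y) <= Num.sqrt (a * m1 / kap) * (Num.sqrt (L - x))^-1.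
  rewrite -(sqrtrV (ltW Lx)) -sqrtrM; last first.
    by apply: divr_ge0; [exact: mulr_ge0 (ltW a0) m10|exact: ltW].
  apply: ler_wsqrtr.
  rewrite (_ : a * m1 / kap * (L - x)^-1 = a * (m1 / (kap * (L - x)))).
    by rewrite ler_pM2l.
  by field; rewrite !gt_eqF.
apply: le_trans (ler_distD (K (x, y)) _ _) _.
apply: le_trans (lerD h2 h1) _.
by rewrite mulr_natl mulr2n; move: h3; lra.
Qed.

(** [line_bound] is integrated along the row: the column energies by Cauchy-Schwarz over a length at
    most [a], the inverse square root by its primitive. The cone holds the comparison points, not
    the line itself, so the estimate is available at almost every height. The nested quantifiers let
    a height and then two end points be picked one after the other. *)
Lemma line_estimate : {ae mu, forall y0, {ae mu, forall x1, {ae mu, forall x2,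
  xs < x1 < x2 -> x2 < L -> Q (x2, y0) ->
  `|f (x2, y0) - f (x1, y0) - k0 * (x2 - x1)| <=
    2 * Num.sqrt (b * (a * m2)) + c0 * (x2 - x1) +
    2 * Num.sqrt (a * m1 / kap) * Num.sqrt (L - xs)}}}.
Proof.
have [_ mQ Q0 Qd] := loQ.
move: (ae_ysection_notin mN N0); apply: ae_imply => y0 Ny0.
have lb := line_bound Ny0.
move: (Ny0); apply: ae_imply => x1 Nx1.
move: (Ny0); apply: ae_imply => x2 Nx2 /andP[xs1 x12] x2L Q2.
have x10 : 0 < x1 by exact: le_lt_trans xs0 xs1.
have [_ /= y00] := Q0 _ Q2.
have Qx x : 0 < x <= x2 -> Q (x, y0).
  by move=> x02; apply: (Qd _ _ _ _ Q2) => //; rewrite y00 lexx.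
have Q1 : Q (x1, y0) by apply: Qx; rewrite x10 ltW.
have [/= /andP[_ x2a] _] := Qab Q2.
rewrite -lee_fin; apply: le_trans (ftc k0 Q1 Q2 x12 Nx1 Nx2) _.
set I := `]x1, x2[%classic.
have mI : measurable (I : set R) by exact: measurable_itv.
have m20 : 0 <= m2.
  rewrite -lee_fin; apply: le_trans (ltW p2m); apply: integral_ge0 => z _.
  by rewrite lee_fin.
pose s1 (x : R) := 2 * Num.sqrt (b * p2 x).
pose A := Num.sqrt (a * m1 / kap).
pose s3 (x : R) := A * (Num.sqrt (L - x))^-1.
have ms : measurable_fun setT (fun x : R => Num.sqrt (b * p2 x)).
  apply: measurableT_comp; first by apply: continuous_measurable_fun; exact: sqrt_continuous.
  exact: measurable_funM.
have ms1 : measurable_fun I (fun x => (s1 x)%:E).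
  by apply/measurable_EFinP; apply: measurable_funTS; exact: measurable_funM.
have ms3' : measurable_fun I (fun x : R => (Num.sqrt (L - x))^-1).
  apply: open_continuous_measurable_fun => // x.
  rewrite inE /I /= in_itv/= => /andP[_ xx2]; apply: cvgV.
    by rewrite gt_eqF// sqrtr_gt0 subr_gt0; exact: lt_trans x2L.
  apply: continuous_comp; last exact: sqrt_continuous.
  by apply: cvgB; [exact: cvg_cst|exact: cvg_id].
have ms3 : measurable_fun I (fun x => (s3 x)%:E).
  by apply/measurable_EFinP; exact: measurable_funM.
have s10 x : 0 <= s1 x by rewrite mulr_ge0// sqrtr_ge0.
have s30 x : 0 <= s3 x by rewrite mulr_ge0// ?invr_ge0 sqrtr_ge0.
have mKy : measurable_fun setT (fun x : R => K (x, y0)).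
  by apply/measurable_EFinP; exact: measurable_section.
apply: (@le_trans _ _ (\int[mu]_(x in I) ((s1 x)%:E + c0%:E + (s3 x)%:E))%E).
  apply: ae_ge0_le_integral => //.
  - apply/measurable_EFinP; apply: measurableT_comp => //.
    by apply: measurable_funB => //; exact: measurable_funTS.
  - by move=> x _; rewrite -!EFinD lee_fin !addr_ge0.
  - by apply: emeasurable_funD => //; exact: emeasurable_funD.
  move: lb; apply: ae_imply => x + Ix; rewrite -!EFinD lee_fin.
  move: Ix; rewrite /I /= in_itv/= => /andP[x1x xx2]; apply.
    by rewrite (lt_trans xs1 x1x) (lt_trans xx2 x2L).
  by apply: Qx; rewrite (lt_trans x10 x1x) ltW.
have muI : mu I = (x2 - x1)%:E.
  by rewrite lebesgue_measure_itv/= lte_fin x12 -EFinB.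
have eI : (\int[mu]_(x in I) ((s1 x)%:E + c0%:E + (s3 x)%:E) =
    \int[mu]_(x in I) (s1 x)%:E + \int[mu]_(x in I) c0%:E + \int[mu]_(x in I) (s3 x)%:E)%E.
  rewrite ge0_integralD//; try by
    [exact: emeasurable_funD|move=> x _; rewrite -?EFinD lee_fin ?addr_ge0].
  by rewrite ge0_integralD//; move=> x _; rewrite lee_fin.
rewrite eI.
rewrite !EFinD; apply: leeD; first apply: leeD.
- have hs0 x : I x -> (0 <= (Num.sqrt (b * p2 x))%:E)%E by rewrite lee_fin sqrtr_ge0.
  have hsm : measurable_fun I (fun x => (Num.sqrt (b * p2 x))%:E).
    by apply/measurable_EFinP; exact: measurable_funTS.
  have e1 := @ge0_integralZl_EFin _ (measurableTypeR R) R mu I mI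
    (fun x => (Num.sqrt (b * p2 x))%:E) hs0 hsm 2 (ler0n R 2).
  rewrite [X in (X <= _)%E]e1 [X in (_ <= X)%E]EFinM; apply: lee_wpmul2l => //.
  rewrite mulrCA [b * m2]mulrC.
  under eq_integral do rewrite -[X in X%:E](ger0_norm (sqrtr_ge0 _)).
  apply: cauchy_schwarz0 => //.
  + exact: measurable_funTS.
  + by rewrite mulr_ge0// ltW.
  + by rewrite [X in (X <= _)%E]muI lee_fin; lra.
  apply: (@le_trans _ _ (b%:E * \int[mu]_x (p2 x)%:E)%E); last first.
    rewrite [m2 * b]mulrC EFinM; apply: lee_wpmul2l; last exact: ltW.
    by rewrite lee_fin ltW.
  have hp0 x : setT x -> (0 <= (p2 x)%:E)%E by rewrite lee_fin.
  have hpm : measurable_fun setT (fun x => (p2 x)%:E) by exact/measurable_EFinP.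
  have e2 := @ge0_integralZl_EFin _ (measurableTypeR R) R mu setT measurableT
    (fun x => (p2 x)%:E) hp0 hpm b (ltW b0).
  rewrite -[X in (_ <= X)%E]e2.
  apply: (@le_trans _ _ (\int[mu]_(x in I) (b * p2 x)%:E)%E).
    rewrite le_eqVlt; apply/orP; left; apply/eqP; apply: eq_integral => x _.
    by rewrite sqr_sqrtr// mulr_ge0// ltW.
  apply: ge0_subset_integral => //.
  + by apply/measurable_EFinP; exact: measurable_funM.
  + by move=> x _; rewrite lee_fin mulr_ge0// ltW.
- by rewrite integral_cst//= [X in (_ * X)%E]muI -EFinM.
have hs0 x : I x -> (0 <= ((Num.sqrt (L - x))^-1)%:E)%E.
  by rewrite lee_fin invr_ge0 sqrtr_ge0.
have hsm : measurable_fun I (fun x => ((Num.sqrt (L - x))^-1)%:E).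
  exact/measurable_EFinP.
have e1 := @ge0_integralZl_EFin _ (measurableTypeR R) R mu I mI
    (fun x => ((Num.sqrt (L - x))^-1)%:E) hs0 hsm A (sqrtr_ge0 _).
rewrite [X in (X <= _)%E]e1.
apply: (@le_trans _ _ (A%:E * (2 * Num.sqrt (L - xs))%:E)%E); last first.
  by rewrite -EFinM lee_fin mulrCA mulrA.
apply: lee_wpmul2l; first by rewrite lee_fin sqrtr_ge0.
apply: le_trans (integral_inv_sqrt x12 x2L) _.
by rewrite lee_fin ler_pM2l// ler_wsqrtr// lerB// ltW.
Qed.

End estimates.
End line.

(** * Geometry of the quadrilateral *)

Section geometry.
Variable R : realType.
Implicit Types (s t : R) (p : R * R).

(** The sides come in the order A1 A5, A1 A2, A2 A3, A3 A5; the inequalities are strict because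
    [Qhat] is an interior. *)
Definition polygon s t : set (R * R) :=
  [set p | [/\ 0 < p.1, 0 < p.2, p.1 + p.2 < 1 &
     (1 - s) * p.2 + (t - s) * p.1 < t * (1 - s)]].

Definition halfplane (al be ga : R) : set (R * R) :=
  [set p | 0 < al + be * p.1 + ga * p.2].

Lemma open_halfplane al be ga : open (halfplane al be ga).
Proof.
rewrite (_ : halfplane al be ga =
    (fun p : R * R => al + be * p.1 + ga * p.2) @^-1` [set x | 0 < x])//.
apply: open_comp; last exact: open_gt.
move=> p _; apply: cvgD; [apply: cvgD; [exact: cvg_cst|]|].
  by apply: cvgM; [exact: cvg_cst|exact: cvg_fst].
by apply: cvgM; [exact: cvg_cst|exact: cvg_snd].
Qed.

Lemma measurable_halfplane al be ga : measurable (halfplane al be ga).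
Proof.
have m0 : measurable_fun setT (fun _ : R * R => 0 : R) by exact: measurable_cst.
have mf : measurable_fun setT (fun p : R * R => al + be * p.1 + ga * p.2).
  apply: measurable_funD; [apply: measurable_funD => //|].
    by apply: measurable_funM => //; exact: measurable_fst.
  by apply: measurable_funM => //; exact: measurable_snd.
rewrite (_ : halfplane al be ga =
  (fun p : R * R => 0 < al + be * p.1 + ga * p.2) @^-1` [set true])//.
by rewrite -[X in measurable X]setTI; exact: (measurable_fun_ltr m0 mf).
Qed.

Lemma polygonE s t : polygon s t = halfplane 0 1 0 `&` halfplane 0 0 1 `&`
  (halfplane 1 (- 1) (- 1) `&` halfplane (t * (1 - s)) (- (t - s)) (- (1 - s))).
Proof.
apply/seteqP; split => [[x y]|[x y]]; rewrite /polygon /halfplane /=.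
  by move=> [h1 h2 h3 h4]; do !split => /=; lra.
by move=> [[h1 h2] [h3 h4]]; split; lra.
Qed.

(** From an interior point one can still move a little against the normal [(be, ga)], which strictly
    decreases the affine form. Coefficients bounded by 1 keep the displacement of factor [e / 2]
    inside the ball of radius [e]. *)
Lemma interior_halfplane (al be ga : R) : (be != 0) || (ga != 0) ->
  `|be| <= 1 -> `|ga| <= 1 ->
  interior [set p : R * R | 0 <= al + be * p.1 + ga * p.2] `<=` halfplane al be ga.
Proof.
move=> bg b1 g1 [x y]; rewrite /interior => /nbhs_ballP[e /= e0 he].
have e2 : 0 < e / 2 by rewrite divr_gt0.
have small (c : R) : `|c| <= 1 -> `|e / 2 * c| < e.
  move=> c1; rewrite normrM gtr0_norm//; apply: (@le_lt_trans _ _ (e / 2)).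
    by rewrite ler_piMr// ltW.
  by rewrite ltr_pdivrMr// ltr_pMr// ltr1n.
have /he /= : ball (x, y) e (x - e / 2 * be, y - e / 2 * ga).
  by split; rewrite /ball/= opprB addrC subrK; exact: small.
rewrite /halfplane /=.
have bg2 : 0 < be ^+ 2 + ga ^+ 2.
  case/orP: bg => h; first by rewrite ltr_pwDl ?sqr_ge0// exprn_even_gt0.
  by rewrite ltr_wpDl ?sqr_ge0// exprn_even_gt0.
have : 0 < e / 2 * (be ^+ 2 + ga ^+ 2) by rewrite mulr_gt0.
have -> : al + be * (x - e / 2 * be) + ga * (y - e / 2 * ga) =
  al + be * x + ga * y - e / 2 * (be ^+ 2 + ga ^+ 2) by ring.
lra.
Qed.

Lemma convE (x y : convex_lmodType (R * R)%type) (k : {i01 R}) :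
  conv k x y = (k%:num * x.1 + (1 - k%:num) * y.1, k%:num * x.2 + (1 - k%:num) * y.2).
Proof. by []. Qed.

Lemma convex_closed_halfplane (al be ga : R) :
  @convex_set R (R * R)%type [set p : R * R | 0 <= al + be * p.1 + ga * p.2].
Proof.
move=> x y k; rewrite !inE /= => hx hy.
have k0 : 0 <= k%:num by []. have k1 : k%:num <= 1 by [].
move: (k%:num) k0 k1 => l l0 l1.
have h1 := mulr_ge0 l0 hx.
have l1' : 0 <= 1 - l by rewrite subr_ge0.
have h2 := mulr_ge0 l1' hy.
move: h1 h2; rewrite /= /GRing.scale/=.
set X := l * (_ + _); set Y := (1 - l) * _ => h1 h2.
have -> : al + be * (l * x.1 + (1 - l) * y.1) + ga * (l * x.2 + (1 - l) * y.2) = X + Y.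
  by rewrite /X /Y; ring.
exact: addr_ge0.
Qed.

Lemma convex_cone2 (A : set (R * R)) (u v : R * R) (m n : R) :
  @convex_set R (R * R)%type A -> A (0, 0) -> A u -> A v ->
  0 <= m -> 0 <= n -> m + n <= 1 -> A (m * u.1 + n * v.1, m * u.2 + n * v.2).
Proof.
move=> cA A0 Au Av m0 n0 mn1.
have conv_in (x y : R * R) (l : R) : 0 <= l -> l <= 1 -> A x -> A y ->
    A (l * x.1 + (1 - l) * y.1, l * x.2 + (1 - l) * y.2).
  move=> l0 l1 Ax Ay.
  have := cA x y (Itv01 l0 l1); rewrite !inE => /(_ Ax Ay).
  by rewrite convE.
have [mn0|mn0] := eqVneq (m + n) 0.
  have -> : m = 0 by lra.
  have -> : n = 0 by lra.
  by rewrite !mul0r !addr0.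
have mnp : 0 < m + n by rewrite lt_neqAle eq_sym mn0 addr_ge0.
have q0 : 0 <= m / (m + n) by rewrite divr_ge0// ltW.
have q1 : m / (m + n) <= 1 by rewrite ler_pdivrMr// mul1r lerDl.
have Aw := conv_in _ _ _ q0 q1 Au Av.
have := conv_in _ _ _ (ltW mnp) mn1 Aw A0; rewrite /= !mulr0 !addr0.
by congr A; congr (_, _); field.
Qed.

Lemma Qhat_polygon s t : 0 < s -> s <= t -> t < 1 -> Qhat s t = polygon s t.
Proof.
move=> s0 st t1; apply/seteqP; split.
  have sub (al be ga : R) : (be != 0) || (ga != 0) -> `|be| <= 1 -> `|ga| <= 1 ->
      [set A1 R; A2 R; A3 s; A5 t] `<=` [set p | 0 <= al + be * p.1 + ga * p.2] ->
      Qhat s t `<=` halfplane al be ga.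
    move=> h1 h2 h3 h4.
    apply: subset_trans (interior_halfplane h1 h2 h3).
    apply: interiorS; apply: smallest_sub => //.
    exact: convex_closed_halfplane.
  rewrite polygonE !subsetI; do !split; apply: sub.
  - by rewrite oner_eq0.
  - by rewrite normr1.
  - by rewrite normr0.
  - by move=> p [[[|]|]|] -> /=; lra.
  - by rewrite oner_eq0 orbT.
  - by rewrite normr0.
  - by rewrite normr1.
  - by move=> p [[[|]|]|] -> /=; lra.
  - by rewrite oppr_eq0 oner_eq0.
  - by rewrite normrN normr1.
  - by rewrite normrN normr1.
  - by move=> p [[[|]|]|] -> /=; lra.
  - by apply/orP; right; rewrite oppr_eq0 gt_eqF//; lra.
  - by rewrite normrN ger0_norm; lra.
  - by rewrite normrN ger0_norm; lra.
  - move=> p [[[|]|]|] -> /=.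
    + have : 0 <= t * (1 - s) by rewrite mulr_ge0; lra.
      lra.
    + have : 0 <= s * (1 - t) by rewrite mulr_ge0; lra.
      lra.
    + have -> : t * (1 - s) + - (t - s) * (1 - s) + - (1 - s) * s = 0 by ring.
      exact: lexx.
    + have -> : t * (1 - s) + - (t - s) * 0 + - (1 - s) * t = 0 by ring.
      exact: lexx.
have oP : open (polygon s t).
  by rewrite polygonE; do ![apply: openI]; exact: open_halfplane.
(* An open subset of the hull lies in its interior, and the hull is the intersection of all convex
   sets [A] containing the vertices. *)
rewrite /Qhat -open_subsetE// => -[x y] [/= x0 y0 xy1 xyt] A [cA vA].
have in1 : A (0, 0) by apply: vA; left; left; left.
have in2 : A (1, 0) by apply: vA; left; left; right.
have in3 : A (1 - s, s) by apply: vA; left; right.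
have in5 : A (0, t) by apply: vA; right.
have s1 : 0 < 1 - s by lra.
have tp : 0 < t by lra.
(* The diagonal A1 A3 cuts the quadrilateral into two triangles with a vertex at the origin; the
   weights given to [convex_cone2] are barycentric coordinates in the triangle that contains the
   point. *)
have [h|h] := leP (y * (1 - s)) (s * x).
  have m0 : 0 <= y / s by rewrite divr_ge0// ltW.
  have n0 : 0 <= x - y * (1 - s) / s by rewrite subr_ge0 ler_pdivrMr// mulrC [x * s]mulrC mulrC.
  have mn : y / s + (x - y * (1 - s) / s) <= 1.
    by rewrite [leLHS](_ : _ = x + y); [exact: ltW|field; rewrite gt_eqF].
  have := convex_cone2 cA in1 in3 in2 m0 n0 mn.
  by congr A; rewrite /=; congr (_, _); field; rewrite gt_eqF.
have m0 : 0 <= x / (1 - s) by rewrite divr_ge0// ltW.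
have n0 : 0 <= (y - s * x / (1 - s)) / t.
  by rewrite divr_ge0 ?(ltW tp)// subr_ge0 ler_pdivrMr// ltW.
have mn : x / (1 - s) + (y - s * x / (1 - s)) / t <= 1.
  rewrite (_ : _ + _ = (t * x + (1 - s) * y - s * x) / (t * (1 - s))).
    by rewrite ler_pdivrMr ?mulr_gt0// mul1r; lra.
  by field; rewrite !gt_eqF.
have := convex_cone2 cA in1 in3 in5 m0 n0 mn.
by congr A; rewrite /=; congr (_, _); field; rewrite !gt_eqF.
Qed.

Lemma polygon_sub s t p : 0 < s -> s <= t -> t < 1 ->
  polygon s t p -> 0 < p.1 < 1 /\ 0 < p.2 < t.
Proof.
move=> s0 st t1.
case: p => x y [/= x0 y0 xy h]; rewrite x0 y0 /=; split; first by lra.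
have : 0 <= (t - s) * x by rewrite mulr_ge0//; lra.
move=> h2; have : (1 - s) * y < (1 - s) * t by lra.
by rewrite ltr_pM2l//; lra.
Qed.

Lemma lower_open_polygon s t : 0 < s -> s <= t -> t < 1 ->
  lower_open (polygon s t).
Proof.
move=> s0 st t1.
split.
- by rewrite polygonE; do ![apply: openI]; exact: open_halfplane.
- by rewrite polygonE; do ![apply: measurableI]; exact: measurable_halfplane.
- by move=> p [].
move=> x y x' y' [/= x0 y0 xy h] /andP[x'0 x'x] /andP[y'0 y'y]; split => //=; first by lra.
have h1 : (1 - s) * y' <= (1 - s) * y by rewrite ler_pM2l//; lra.
have h2 : (t - s) * x' <= (t - s) * x by rewrite ler_wpM2l//; lra.
by lra.
Qed.

(** The triangle A1 A2 A5: a cone of opening [t] at A2 and, with the coordinates exchanged, of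
    opening [1 / t] at A5. *)
Lemma triangle_polygon s t x y : 0 < s -> s <= t -> t < 1 ->
  0 < x < 1 -> 0 < y < t * (1 - x) -> polygon s t (x, y).
Proof.
move=> s0 st t1.
move=> /andP[x0 x1] /andP[y0 yt].
have tx : t * (1 - x) < 1 - x by rewrite gtr_pMl//; lra.
split => //=; first by lra.
have h1 : (1 - s) * y < (1 - s) * (t * (1 - x)) by rewrite ltr_pM2l//; lra.
have h2 : 0 <= x * (s * (1 - t)) by rewrite !mulr_ge0//; lra.
by lra.
Qed.

(** The right triangle below the edge A2 A3: a cone at A2 of opening 1, however thin the
    quadrilateral is. *)
Lemma corner_polygon s t x y : 0 < s -> s <= t -> t < 1 ->
  1 - s < x < 1 -> 0 < y < 1 - x -> polygon s t (x, y).
Proof.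
move=> s0 st t1.
move=> /andP[x0 x1] /andP[y0 yt]; split => //=; [lra|lra|].
have h1 : (1 - s) * y < (1 - s) * (1 - x) by rewrite ltr_pM2l//; lra.
have h2 : (1 - t) * (1 - s) <= (1 - t) * x by rewrite ler_wpM2l//; lra.
by lra.
Qed.

Lemma rectangle_polygon s t x y : 0 < s -> s <= t -> t < 1 ->
  0 < x < 1 - s -> 0 < y < s -> polygon s t (x, y).
Proof.
move=> s0 st t1.
move=> /andP[x0 xs] /andP[y0 ys]; split => //=; first by lra.
have h1 : (1 - s) * y < (1 - s) * s by rewrite ltr_pM2l//; lra.
have h2 : (t - s) * x <= (t - s) * (1 - s) by rewrite ler_wpM2l//; lra.
by lra.
Qed.

Lemma half_box_polygon s t x y : 0 < s -> s <= t -> t < 1 ->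
  0 < x < 1 / 2 -> 0 < y < t / 2 -> polygon s t (x, y).
Proof.
move=> s0 st t1.
move=> /andP[x0 x2] /andP[y0 y2]; apply: triangle_polygon => //; apply/andP; split => //; first lra.
have h : t * x < t * (1 / 2) by rewrite ltr_pM2l//; lra.
by lra.
Qed.

End geometry.

(** * Weak derivatives tested on products *)

Section weak.
Variable R : realType.
Local Notation mu := (@lebesgue_measure R).
Local Notation mu2 := (mu \x mu)%E.

Definition tensor_weak (Q : set (R * R)) (i j : nat) (f g : R * R -> R) : Prop :=
  forall (a b : R -> R) (c d e k : R), smooth1 a -> smooth1 b ->
    (forall x, ~~ (c <= x <= d) -> a x = 0) ->
    (forall y, ~~ (e <= y <= k) -> b y = 0) ->
    `[c, d] `*` `[e, k] `<=` Q ->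
    \int[mu2]_(p in Q) (f p * tensor (iter i (@derive1 R R) a) (iter j (@derive1 R R) b) p) =
    (-1) ^+ (i + j) * \int[mu2]_(p in Q) (g p * tensor a b p).

Lemma smooth1_iter (a : R -> R) n : smooth1 a -> smooth1 (iter n (@derive1 R R) a).
Proof. by move=> sa; elim: n => //= n; exact: smooth1_derive. Qed.

Lemma iter_supp (c d : R) (a : R -> R) n : smooth1 a ->
  (forall x, ~~ (c <= x <= d) -> a x = 0) ->
  (forall x, ~~ (c <= x <= d) -> iter n (@derive1 R R) a x = 0).
Proof.
move=> sa a0; elim: n => //= n IH; apply: derive1_supp => //.
exact: smooth1_iter.
Qed.

Lemma partial_tensor i j (a b : R -> R) : smooth1 a -> smooth1 b ->
  partial i j (tensor a b) = tensor (iter i (@derive1 R R) a) (iter j (@derive1 R R) b).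
Proof.
move=> sa sb; rewrite /partial.
have -> : iter j (fun g => 'D_((0, 1) : R * R) g) (tensor a b) =
    tensor a (iter j (@derive1 R R) b).
  by elim: j => //= j ->; rewrite partial01_tensor//; exact: smooth1_iter.
have sb' := smooth1_iter j sb.
elim: i => //= i ->; rewrite partial10_tensor//; exact: smooth1_iter.
Qed.

Lemma weak_partial_tensor (Q : set (R * R)) i j (f g : R * R -> R) :
  weak_partial Q i j f g -> tensor_weak Q i j f g.
Proof.
move=> [_ fg] a b c d e k sa sb a0 b0 Qbox.
by have := fg _ (test_function_tensor sa sb a0 b0 Qbox); rewrite partial_tensor.
Qed.

Section integrable.
Variable Q : set (R * R).
Hypothesis mQ : measurable Q.

Lemma integrable_tensorM (f : R * R -> R) (a b : R -> R) (c d e k : R) :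
  mu2.-integrable Q (EFin \o f) -> smooth1 a -> smooth1 b ->
  (forall x, ~~ (c <= x <= d) -> a x = 0) ->
  (forall y, ~~ (e <= y <= k) -> b y = 0) ->
  mu2.-integrable Q (EFin \o (fun p => f p * tensor a b p)).
Proof.
move=> if_ sa sb a0 b0.
have [mt [C tC]] := tensor_bounded sa sb a0 b0.
have if0 : mu2.-integrable setT (EFin \o (f \_ Q)).
  by rewrite -restrict_EFin; apply/(integrable_mkcond _ _).1.
have := integrableM_bounded if0 mt tC.
have -> : EFin \o (f \_ Q \* tensor a b) =
    (EFin \o (fun p => f p * tensor a b p)) \_ Q.
  by apply/funext => p /=; rewrite !patchE; case: ifP => //=; rewrite mul0r.
by move=> h; apply/(integrable_mkcond _ _).2.
Qed.

Lemma tensor_weakB i j (f g f' g' : R * R -> R) :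
  mu2.-integrable Q (EFin \o f) -> mu2.-integrable Q (EFin \o g) ->
  mu2.-integrable Q (EFin \o f') -> mu2.-integrable Q (EFin \o g') ->
  tensor_weak Q i j f g -> tensor_weak Q i j f' g' ->
  tensor_weak Q i j (f \- f') (g \- g').
Proof.
move=> if_ ig if' ig' fg fg' a b c d e k sa sb a0 b0 Qbox.
have ai := iter_supp i sa a0; have bj := iter_supp j sb b0.
have sai := smooth1_iter i sa; have sbj := smooth1_iter j sb.
have E1 := fg _ _ _ _ _ _ sa sb a0 b0 Qbox.
have E2 := fg' _ _ _ _ _ _ sa sb a0 b0 Qbox.
have H1 := RintegralB (mQ : @measurable _ (measurableTypeR R * measurableTypeR R)%type Q) (integrable_tensorM if_ sai sbj ai bj) (integrable_tensorM if' sai sbj ai bj).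
have H2 := RintegralB (mQ : @measurable _ (measurableTypeR R * measurableTypeR R)%type Q) (integrable_tensorM ig sa sb a0 b0) (integrable_tensorM ig' sa sb a0 b0).
transitivity (\int[mu2]_(p in Q) (f p * tensor (iter i (@derive1 R R) a) (iter j (@derive1 R R) b) p) -
   \int[mu2]_(p in Q) (f' p * tensor (iter i (@derive1 R R) a) (iter j (@derive1 R R) b) p)).
  by rewrite -H1; apply: eq_Rintegral => p _; rewrite /= mulrBl.
rewrite E1 E2 -mulrBr -H2; congr (_ * _).
by apply: eq_Rintegral => p _; rewrite /= mulrBl.
Qed.

Lemma tensor_weak_id (f : R * R -> R) : tensor_weak Q 0 0 f f.
Proof. by move=> a b c d e k _ _ _ _ _; rewrite expr0 mul1r. Qed.

(** Testing the first identity with [derive1 a] and the second with [a] gives the same left-hand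
    side, which eliminates [f]. The second derivatives of [v] thereby become derivatives of its
    first derivatives. *)
Lemma tensor_weak_derivative_x i j (f g h : R * R -> R) :
  tensor_weak Q i j f g -> tensor_weak Q i.+1 j f h -> tensor_derivative Q g h.
Proof.
move=> fg fh a b c d e k sa sb a0 b0 Qbox.
have E1 := fg _ _ _ _ _ _ (smooth1_derive sa) sb (derive1_supp sa a0) b0 Qbox.
have := fh _ _ _ _ _ _ sa sb a0 b0 Qbox; rewrite iterSr E1.
by rewrite addSn exprS mulN1r mulNr -mulrN => /mulrI; apply; exact: unitrX (unitrN1 _).
Qed.

(** Domain and functions are swapped because the line theory is developed in the first variable
    only. *)
Lemma tensor_weak_derivative_y i j (f g h : R * R -> R) :
  mu2.-integrable Q (EFin \o g) -> mu2.-integrable Q (EFin \o h) ->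
  tensor_weak Q i j f g -> tensor_weak Q i j.+1 f h ->
  tensor_derivative (@swap R R @^-1` Q) (g \o @swap R R) (h \o @swap R R).
Proof.
move=> ig ih fg fh a b c d e k sa sb a0 b0 Qbox.
have Qbox' : `[e, k] `*` `[c, d] `<=` Q.
  by move=> [x y] [/= xi yi]; exact: (Qbox (y, x)).
have E1 := fg _ _ _ _ _ _ sb (smooth1_derive sa) b0 (derive1_supp sa a0) Qbox'.
have := fh _ _ _ _ _ _ sb sa b0 a0 Qbox'; rewrite iterSr E1.
rewrite addnS exprS mulN1r mulNr -mulrN => /mulrI.
move=> /(_ (unitrX _ (unitrN1 _))) E.
have mg := integrable_tensorM ig sb (smooth1_derive sa) b0 (derive1_supp sa a0).
have mh := integrable_tensorM ih sb sa b0 a0.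
have Eg := Rintegral_swap mQ (proj1 (measurable_EFinP _ _) (measurable_int _ mg)).
have Eh := Rintegral_swap mQ (proj1 (measurable_EFinP _ _) (measurable_int _ mh)).
transitivity (\int[mu2]_(p in Q) (g p * tensor b (derive1 a) p)).
  rewrite -Eg; apply: eq_Rintegral => -[x y] _ /=; congr (_ * _).
  by rewrite /tensor /= mulrC.
rewrite E; congr (- _).
rewrite -Eh; apply: eq_Rintegral => -[x y] _ /=; congr (_ * _).
by rewrite /tensor /= mulrC.
Qed.

End integrable.

End weak.

(** * Weak derivatives of affine functions *)

Section affine.
Variable R : realType.
Local Notation mu := (@lebesgue_measure R).
Local Notation mu2 := (mu \x mu)%E.

Section compact_support.
Variables (c d : R) (a : R -> R).
Hypothesis sa : smooth1 a.
Hypothesis a0 : forall x, ~~ (c <= x <= d) -> a x = 0.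

Lemma integrable_smooth1 : mu.-integrable setT (EFin \o a).
Proof.
have -> : EFin \o a = (EFin \o a) \_ `[c, d].
  apply/funext => x /=; rewrite patchE; case: ifPn => //=.
  by rewrite notin_setE /= in_itv /= => /negP /a0 ->.
apply: (integrable_mkcond _ _).1 => //.
exact: continuous_integrable_itv (smooth1_continuous sa).
Qed.

Lemma Rintegral_derive1 : \int[mu]_x derive1 a x = 0.
Proof.
set X := Num.max c d + 1; set Y := c - 1.
have YX : Y < X.
  have : c <= Num.max c d by rewrite le_max lexx.
  by rewrite /X /Y; lra.
have dX : d < X.
  have : d <= Num.max c d by rewrite le_max lexx orbT.
  by rewrite /X; lra.
have a0' := derive1_supp sa a0.
rewrite /Rintegral.
have -> : (\int[mu]_x (derive1 a x)%:E = \int[mu]_(x in `]Y, X[) (derive1 a x)%:E)%E.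
  rewrite [RHS]integral_mkcond; apply: eq_integral => x _; rewrite patchE.
  case: ifPn => //; rewrite notin_setE /= in_itv /= => /negP h.
  rewrite a0' //; apply: contra h => /andP[cx xd]; apply/andP; split; rewrite /Y; lra.
rewrite smooth1_FTC2 // !a0 ?sube0 ?subr0 //=.
  by rewrite /Y; apply/negP => /andP[+ _]; lra.
by apply/negP => /andP[_ +]; lra.
Qed.

End compact_support.

Lemma smooth1M (a b : R -> R) : smooth1 a -> smooth1 b -> smooth1 (a \* b).
Proof. by move=> sa sb k; exact: Ck1M. Qed.

Lemma smooth1_id : smooth1 (@id R).
Proof.
move=> k; have -> : @id R = fun x => x * 1 + 0 by apply/funext => x; rewrite mulr1 addr0.
case: k => [|k].
  by split => // x; apply: cvgD; [apply: cvgM; [exact: cvg_id|exact: cvg_cst]|exact: cvg_cst].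
split; first by move=> x; apply: cvgD; [apply: cvgM; [exact: cvg_id|exact: cvg_cst]|exact: cvg_cst].
have -> : (fun x : R => x * 1 + 0) = id by apply/funext => x; rewrite mulr1 addr0.
split; first by move=> x; exact: derivable_id.
suff -> : derive1 (@id R) = cst 1 by exact: Ck1_cst.
by apply/funext => x; rewrite derive1E derive_id.
Qed.

Lemma Rintegral_id_iter (c d : R) (a : R -> R) (i : nat) : smooth1 a ->
  (forall x, ~~ (c <= x <= d) -> a x = 0) ->
  \int[mu]_x (x * iter i.+1 (@derive1 R R) a x) = - \int[mu]_x iter i (@derive1 R R) a x.
Proof.
move=> sa a0; set ai := iter i _ a.
have sai : smooth1 ai by exact: smooth1_iter.
have ai0 := iter_supp i sa a0; rewrite -/ai in ai0.
have sx : smooth1 (@id R \* ai) by exact: smooth1M smooth1_id sai.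
have x0 x : ~~ (c <= x <= d) -> (@id R \* ai) x = 0.
  by move=> /ai0 /= ->; rewrite mulr0.
have x0' x : ~~ (c <= x <= d) -> x * derive1 ai x = 0.
  by move=> /(derive1_supp sai ai0) ->; rewrite mulr0.
have := Rintegral_derive1 sx x0.
have -> : derive1 (@id R \* ai) = fun x => ai x + x * derive1 ai x.
  apply/funext => x; rewrite derive1E deriveM; last 2 first.
  - exact: derivable_id.
  - exact: smooth1_derivable.
  by rewrite derive_id -derive1E /GRing.scale /= mulr1 addrC.
rewrite (@RintegralD _ (measurableTypeR R) R mu setT ai (fun x => x * derive1 ai x) measurableT).
- by move=> /eqP; rewrite addrC addr_eq0 => /eqP.
- exact: integrable_smooth1 sai ai0.
- exact: integrable_smooth1 (smooth1M smooth1_id (smooth1_derive sai)) x0'.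
Qed.

Definition affine (al be ga : R) (p : R * R) : R := al + be * p.1 + ga * p.2.

Section tensor_weak_affine.
Variables (Q : set (R * R)) (al be ga : R).

(** The test is supported in a box inside [Q], so the integral extends to the plane and splits into
    one-variable moments. Weak derivatives of affine functions then reduce to moments of
    derivatives. *)
Lemma Rintegral_affine_tensor (x0 y0 z0 : R) (a b : R -> R) (c d e k : R) :
  smooth1 a -> smooth1 b ->
  (forall x, ~~ (c <= x <= d) -> a x = 0) ->
  (forall y, ~~ (e <= y <= k) -> b y = 0) ->
  `[c, d] `*` `[e, k] `<=` Q ->
  \int[mu2]_(p in Q) (affine x0 y0 z0 p * tensor a b p) =
  x0 * (\int[mu]_x a x * \int[mu]_y b y) +
  y0 * (\int[mu]_x (x * a x) * \int[mu]_y b y) +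
  z0 * (\int[mu]_x a x * \int[mu]_y (y * b y)).
Proof.
move=> sa sb a0 b0 Qbox.
have ia := integrable_smooth1 sa a0; have ib := integrable_smooth1 sb b0.
have supp (h : R -> R) (u v : R) : (forall x, ~~ (u <= x <= v) -> h x = 0) ->
    forall x, ~~ (u <= x <= v) -> (@id R \* h) x = 0.
  by move=> h0 x /h0 /= ->; rewrite mulr0.
have ixa : mu.-integrable setT (EFin \o (fun x => x * a x)).
  exact: integrable_smooth1 (smooth1M smooth1_id sa) (supp _ _ _ a0).
have iyb : mu.-integrable setT (EFin \o (fun x => x * b x)).
  exact: integrable_smooth1 (smooth1M smooth1_id sb) (supp _ _ _ b0).
have i1 := integrable_tensor ia ib; have i2 := integrable_tensor ixa ib.
have i3 := integrable_tensor ia iyb.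
have j1 := integrableZr measurableT x0 i1; have j2 := integrableZr measurableT y0 i2.
have j3 := integrableZr measurableT z0 i3.
rewrite -(Rintegral_tensor ia ib) -(Rintegral_tensor ixa ib) -(Rintegral_tensor ia iyb).
rewrite -!(mulrC (\int[mu2]_p _)).
rewrite -(RintegralZr x0 measurableT i1) -(RintegralZr y0 measurableT i2).
rewrite -(RintegralZr z0 measurableT i3).
have j12 := integrableD measurableT j1 j2.
rewrite -(RintegralD measurableT j1 j2) -(RintegralD measurableT j12 j3).
rewrite Rintegral_mkcond; apply: eq_Rintegral => -[x y] _; rewrite patchE.
case: ifPn => [_|]; first by rewrite /affine /tensor /=; ring.
rewrite notin_setE => nQ; transitivity (0 : R) => //.
have [xcd|/a0 ax] := boolP (c <= x <= d); last by rewrite /tensor /= ax; ring.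
have [yek|/b0 by_] := boolP (e <= y <= k); last by rewrite /tensor /= by_; ring.
by case: nQ; apply: Qbox; split; rewrite /= in_itv.
Qed.

Lemma tensor_weak_affine_x : tensor_weak Q 1 0 (affine al be ga) (cst be).
Proof.
move=> a b c d e k sa sb a0 b0 Qbox.
have := Rintegral_affine_tensor be 0 0 sa sb a0 b0 Qbox.
rewrite /affine /=; under eq_Rintegral do rewrite !mul0r !addr0; move=> ->.
have a0' := derive1_supp sa a0; have sa' := smooth1_derive sa.
rewrite (Rintegral_affine_tensor al be ga sa' sb a0' b0 Qbox).
have := Rintegral_id_iter 0 sa a0; rewrite /= => ->.
by rewrite (Rintegral_derive1 sa a0) addn0 expr1; ring.
Qed.

Lemma tensor_weak_affine_y : tensor_weak Q 0 1 (affine al be ga) (cst ga).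
Proof.
move=> a b c d e k sa sb a0 b0 Qbox.
have := Rintegral_affine_tensor ga 0 0 sa sb a0 b0 Qbox.
rewrite /affine /=; under eq_Rintegral do rewrite !mul0r !addr0; move=> ->.
have b0' := derive1_supp sb b0; have sb' := smooth1_derive sb.
rewrite (Rintegral_affine_tensor al be ga sa sb' a0 b0' Qbox).
have := Rintegral_id_iter 0 sb b0; rewrite /= => ->.
by rewrite (Rintegral_derive1 sb b0) add0n expr1; ring.
Qed.

(** In each product of moments some factor is differentiated more often than the degree of its
    weight, hence integrates to 0. *)
Lemma tensor_weak_affine_0 i j : (1 < i + j)%N -> tensor_weak Q i j (affine al be ga) (cst 0).
Proof.
move=> ij a b c d e k sa sb a0 b0 Qbox.
rewrite [X in _ = _ * X](_ : _ = 0); last first.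
  under eq_Rintegral do rewrite mul0r.
  by rewrite /Rintegral integral0.
have I0 (h : R -> R) (u v : R) n : smooth1 h -> (forall x, ~~ (u <= x <= v) -> h x = 0) ->
    \int[mu]_x iter n.+1 (@derive1 R R) h x = 0.
  by move=> sh h0; exact: Rintegral_derive1 (smooth1_iter n sh) (iter_supp n sh h0).
have I1 (h : R -> R) (u v : R) n : smooth1 h -> (forall x, ~~ (u <= x <= v) -> h x = 0) ->
    \int[mu]_x (x * iter n.+2 (@derive1 R R) h x) = 0.
  by move=> sh h0; rewrite (Rintegral_id_iter n.+1 sh h0) (I0 _ _ _ n sh h0) oppr0.
rewrite (Rintegral_affine_tensor al be ga (smooth1_iter i sa) (smooth1_iter j sb)
  (iter_supp i sa a0) (iter_supp j sb b0) Qbox).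
have A0 : (0 < i)%N -> \int[mu]_x iter i (@derive1 R R) a x = 0.
  by case: i {ij} => // n _; exact: (I0 _ _ _ n sa a0).
have A1 : (1 < i)%N -> \int[mu]_x (x * iter i (@derive1 R R) a x) = 0.
  by case: i {ij A0} => [|[|n]] // _; exact: (I1 _ _ _ n sa a0).
have B0 : (0 < j)%N -> \int[mu]_x iter j (@derive1 R R) b x = 0.
  by case: j {ij} => // n _; exact: (I0 _ _ _ n sb b0).
have B1 : (1 < j)%N -> \int[mu]_x (x * iter j (@derive1 R R) b x) = 0.
  by case: j {ij B0} => [|[|n]] // _; exact: (I1 _ _ _ n sb b0).
have [i0|i0] := posnP i.
  have j2 : (1 < j)%N by move: ij; rewrite i0.
  by rewrite (B0 (ltnW j2)) (B1 j2) !mulr0 !addr0.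
have [j0|j0] := posnP j.
  have i2 : (1 < i)%N by move: ij; rewrite j0 addn0.
  by rewrite (A0 i0) (A1 i2) !mul0r !mulr0 !addr0.
by rewrite (A0 i0) (B0 j0) !mulr0 !mul0r !mulr0 !addr0.
Qed.

End tensor_weak_affine.

End affine.

(** * Square integrable functions on a domain *)

Section square_integrable.
Variable R : realType.
Local Notation mu := (@lebesgue_measure R).
Local Notation mu2 := (mu \x mu)%E.
Variable Q : set (R * R).
Hypothesis mQ : measurable Q.

Lemma integral_sqr_L2norm (f : R * R -> R) : L2 Q f ->
  (\int[mu2]_p ((f \_ Q) p ^+ 2)%:E = (L2norm Q f ^+ 2)%:E)%E.
Proof.
move=> [_ foo]; have foo' : ('N[mu2]_2%:E[EFin \o (f \_ Q)] < +oo)%E := foo.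
have n0 : (2 : R) != 0 by [].
have E := powR_Lnorm mu2 (EFin \o (f \_ Q)) n0.
have g0 := Lnorm_ge0 mu2 2%:E (EFin \o (f \_ Q)).
transitivity (\int[mu2]_p (`|((f \_ Q) p)%:E| `^ 2))%E.
  apply: eq_integral => p _; rewrite /= powR_mulrn//.
  by rewrite real_normK// num_real.
rewrite -E /L2norm; have -> : ('N[@lebesgue2 R]_2%:E[EFin \o (f \_ Q)] = 'N[mu2]_2%:E[EFin \o (f \_ Q)])%E by [].
case: ('N[mu2]_2%:E[_])%E foo' g0 => //= r _; rewrite lee_fin => r0.
by rewrite powR_mulrn.
Qed.

Lemma L2norm0 : L2norm Q (fun=> 0) = 0.
Proof.
rewrite /L2norm; have -> : EFin \o ((fun=> 0) \_ Q) = cst (0 : \bar R).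
  by apply/funext => p /=; rewrite patchE; case: ifP.
by rewrite Lnorm0.
Qed.

(** On a set of finite measure the majorant [1 + f ^+ 2] of [|f|] is integrable. *)
Lemma L2_integrable (f : R * R -> R) : (mu2 Q < +oo)%E -> L2 Q f ->
  mu2.-integrable Q (EFin \o f).
Proof.
move=> Qoo L2f; have [mf _] := L2f.
have I2 : mu2.-integrable Q (EFin \o (fun p => (1 + f p ^+ 2)%R)).
  have mf2 : measurable_fun Q (fun p => f p ^+ 2) by exact: measurable_funX.
  have i1 : mu2.-integrable Q (EFin \o cst (1 : R)).
    apply/integrableP; split; first by apply/measurable_EFinP; exact: measurable_cst.
    rewrite (eq_integral (cst 1%E)) => [|p _]; last by rewrite /= normr1.
    by rewrite integral_cst// mul1e.
  have i2 : mu2.-integrable Q (EFin \o (fun p => f p ^+ 2)).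
    apply/integrableP; split; first by apply/measurable_EFinP.
    rewrite integral_mkcond.
    have -> : (fun p => `|(f p ^+ 2)%:E|%E) \_ Q =
        fun p => ((f \_ Q) p ^+ 2)%:E.
      apply/funext => p; rewrite !patchE; case: ifP => _.
        by rewrite /= ger0_norm// sqr_ge0.
      by rewrite expr0n.
    by rewrite integral_sqr_L2norm// ltry.
  have -> : EFin \o (fun p => (1 + f p ^+ 2)%R) =
      (fun p => (EFin \o cst (1%R : R)) p + (EFin \o (fun p => (f p ^+ 2)%R)) p)%E by [].
  by apply: integrableD.
apply: (@le_integrable _ (measurableTypeR R * measurableTypeR R)%type R mu2 Q mQ _ (EFin \o (fun p => (1 + f p ^+ 2)%R))) => //.
  by apply/measurable_EFinP.
move=> p _ /=; rewrite lee_fin [leRHS]ger0_norm ?addr_ge0 ?sqr_ge0//.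
have : 0 <= (`|f p| - 1) ^+ 2 by exact: sqr_ge0.
have : 0 <= `|f p| ^+ 2 by exact: sqr_ge0.
by rewrite sqrrB real_normK ?num_real//; nra.
Qed.

End square_integrable.

(** * Estimates from weak derivatives, and passage to the corners *)

Section core.
Variable R : realType.
Local Notation mu := (@lebesgue_measure R).
Local Notation mu2 := (mu \x mu)%E.

(** Passes from a Sobolev function to its continuous representative, the one with meaningful vertex
    values, at the price of a larger exceptional set. *)
Lemma ftc_off_eq (Q N M : set (R * R)) (f f' g : R * R -> R) :
  (forall p, Q p -> ~ M p -> f p = f' p) ->
  ftc_off Q N f g -> ftc_off Q (N `|` M) f' g.
Proof.
move=> ff' fg y x1 x2 c Q1 Q2 x12 /not_orP[N1 M1] /not_orP[N2 M2].
by rewrite -!ff'//; exact: fg.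
Qed.

Lemma collip_mono (Q N M : set (R * R)) b (K : R * R -> R) p :
  collip Q N b K p -> collip Q (N `|` M) b K p.
Proof. by move=> h x y1 y2 Q1 Q2 /not_orP[N1 _] /not_orP[N2 _]; exact: h. Qed.

Lemma rowlip_mono (Q N M : set (R * R)) a (K : R * R -> R) p :
  rowlip Q N a K p -> rowlip Q (N `|` M) a K p.
Proof. by move=> h x1 x2 y Q1 Q2 /not_orP[N1 _] /not_orP[N2 _]; exact: h. Qed.

Lemma collip_swap (Q N : set (R * R)) b (K : R * R -> R) p :
  rowlip (@swap R R @^-1` Q) N b (K \o @swap R R) p -> collip Q (@swap R R @^-1` N) b K p.
Proof. by move=> h x y1 y2 Q1 Q2 N1 N2; exact: (h y1 y2 x). Qed.

Lemma lower_open_swap (Q : set (R * R)) : lower_open Q -> lower_open (@swap R R @^-1` Q).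
Proof.
move=> [oQ mQ Q0 Qd]; split.
- by apply: open_comp => // p _; exact: swap_continuous.
- exact: measurable_preswap.
- by move=> [x y] /Q0 /= [].
- by move=> x y x' y' Qxy hx hy; apply: (Qd _ _ _ _ Qxy).
Qed.

Lemma integrable_swap (Q : set (R * R)) (f : R * R -> R) : measurable Q ->
  mu2.-integrable Q (EFin \o f) ->
  mu2.-integrable (@swap R R @^-1` Q) (EFin \o (f \o @swap R R)).
Proof.
move=> mQ if_.
have /integrableP[mf0 foo] : mu2.-integrable setT (EFin \o (f \_ Q)).
  by rewrite -restrict_EFin; apply/(integrable_mkcond _ _).1.
have E : EFin \o ((f \_ Q) \o @swap R R) = (EFin \o (f \o @swap R R)) \_ (@swap R R @^-1` Q).
  apply/funext => p; rewrite /= !patchE.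
  have -> : (p \in @swap R R @^-1` Q) = (swap p \in Q) by [].
  by case: ifP.
have mQ' := measurable_preswap mQ.
apply: (integrable_mkcond _ _).2 => //.
have mf1 : measurable_fun setT (f \_ Q) by apply/measurable_EFinP; exact: mf0.
rewrite -E; apply/integrableP; split.
  apply/measurable_EFinP; apply: measurableT_comp; first exact: mf1.
  exact: measurable_swap.
have m0 : measurable_fun setT (fun p => `|((f \_ Q) p)%:E|%E).
  by apply: measurableT_comp => //; exact: mf0.
have E0 := ge0_integral_swap m0 (fun p => abse_ge0 _).
by apply: le_lt_trans foo; rewrite le_eqVlt; apply/orP; left; apply/eqP; exact: E0.
Qed.

Section estimates.
Variables (Q : set (R * R)) (a b n : R) (K K1 K2 : R * R -> R).
Hypotheses (loQ : lower_open Q) (a0 : 0 < a) (b0 : 0 < b).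
Hypothesis Qab : forall p, Q p -> 0 < p.1 < a /\ 0 < p.2 < b.
Hypothesis half : forall x y, 0 < x < a / 2 -> 0 < y < b / 2 -> Q (x, y).
Hypothesis mK : measurable_fun setT K.
Hypotheses (mK1 : measurable_fun setT K1) (mK2 : measurable_fun setT K2).
Hypothesis iK : mu2.-integrable Q (EFin \o K).
Hypothesis iK1 : mu2.-integrable Q (EFin \o K1).
Hypothesis iK2 : mu2.-integrable Q (EFin \o K2).
Hypothesis K1n : (\int[mu2]_p (K1 p ^+ 2)%:E < n%:E)%E.
Hypothesis K2n : (\int[mu2]_p (K2 p ^+ 2)%:E < n%:E)%E.
Hypothesis dx : tensor_derivative Q K K1.
Hypothesis dy : tensor_derivative (@swap R R @^-1` Q) (K \o @swap R R) (K2 \o @swap R R).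

Let p1 := rowint K1.
Let p2 := rowint (K2 \o @swap R R).
Let c0 := Num.sqrt (a * (n / (b / 2))) + Num.sqrt (b * (n / (a / 2))).

(** Formulated for a box of sides [a] and [b] because it serves twice: for the horizontal derivative
    with sides 1 and [t], and for the vertical one on the swapped domain with sides [t] and 1. *)
Lemma oscillation_weak : exists k0 N, [/\ measurable N, mu2 N = 0,
  collip Q N b K p2 & {ae mu2, forall p, Q p ->
  `|K p - k0| <= Num.sqrt (a * p1 p.2) + Num.sqrt (b * p2 p.1) + c0}].
Proof.
have [_ mQ _ _] := loQ.
have mK2' : measurable_fun setT (K2 \o @swap R R).
  by apply: measurableT_comp; [exact: mK2|exact: measurable_swap].
have K2n' : (\int[mu2]_p (((K2 \o @swap R R) p) ^+ 2)%:E < n%:E)%E.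
  apply: le_lt_trans K2n; rewrite -(ge0_integral_swap (f := fun p => (K2 p ^+ 2)%:E)) //.
    by apply/measurable_EFinP; exact: measurable_funX.
  by move=> p; rewrite lee_fin sqr_ge0.
have [N1 [mN1 N10 ftc1]] := tensor_derivative_ftc loQ iK iK1 dx.
have [N2 [mN2 N20 ftc2]] := tensor_derivative_ftc (lower_open_swap loQ)
  (integrable_swap mQ iK) (integrable_swap mQ iK2) dy.
have [M1 [mM1 M10 row]] := rowlip_ftc a0 (fun p (Qp : Q p) => (Qab Qp).1) mN1 N10 mK1
  (lt_trans K1n (ltry n)) ftc1.
have [M2 [mM2 M20 row2]] := rowlip_ftc b0 (fun p (Qp : (@swap R R @^-1` Q) p) => (Qab Qp).2) mN2 N20 mK2'
  (lt_trans K2n' (ltry n)) ftc2.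
have col := collip_swap row2.
have mM2' := measurable_preswap mM2.
have M20' : mu2 (@swap R R @^-1` M2) = 0%E by rewrite measure_swap.
have mN : measurable (M1 `|` @swap R R @^-1` M2) by exact: measurableU.
have N0 := measureU_null mM1 mM2' M10 M20'.
have col' : collip Q (M1 `|` @swap R R @^-1` M2) b K p2.
  by rewrite setUC; exact: collip_mono col.
have [k0 hk0] := oscillation loQ a0 b0 half mN N0 (measurable_rowint mK1)
  (rowint_ge0 K1) (measurable_rowint mK2') (rowint_ge0 _)
  (le_lt_trans (integral_rowint_le mK1) K1n) (le_lt_trans (integral_rowint_le mK2') K2n')
  (rowlip_mono row) col'.
by exists k0, (M1 `|` @swap R R @^-1` M2).
Qed.

Let mK2' : measurable_fun setT (K2 \o @swap R R).
Proof. by apply: measurableT_comp; [exact: mK2|exact: measurable_swap]. Qed.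

Let c00 : 0 <= c0.
Proof. by rewrite addr_ge0 ?sqrtr_ge0. Qed.

Let p1n : (\int[mu]_y (p1 y)%:E < n%:E)%E.
Proof. exact: le_lt_trans (integral_rowint_le mK1) K1n. Qed.

Let p2n : (\int[mu]_y (p2 y)%:E < n%:E)%E.
Proof.
apply: le_lt_trans (integral_rowint_le mK2') _.
apply: le_lt_trans K2n; rewrite -(ge0_integral_swap (f := fun p => (K2 p ^+ 2)%:E)) //.
  by apply/measurable_EFinP; exact: measurable_funX.
by move=> p; rewrite lee_fin sqr_ge0.
Qed.

Section constant.
Variables (k0 : R) (N : set (R * R)).
Hypotheses (mN : measurable N) (N0 : mu2 N = 0).
Hypothesis col : collip Q N b K p2.
Hypothesis bound : {ae mu2, forall p, Q p ->
  `|K p - k0| <= Num.sqrt (a * p1 p.2) + Num.sqrt (b * p2 p.1) + c0}.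

(** [oscillation_L2] is applied with the comparison constant 0 instead of [k0], and [|k0|] is
    absorbed in the additive constant; this bounds [K] itself. *)
Lemma oscillation_L2_weak : (\int[mu2]_(p in Q) (K p ^+ 2)%:E <=
  (3 * (a ^+ 2 * n + b ^+ 2 * n + a * b * (c0 + `|k0|) ^+ 2))%:E)%E.
Proof.
have c0k : 0 <= c0 + `|k0| by rewrite addr_ge0.
have bound0 : {ae mu2, forall p, Q p ->
    `|K p - 0| <= Num.sqrt (a * p1 p.2) + Num.sqrt (b * p2 p.1) + (c0 + `|k0|)}.
  move: bound; apply: ae_imply => p h Qp.
  have hp := h Qp; rewrite subr0 addrA -[in leLHS](subrK k0 (K p)).
  by apply: le_trans (ler_normD _ _) _; rewrite lerD2r.
have := oscillation_L2 loQ a0 b0 c0k Qab mK (measurable_rowint mK1) (rowint_ge0 K1)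
  (measurable_rowint mK2') (rowint_ge0 _) p1n p2n bound0.
by under eq_integral do rewrite subr0.
Qed.

Lemma line_estimate_weak (M : set (R * R)) (f f' : R * R -> R) (kap L xs m c : R) :
  mu2.-integrable Q (EFin \o f) -> tensor_derivative Q f K ->
  measurable M -> mu2 M = 0 -> (forall p, Q p -> ~ M p -> f p = f' p) ->
  0 < kap -> 0 <= xs ->
  (forall x y, xs < x < L -> 0 < y < kap * (L - x) -> Q (x, y)) ->
  2 * Num.sqrt (b * (a * n)) + 2 * Num.sqrt (a * n / kap) * Num.sqrt (L - xs) <= m ->
  c0 <= c ->
  {ae mu, forall y0, {ae mu, forall x1, {ae mu, forall x2,
  xs < x1 < x2 -> x2 < L -> Q (x2, y0) ->
  `|f' (x2, y0) - f' (x1, y0) - k0 * (x2 - x1)| <= m + c * (x2 - x1)}}}.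
Proof.
move=> if_ df mM M0 ff' kap0 xs0 cone hm hc.
have [N1 [mN1 N10 ftc1]] := tensor_derivative_ftc loQ if_ iK df.
have ftc := ftc_off_eq (N := N1 `|` N) ff' (fun y x1 x2 c Q1 Q2 x12 n1 n2 =>
  ftc1 y x1 x2 c Q1 Q2 x12 (fun h => n1 (or_introl h)) (fun h => n2 (or_introl h))).
have mN' : measurable (N1 `|` N `|` M) by do 2 apply: measurableU => //.
have N'0 : mu2 (N1 `|` N `|` M) = 0%E.
  by apply: measureU_null => //; [exact: measurableU|exact: measureU_null].
have col' : collip Q (N1 `|` N `|` M) b K p2.
  by apply: collip_mono; rewrite setUC; exact: collip_mono.
have := line_estimate loQ a0 b0 c00 Qab mK (measurable_rowint mK1) (rowint_ge0 K1)
  (measurable_rowint mK2') (rowint_ge0 _) p1n p2n bound mN' N'0 ftc col' kap0 xs0 cone.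
apply: ae_imply => y0; apply: ae_imply => x1; apply: ae_imply => x2 h xs12 x2L Q2.
apply: le_trans (h xs12 x2L Q2) _; rewrite addrAC; apply: lerD => //.
by rewrite ler_wpM2r// subr_ge0 ltW//; case/andP: xs12.
Qed.

End constant.

End estimates.

(* Restricting to points of [Q] makes the condition vacuous when [(X, Y)] is not
   in the closure of [Q], so no corner has to be shown to lie there. *)
Definition corner_value (Q : set (R * R)) (f : R * R -> R) (X Y v : R) : Prop :=
  forall e, 0 < e -> exists2 d, 0 < d &
    forall p, Q p -> `|p.1 - X| < d -> `|p.2 - Y| < d -> `|f p - v| < e.

(** Corners are boundary points, about which an estimate on almost every row says nothing directly.
    The last hypothesis supplies open windows, arbitrarily close to the corners, for the height and
    the two end points; a window has positive measure and so contains generic values. *)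
Lemma line_limit (Q : set (R * R)) (f : R * R -> R) (xs L k0 m c X1 X2 Y v1 v2 : R) :
  {ae mu, forall y0, {ae mu, forall x1, {ae mu, forall x2,
  xs < x1 < x2 -> x2 < L -> Q (x2, y0) ->
  `|f (x2, y0) - f (x1, y0) - k0 * (x2 - x1)| <= m + c * (x2 - x1)}}} ->
  corner_value Q f X1 Y v1 -> corner_value Q f X2 Y v2 ->
  (forall d, 0 < d -> exists ya yb ua ub va vb, [/\ ya < yb, ua < ub, va < vb &
    forall y x1 x2, ya < y < yb -> ua < x1 < ub -> va < x2 < vb ->
    [/\ `|y - Y| < d /\ `|x1 - X1| < d, `|x2 - X2| < d, xs < x1 < x2 /\ x2 < L,
       Q (x1, y) & Q (x2, y)]]) ->
  `|v2 - v1 - k0 * (X2 - X1)| <= m + c * (X2 - X1).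
Proof.
move=> est cv1 cv2 approx; apply/ler_addgt0Pr => e e0.
(* The errors are [h] for each of the two values of [f], and [|k0| * h] and [|c| * h] for each of
   the two abscissas; they add up to [e]. *)
set h := e / (2 + 2 * (`|k0| + `|c|)).
have den : 0 < 2 + 2 * (`|k0| + `|c|).
  by rewrite ltr_pwDl// mulr_ge0// addr_ge0.
have h0 : 0 < h by rewrite divr_gt0.
have hE : h * (2 + 2 * (`|k0| + `|c|)) = e by rewrite /h divfK// gt_eqF.
have [d1 d10 D1] := cv1 _ h0; have [d2 d20 D2] := cv2 _ h0.
have d0 : 0 < Num.min h (Num.min d1 d2) by rewrite !lt_min h0 d10 d20.
have [ya [yb [ua [ub [va [vb [yab uab vab P]]]]]]] := approx _ d0.
have [y ybd [x1 x1bd [x2 x2bd E]]] : exists2 y, ya < y < yb & exists2 x1, ua < x1 < ub &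
    exists2 x2, va < x2 < vb & (xs < x1 < x2 -> x2 < L -> Q (x2, y) ->
    `|f (x2, y) - f (x1, y) - k0 * (x2 - x1)| <= m + c * (x2 - x1)).
  have [y yab' Ey] := ae_exists_itv yab est; exists y => //.
  have [x1 u1 Ex] := ae_exists_itv uab Ey; exists x1 => //.
  by have [x2 v2' Ex2] := ae_exists_itv vab Ex; exists x2.
have [[+ +] + [x12 x2L] Q1 Q2] := P _ _ _ ybd x1bd x2bd.
rewrite !lt_min => /and3P[yh yd1 yd2] /and3P[xh1 xd1 _] /and3P[xh2 _ xd2].
have F1 := D1 _ Q1 xd1 yd1; have F2 := D2 _ Q2 xd2 yd2.
have {}E := E x12 x2L Q2.
have K1 : `|k0 * (x1 - X1)| <= `|k0| * h by rewrite normrM ler_wpM2l// ltW.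
have K2 : `|k0 * (x2 - X2)| <= `|k0| * h by rewrite normrM ler_wpM2l// ltW.
have C1 : `|c * (x1 - X1)| <= `|c| * h by rewrite normrM ler_wpM2l// ltW.
have C2 : `|c * (x2 - X2)| <= `|c| * h by rewrite normrM ler_wpM2l// ltW.
move: E F1 F2 K1 K2 C1 C2; rewrite !ler_norml !ltr_norml.
move: hE; clear; move: (f _) (f _) (`|k0|) (`|c|) => f1 f2 ak ac.
by move=> *; lra.
Qed.

End core.

(** * Approaching the corners from inside the quadrilateral *)

Section corners.
Variable R : realType.
Local Notation mu := (@lebesgue_measure R).
Local Notation mu2 := (mu \x mu)%E.

Lemma sqrtr_le (x y : R) : 0 <= y -> x <= y ^+ 2 -> Num.sqrt x <= y.
Proof. by move=> y0 xy; rewrite -(ger0_norm y0) -sqrtr_sqr ler_wsqrtr. Qed.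

Lemma exists_small (d k : R) : 0 < d -> 0 < k ->
  exists e, [/\ 0 < e, 4 * e <= d & 4 * e <= k].
Proof.
move=> d0 k0; exists (Num.min d k / 4); split; first by rewrite divr_gt0// lt_min d0.
  by rewrite mulrC divfK// ge_min lexx.
by rewrite mulrC divfK// ge_min lexx orbT.
Qed.

(** At distance more than [e] from A2 the triangle A1 A2 A5 is higher than [t * e], so rows below
    this height come that close to A2 without leaving the domain. *)
Lemma approach_bottom (s t d : R) : 0 < s -> s <= t -> t < 1 -> 0 < d ->
  exists ya yb ua ub va vb : R,
  [/\ ya < yb, ua < ub, va < vb &
    forall y x1 x2, ya < y < yb -> ua < x1 < ub -> va < x2 < vb ->
    [/\ `|y - 0| < d /\ `|x1 - 0| < d, `|x2 - 1| < d, 0 < x1 < x2 /\ x2 < 1,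
       polygon s t (x1, y) & polygon s t (x2, y)]].
Proof.
move=> s0 st t1 d0; have [e [e0 ed ek]] := exists_small d0 ltr01.
have t0 : 0 < t by exact: lt_le_trans s0 st.
have te0 : 0 < t * e by rewrite mulr_gt0.
have tee : t * e < e by rewrite gtr_pMl.
exists 0, (t * e), 0, e, (1 - 2 * e), (1 - e).
split; [by []|by []|by move: e0; clear; lra|].
move=> y x1 x2 /andP[ya yb] /andP[ua ub] /andP[va vb].
have h (x : R) : e < 1 - x -> y < t * (1 - x).
  by move=> ex; apply: lt_trans yb _; rewrite ltr_pM2l.
have h1 : y < t * (1 - x1) by apply: h; move: ub ek e0; clear; lra.
have h2 : y < t * (1 - x2) by apply: h; move: vb; clear; lra.
rewrite !ltr_norml; split.
- by move: ya yb tee ua ub ed e0; clear; move: (t * e) => te *; split; lra.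
- by move: va vb ed e0; clear; lra.
- by move: ua ub va vb ek e0; clear; lra.
- by apply: triangle_polygon => //; [move: ua ub ek e0; clear; lra|rewrite ya].
- by apply: triangle_polygon => //; [move: va vb ek e0; clear; lra|rewrite ya].
Qed.

Lemma approach_corner (s t d : R) : 0 < s -> s <= t -> t < 1 -> 0 < d ->
  exists ya yb ua ub va vb : R,
  [/\ ya < yb, ua < ub, va < vb &
    forall y x1 x2, ya < y < yb -> ua < x1 < ub -> va < x2 < vb ->
    [/\ `|y - 0| < d /\ `|x1 - (1 - s)| < d, `|x2 - 1| < d,
       1 - s < x1 < x2 /\ x2 < 1, polygon s t (x1, y) & polygon s t (x2, y)]].
Proof.
move=> s0 st t1 d0; have [e [e0 ed es]] := exists_small d0 s0.
exists 0, e, (1 - s), (1 - s + e), (1 - 2 * e), (1 - e).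
split; [by []|by move: e0; clear; lra|by move: e0; clear; lra|].
move=> y x1 x2 /andP[ya yb] /andP[ua ub] /andP[va vb].
rewrite !ltr_norml; split.
- by move: ya yb ua ub ed e0; clear; move=> *; split; lra.
- by move: va vb ed e0; clear; lra.
- by move: ua ub va vb es e0; clear; lra.
- by apply: corner_polygon => //; move: ua ub ya yb es e0; clear; lra.
- by apply: corner_polygon => //; move: va vb ya yb es e0; clear; lra.
Qed.

Lemma approach_left (s t d : R) : 0 < s -> s <= t -> t < 1 -> 0 < d ->
  exists ya yb ua ub va vb : R,
  [/\ ya < yb, ua < ub, va < vb &
    forall y x1 x2, ya < y < yb -> ua < x1 < ub -> va < x2 < vb ->
    [/\ `|y - 0| < d /\ `|x1 - 0| < d, `|x2 - t| < d, 0 < x1 < x2 /\ x2 < t,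
       polygon s t (y, x1) & polygon s t (y, x2)]].
Proof.
move=> s0 st t1 d0; have [e [e0 ed ek]] := exists_small d0 ltr01.
have t0 : 0 < t by exact: lt_le_trans s0 st.
have te0 : 0 < t * e by rewrite mulr_gt0.
have tee : t * e < e by rewrite gtr_pMl.
have tek : 4 * (t * e) <= t by rewrite mulrCA ger_pMr.
exists 0, e, 0, (t * e), (t - 2 * (t * e)), (t - t * e).
split; [by []|by []|by move: te0; clear; lra|].
move=> y x1 x2 /andP[ya yb] /andP[ua ub] /andP[va vb].
have h : t - t * e < t * (1 - y) by rewrite mulrBr mulr1 ltrD2l ltrN2 ltr_pM2l.
rewrite !ltr_norml; split.
- by move: ya yb tee ua ub ed e0; clear; move: (t * e) => te *; split; lra.
- by move: tee te0 va vb ed e0; clear; move: (t * e) => te; lra.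
- by move: tee te0 ua ub va vb tek; clear; move: (t * e) => te; lra.
- apply: triangle_polygon => //; first by move: ya yb ek e0; clear; lra.
  by rewrite ua /=; move: h ub te0 tek; clear; move: (t * e) (t * (1 - y)) => te ty; lra.
- apply: triangle_polygon => //; first by move: ya yb ek e0; clear; lra.
  by move: h va vb te0 tek; clear; move: (t * e) (t * (1 - y)) => te ty; lra.
Qed.

Lemma approach_right (s t d : R) : 0 < s -> s <= t -> t < 1 -> 0 < d ->
  exists ya yb ua ub va vb : R,
  [/\ ya < yb, ua < ub, va < vb &
    forall y x1 x2, ya < y < yb -> ua < x1 < ub -> va < x2 < vb ->
    [/\ `|y - (1 - s)| < d /\ `|x1 - 0| < d, `|x2 - s| < d, 0 < x1 < x2 /\ x2 < t,
       polygon s t (y, x1) & polygon s t (y, x2)]].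
Proof.
move=> s0 st t1 d0; have s1 : 0 < 1 - s by move: st t1; lra.
(* [e] has to be small compared with [d], [s] and [1 - s]; two successive choices arrange this. *)
have [e' [e'0 e'd e's]] := exists_small d0 s0.
have [e [e0 ee es]] := exists_small e'0 s1.
exists (1 - s - e), (1 - s), 0, e, (s - 2 * e), (s - e).
split; [by move: e0; clear; lra|by []|by move: e0; clear; lra|].
move=> y x1 x2 /andP[ya yb] /andP[ua ub] /andP[va vb].
rewrite !ltr_norml; split.
- by move: ya yb ua ub e'd ee e0 e'0; clear; move=> *; split; lra.
- by move: va vb e'd ee e0 e'0; clear; lra.
- by move: ua ub va vb e's ee e0 e'0 st; clear; move=> *; split; lra.
- by apply: rectangle_polygon => //; move: ua ub ya yb es e's ee e0 e'0; clear; lra.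
- by apply: rectangle_polygon => //; move: va vb ya yb es e's ee e0 e'0; clear; lra.
Qed.

End corners.

(** * The uniform gradient bound *)

Section gradient.
Variable R : realType.
Local Notation mu := (@lebesgue_measure R).
Local Notation mu2 := (mu \x mu)%E.

Lemma comp_swapK (f : R * R -> R) : (f \o @swap R R) \o @swap R R = f.
Proof. by apply/funext => -[]. Qed.

Lemma preswapK (Q : set (R * R)) : @swap R R @^-1` (@swap R R @^-1` Q) = Q.
Proof. by apply/funext => -[]. Qed.

Lemma corner_value_swap (Q : set (R * R)) (f : R * R -> R) (X Y v : R) :
  corner_value Q f X Y v -> corner_value (@swap R R @^-1` Q) (f \o @swap R R) Y X v.
Proof.
move=> h e e0; have [d d0 D] := h e e0.
by exists d => // p Qp pY pX; exact: D.
Qed.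

Lemma integral_sqr_swap (f : R * R -> R) : measurable_fun setT f ->
  (\int[mu2]_p (((f \o @swap R R) p) ^+ 2)%:E = \int[mu2]_p (f p ^+ 2)%:E)%E.
Proof.
move=> mf; rewrite -(ge0_integral_swap (f := fun p => (f p ^+ 2)%:E)) //.
  by apply/measurable_EFinP; exact: measurable_funX.
by move=> p; rewrite lee_fin sqr_ge0.
Qed.

(* [z] is the value at the foot [(1 - s, 0)] of the perpendicular from A3: the
   edge A2 A3 is replaced by a horizontal and a vertical segment through it. The
   combination [t + s * (1 - t)] is bounded below by [t], uniformly in [s]. *)
Lemma corner_algebra (s t al z g h rho : R) : 0 < s -> s <= t -> t < 1 -> 0 <= rho ->
  `|- al - al - g * (1 - 0)| <= 8 * rho ->
  `|- al - z - g * (1 - (1 - s))| <= 8 * rho * t ->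
  `|- al - al - h * (t - 0)| <= 8 * rho * t ->
  `|al - z - h * (s - 0)| <= 8 * rho * t ->
  `|h| <= 40 * rho /\ `|g| <= 56 * rho.
Proof.
move=> s0 st t1 rho0.
rewrite !ler_norml => /andP[a1 a2] /andP[b1 b2] /andP[c1 c2] /andP[d1 d2].
have t0 : 0 < t by exact: lt_le_trans s0 st.
have rt : rho * t <= rho by rewrite ler_piMr// ltW.
have u1 : g - t * h <= 16 * rho by lra.
have u2 : - (16 * rho) <= g - t * h by lra.
have su1 : s * (g - t * h) <= t * (16 * rho).
  apply: le_trans (_ : s * (16 * rho) <= _); first by rewrite ler_wpM2l// ltW.
  by rewrite ler_wpM2r//; lra.
have su2 : - (t * (16 * rho)) <= s * (g - t * h).
  apply: le_trans (_ : - (s * (16 * rho)) <= _).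
    by rewrite lerN2 ler_wpM2r//; lra.
  by rewrite -mulrN ler_wpM2l// ltW.
have D0 : t <= t + s * (1 - t) by rewrite lerDl mulr_ge0//; lra.
have h1 : (t + s * (1 - t)) * h <= t * (40 * rho) by lra.
have h2 : - (t * (40 * rho)) <= (t + s * (1 - t)) * h by lra.
have hb : `|h| <= 40 * rho.
  rewrite -(ler_pM2l t0); apply: le_trans (_ : (t + s * (1 - t)) * `|h| <= _).
    by rewrite ler_wpM2r.
  have D : 0 <= t + s * (1 - t) by lra.
  by rewrite -[X in X * _](ger0_norm D) -normrM ler_norml h1 andbT.
have th : `|t * h| <= 40 * rho.
  by rewrite normrM gtr0_norm//; apply: le_trans hb; rewrite ler_piMl// ltW.
have := hb; have := th; rewrite !ler_norml => /andP[e1 e2] /andP[f1 f2].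
by split; apply/andP; split => //; lra.
Qed.

Section bound.
Variables (s t n al z : R) (w wt G H P S T : R * R -> R) (M : set (R * R)).
Local Notation Q := (polygon s t).
Hypotheses (s0 : 0 < s) (st : s <= t) (t1 : t < 1) (n0 : 0 < n).
Hypotheses (mG : measurable_fun setT G) (mH : measurable_fun setT H).
Hypotheses (mP : measurable_fun setT P) (mS : measurable_fun setT S)
  (mT : measurable_fun setT T).
Hypothesis iw : mu2.-integrable Q (EFin \o w).
Hypotheses (iG : mu2.-integrable Q (EFin \o G)) (iH : mu2.-integrable Q (EFin \o H)).
Hypotheses (iP : mu2.-integrable Q (EFin \o P)) (iS : mu2.-integrable Q (EFin \o S))
  (iT : mu2.-integrable Q (EFin \o T)).
Hypotheses (wG : tensor_weak Q 1 0 w G) (wH : tensor_weak Q 0 1 w H).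
Hypotheses (wP : tensor_weak Q 2 0 w P) (wS : tensor_weak Q 1 1 w S)
  (wT : tensor_weak Q 0 2 w T).
Hypotheses (Pn : (\int[mu2]_p (P p ^+ 2)%:E < n%:E)%E)
  (Sn : (\int[mu2]_p (S p ^+ 2)%:E < n%:E)%E)
  (Tn : (\int[mu2]_p (T p ^+ 2)%:E < n%:E)%E).
Hypotheses (mM : measurable M) (M0 : mu2 M = 0) (wwt : forall p, Q p -> ~ M p -> w p = wt p).
Hypotheses (w1 : corner_value Q wt 0 0 al) (w2 : corner_value Q wt 1 0 (- al))
  (w3 : corner_value Q wt (1 - s) s al) (w5 : corner_value Q wt 0 t (- al))
  (wz : corner_value Q wt (1 - s) 0 z).

Lemma gradient_bound :
  (\int[mu2]_(p in Q) (G p ^+ 2)%:E <= (10806 * n)%:E)%E /\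
  (\int[mu2]_(p in Q) (H p ^+ 2)%:E <= (10806 * n)%:E)%E.
Proof.
have t0 : 0 < t by exact: lt_le_trans s0 st.
have loQ := lower_open_polygon s0 st t1; have [_ mQ _ _] := loQ.
have loQ' := lower_open_swap loQ.
(* [n] bounds squares of norms, and [rho] is the size allowed to the constants [g0] and [h0]:
   [rho ^+ 2] times an area of order [t] is again of order [n]. *)
pose rho := Num.sqrt (n / t).
have rho0 : 0 <= rho by exact: sqrtr_ge0.
have rhoE : n = rho ^+ 2 * t.
  by rewrite sqr_sqrtr ?divr_ge0 ?ltW// divfK// gt_eqF.
have r20 : 0 <= rho ^+ 2 by exact: sqr_ge0.
have tt : t ^+ 2 <= t by rewrite expr2 ger_pMr// ltW.
have c1 : Num.sqrt (1 * (n / (t / 2))) <= 2 * rho.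
  apply: sqrtr_le; first by rewrite mulr_ge0.
  rewrite [leLHS](_ : _ = 2 * rho ^+ 2); last by rewrite {1}rhoE; field; rewrite gt_eqF.
  by rewrite exprMn; lra.
have c2 : Num.sqrt (t * (n / (1 / 2))) <= 2 * rho.
  apply: sqrtr_le; first by rewrite mulr_ge0.
  rewrite [leLHS](_ : _ = 2 * (rho ^+ 2 * t ^+ 2)); last by rewrite {1}rhoE; field.
  have : rho ^+ 2 * t ^+ 2 <= rho ^+ 2 * 1.
    by rewrite ler_wpM2l// (le_trans tt)// ltW.
  by rewrite exprMn; lra.
have Qab p : Q p -> 0 < p.1 < 1 /\ 0 < p.2 < t by exact: polygon_sub.
have Qab' p : (@swap R R @^-1` Q) p -> 0 < p.1 < t /\ 0 < p.2 < 1.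
  by move=> /Qab [].
have half (x y : R) : 0 < x < 1 / 2 -> 0 < y < t / 2 -> Q (x, y) by exact: half_box_polygon.
have half' (x y : R) : 0 < x < t / 2 -> 0 < y < 1 / 2 -> (@swap R R @^-1` Q) (x, y).
  by move=> hx hy; exact: half_box_polygon.
have msw (f : R * R -> R) : measurable_fun setT f -> measurable_fun setT (f \o @swap R R).
  by move=> mf; apply: measurableT_comp; [exact: mf|exact: measurable_swap].
have wid : tensor_weak Q 0 0 w w by exact: tensor_weak_id.
have dGx := tensor_weak_derivative_x wG wP.
have dGy := tensor_weak_derivative_y mQ iG iS wG wS.
have dHy := tensor_weak_derivative_y mQ iH iT wH wT.
have dHx := tensor_weak_derivative_x wH wS.
(* [H] is estimated on the swapped domain, where its [x]-derivative is the one in the second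
   variable. [oscillation_weak] expects that one in swapped form, here a double swap. *)
rewrite -[X in tensor_derivative X _ _]preswapK -[H]comp_swapK -[S]comp_swapK in dHx.
have isw (f : R * R -> R) : mu2.-integrable Q (EFin \o f) ->
    mu2.-integrable (@swap R R @^-1` Q) (EFin \o (f \o @swap R R)) by exact: integrable_swap.
have nsw (f : R * R -> R) : measurable_fun setT f -> (\int[mu2]_p (f p ^+ 2)%:E < n%:E)%E ->
    (\int[mu2]_p (((f \o @swap R R) p) ^+ 2)%:E < n%:E)%E.
  by move=> mf; rewrite integral_sqr_swap.
have [g0 [N [mN N0 colG bG]]] := oscillation_weak loQ ltr01 t0 Qab half mP mS iG iP iS
  Pn Sn dGx dGy.
have [h0 [N' [mN' N'0 colH bH]]] := oscillation_weak loQ' t0 ltr01 Qab' half'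
  (msw _ mT) (msw _ mS) (isw _ iH) (isw _ iT) (isw _ iS) (nsw _ mT Tn) (nsw _ mS Sn) dHy dHx.
have c0G : Num.sqrt (1 * (n / (t / 2))) + Num.sqrt (t * (n / (1 / 2))) <= 4 * rho by lra.
have c0H : Num.sqrt (t * (n / (1 / 2))) + Num.sqrt (1 * (n / (t / 2))) <= 4 * rho by lra.
have rt : rho * t <= rho by rewrite ler_piMr// ltW.
have rt0 : 0 <= rho * t by rewrite mulr_ge0// ltW.
have st1 : Num.sqrt (t * (1 * n)) <= rho * t.
  by apply: sqrtr_le => //; rewrite mul1r rhoE exprMn; lra.
have st2 : Num.sqrt (1 * (t * n)) <= rho * t by rewrite mul1r -[n]mul1r.
(* Edge A1 A2 with the cone of opening [t] at A2: the singular term is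
   [2 * sqrt (n / t) = 2 * rho]. *)
have l1 : `|- al - al - g0 * (1 - 0)| <= 8 * rho.
  have m1 : 2 * Num.sqrt (t * (1 * n)) + 2 * Num.sqrt (1 * n / t) * Num.sqrt (1 - 0) <= 4 * rho.
    have -> : 1 * n / t = n / t by rewrite mul1r.
    by rewrite subr0 sqrtr1 mulr1 -/rho; lra.
  have est := line_estimate_weak loQ ltr01 t0 Qab mG mP mS iG Pn Sn mN N0 colG bG iw
    (tensor_weak_derivative_x wid wG) mM M0 wwt t0 (lexx 0)
    (fun x y hx hy => triangle_polygon s0 st t1 hx hy) m1 c0G.
  have := line_limit est w1 w2 (fun d => approach_bottom s0 st t1).
  by move=> /le_trans; apply; lra.
(* From the foot [(1 - s, 0)] to A2. Opening 1 and length [s] give the singular term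
   [2 * sqrt (n * s)], of order at most [rho * t]; the cone of opening [t] would only give the order
   [rho * sqrt s]. *)
have l2 : `|- al - z - g0 * (1 - (1 - s))| <= 8 * rho * t.
  have m1 : 2 * Num.sqrt (t * (1 * n)) + 2 * Num.sqrt (1 * n / 1) * Num.sqrt (1 - (1 - s))
      <= 4 * (rho * t).
    have : Num.sqrt (1 * n / 1) * Num.sqrt (1 - (1 - s)) <= rho * t.
      rewrite mul1r divr1 -(sqrtrM _ (ltW n0)); apply: sqrtr_le => //.
      by rewrite {1}rhoE subKr exprMn [t ^+ 2]expr2 mulrA ler_wpM2l// mulr_ge0// ltW.
    by rewrite -mulrA; lra.
  have s1 : 0 <= 1 - s by rewrite subr_ge0 (le_trans st)// ltW.
  have cone (x y : R) : 1 - s < x < 1 -> 0 < y < 1 * (1 - x) -> Q (x, y).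
    by rewrite mul1r; exact: corner_polygon.
  have est := line_estimate_weak loQ ltr01 t0 Qab mG mP mS iG Pn Sn mN N0 colG bG iw
    (tensor_weak_derivative_x wid wG) mM M0 wwt ltr01 s1 cone m1 c0G.
  have := line_limit est wz w2 (fun d => approach_corner s0 st t1).
  move=> /le_trans; apply; rewrite subKr.
  have : rho * s <= rho * t by rewrite ler_wpM2l.
  by lra.
have tr : t * n / (1 / t) = (t * rho) ^+ 2 * t.
  by rewrite {1}rhoE; field; rewrite gt_eqF.
have m2 : 2 * Num.sqrt (1 * (t * n)) + 2 * Num.sqrt (t * n / (1 / t)) * Num.sqrt (t - 0)
    <= 4 * (rho * t).
  have : Num.sqrt (t * n / (1 / t)) * Num.sqrt (t - 0) <= rho * t.
    have tr0 : 0 <= (t * rho) ^+ 2 * t by rewrite mulr_ge0 ?sqr_ge0// ltW.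
    rewrite tr -(sqrtrM _ tr0); apply: sqrtr_le => //.
    rewrite subr0 [rho * t]mulrC -mulrA ler_piMr ?sqr_ge0//.
    by rewrite -expr2 (le_trans tt)// ltW.
  by rewrite -mulrA; lra.
have it0 : 0 < 1 / t by rewrite divr_gt0.
have cone (x y : R) : 0 < x < t -> 0 < y < 1 / t * (t - x) -> (@swap R R @^-1` Q) (x, y).
  move=> /andP[x0 xt] /andP[y0]; rewrite mulrBr divfK ?gt_eqF// => yt.
  have h : 1 / t * x * t = x by rewrite -mulrA [x * t]mulrC mulrA divfK ?gt_eqF// mul1r.
  have yx : y * t < t - x by rewrite -[t - x](_ : (1 - 1 / t * x) * t = _) ?ltr_pM2r// mulrBl h mul1r.
  apply: triangle_polygon => //.
    by rewrite y0 (lt_le_trans yt)// gerBl mulr_ge0 ?ltW.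
  by rewrite x0 /=; lra.
have est := line_estimate_weak loQ' t0 ltr01 Qab' (msw _ mH) (msw _ mT) (msw _ mS) (isw _ iH)
  (nsw _ mT Tn) (nsw _ mS Sn) mN' N'0 colH bH (isw _ iw)
  (tensor_weak_derivative_y mQ iw iH wid wH)
  (measurable_preswap mM) (etrans (measure_swap mM) M0)
  (fun p (Qp : (@swap R R @^-1` Q) p) (Mp : ~ (@swap R R @^-1` M) p) => wwt Qp Mp)
  it0 (lexx 0) cone m2 c0H.
have l3 : `|- al - al - h0 * (t - 0)| <= 8 * rho * t.
  have := line_limit est (corner_value_swap w1) (corner_value_swap w5)
    (fun d => approach_left s0 st t1).
  by move=> /le_trans; apply; rewrite subr0; lra.
have l4 : `|al - z - h0 * (s - 0)| <= 8 * rho * t.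
  have := line_limit est (corner_value_swap wz) (corner_value_swap w3)
    (fun d => approach_right s0 st t1).
  move=> /le_trans; apply; rewrite subr0.
  have : rho * s <= rho * t by rewrite ler_wpM2l.
  by lra.
have [hh hg] := corner_algebra s0 st t1 rho0 l1 l2 l3 l4.
(* The oscillation and the constant add up to [(4 + 56) * rho], and
   [3 * (1 + 1 + 60 ^+ 2) = 10806]. *)
have final (c k : R) : 0 <= c -> c <= 4 * rho -> `|k| <= 56 * rho ->
    3 * (n + t ^+ 2 * n + t * (c + `|k|) ^+ 2) <= 10806 * n.
  move=> c00 c4 k56.
  have h1 : t ^+ 2 * n <= n by rewrite ler_piMl ?(le_trans tt)// ltW.
  have h2 : t * (c + `|k|) ^+ 2 <= 3600 * n.
    apply: le_trans (_ : t * (60 * rho) ^+ 2 <= _).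
      apply: ler_wpM2l; first exact: ltW.
      by rewrite ler_sqr ?nnegrE ?addr_ge0 ?mulr_ge0//; lra.
    by rewrite rhoE exprMn; lra.
  by lra.
split.
  apply: le_trans (oscillation_L2_weak loQ ltr01 t0 Qab mG mP mS Pn Sn bG) _.
  rewrite lee_fin expr1n (mul1r n) (mul1r t); exact: final.
have := oscillation_L2_weak loQ' t0 ltr01 Qab' (msw _ mH) (msw _ mT) (msw _ mS)
  (nsw _ mT Tn) (nsw _ mS Sn) bH.
have -> : (\int[mu2]_(p in @swap R R @^-1` Q) (((H \o @swap R R) p) ^+ 2)%:E =
   \int[mu2]_(p in Q) (H p ^+ 2)%:E)%E.
  rewrite integral_mkcond [RHS]integral_mkcond.
  rewrite -(ge0_integral_swap (f := (fun p => (H p ^+ 2)%:E) \_ Q)).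
  - by apply: eq_integral => p _; rewrite !patchE.
  - apply: (measurable_restrictT _ _).1 => //; apply/measurable_EFinP.
    by apply: measurable_funTS; exact: measurable_funX.
  - by move=> p; rewrite patchE; case: ifP => // _; rewrite lee_fin sqr_ge0.
move=> /le_trans; apply.
rewrite lee_fin expr1n (mul1r n) (mulr1 t) [t ^+ 2 * n + n]addrC; apply: final => //.
by apply: le_trans hh _; rewrite ler_wpM2r// ler_nat.
Qed.

End bound.

End gradient.

(** * Restriction to the domain, and corner values of continuous functions *)

Section restriction.
Variable R : realType.
Local Notation mu := (@lebesgue_measure R).
Local Notation mu2 := (mu \x mu)%E.

(** [L2 Q] provides measurability on [Q] only; cutting a derivative off outside [Q] makes it
    measurable on the plane, as the row and column integrals require. *)
Lemma tensor_weak_restrict (Q : set (R * R)) i j (f g : R * R -> R) :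
  tensor_weak Q i j f g -> tensor_weak Q i j f (g \_ Q).
Proof.
move=> fg a b c d e k sa sb a0 b0 Qbox.
rewrite (fg _ _ _ _ _ _ sa sb a0 b0 Qbox); congr (_ * _).
by apply: eq_Rintegral => p pQ; rewrite patchE pQ.
Qed.

Lemma integrable_restrict_dom (Q : set (R * R)) (f : R * R -> R) : measurable Q ->
  mu2.-integrable Q (EFin \o f) -> mu2.-integrable Q (EFin \o (f \_ Q)).
Proof.
move=> mQ; apply: eq_integrable => // p pQ.
by rewrite /= patchE pQ.
Qed.

Lemma integrable_sub (Q : set (R * R)) (f g : R * R -> R) : measurable Q ->
  mu2.-integrable Q (EFin \o f) -> mu2.-integrable Q (EFin \o g) ->
  mu2.-integrable Q (EFin \o (f \- g)).
Proof.
move=> mQ i1 i2.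
have := @integrableB _ (measurableTypeR R * measurableTypeR R)%type R mu2 Q mQ _ _ i1 i2.
by apply: eq_integrable => // p _; rewrite /= EFinB.
Qed.

Lemma integrable_affine (Q : set (R * R)) (al be ga : R) : measurable Q ->
  (mu2 Q < +oo)%E -> (forall p, Q p -> `|p.1| <= 1 /\ `|p.2| <= 1) ->
  mu2.-integrable Q (EFin \o affine al be ga).
Proof.
move=> mQ Qoo Q1; set C := `|al| + `|be| + `|ga|.
have iC : mu2.-integrable Q (EFin \o cst C).
  apply/integrableP; split; first by apply/measurable_EFinP; exact: measurable_cst.
  rewrite (eq_integral (cst C%:E)) => [|p _]; last first.
    by rewrite /= ger0_norm// !addr_ge0.
  by rewrite integral_cst// lte_mul_pinfty// lee_fin !addr_ge0.
have ma : measurable_fun Q (affine al be ga).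
  have cM c (f : R * R -> R) : measurable_fun setT f ->
      measurable_fun setT (fun p => c * f p).
    by move=> mf; exact: (measurable_funM (@measurable_cst _ _ _ _ _ c) mf).
  apply: measurable_funTS; apply: measurable_funD; last exact: cM measurable_snd.
  by apply: measurable_funD => //; exact: cM measurable_fst.
apply: (@le_integrable _ (measurableTypeR R * measurableTypeR R)%type R mu2 Q mQ _
  (EFin \o cst C)) => //; first by apply/measurable_EFinP.
move=> p Qp; have [p1 p2] := Q1 _ Qp.
rewrite /= lee_fin (ger0_norm (_ : 0 <= C)) ?addr_ge0//.
rewrite /affine (le_trans (ler_normD _ _))// lerD//; last by rewrite normrM ler_piMr.
by rewrite (le_trans (ler_normD _ _))// lerD// normrM ler_piMr.
Qed.

Lemma corner_value_continuous (Q : set (R * R)) (u : R * R -> R) (X Y : R) :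
  {within closure Q, continuous u} -> corner_value Q u X Y (u (X, Y)).
Proof.
move=> /subspace_continuousP cu e e0.
have near (P : set (R * R)) : nbhs ((X, Y) : R * R) P -> exists2 d, 0 < d &
    forall p : R * R, `|p.1 - X| < d -> `|p.2 - Y| < d -> P p.
  move=> /nbhs_ballP[d /= d0 dP]; exists d => // p pX pY; apply: dP.
  by split; rewrite /ball /= distrC.
have [clXY|nXY] := pselect (closure Q (X, Y)).
  have := cu _ clXY => /cvgrPdist_lt /(_ _ e0) /near[d d0 D].
  exists d => // p Qp pX pY; rewrite distrC; apply: D => //.
  exact: subset_closure.
have /existsNP[B /not_implyP[nB BQ]] := nXY.
have [d d0 D] := near _ nB.
exists d => // p Qp pX pY; exfalso; apply: BQ; exists p; split => //.
exact: D.
Qed.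

Lemma corner_valueB (Q : set (R * R)) (u : R * R -> R) (al be ga X Y v : R) :
  corner_value Q u X Y v ->
  corner_value Q (u \- affine al be ga) X Y (v - affine al be ga (X, Y)).
Proof.
move=> cu e e0.
set h := e / (1 + (`|be| + `|ga|)).
have den : 0 < 1 + (`|be| + `|ga|) by rewrite ltr_pwDl// addr_ge0.
have h0 : 0 < h by rewrite divr_gt0.
have hE : h + (`|be| * h + `|ga| * h) = e.
  by rewrite -mulrDl -[X in X + _]mul1r -mulrDl mulrC divfK// gt_eqF.
have [d d0 D] := cu _ h0.
exists (Num.min d h) => [|p Qp]; first by rewrite lt_min d0 h0.
rewrite !lt_min => /andP[pX1 pX2] /andP[pY1 pY2].
have Dp := D _ Qp pX1 pY1.
have b1 : `|be * (p.1 - X)| <= `|be| * h by rewrite normrM ler_wpM2l// ltW.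
have b2 : `|ga * (p.2 - Y)| <= `|ga| * h by rewrite normrM ler_wpM2l// ltW.
move: Dp b1 b2; rewrite /affine /= !ltr_norml !ler_norml.
move: hE; clear; move: (u p) (`|be|) (`|ga|) => up ab ag.
by move=> *; lra.
Qed.

End restriction.

(** * The interpolant and its error *)

Section interpolation.
Variable R : realType.
Local Notation mu := (@lebesgue_measure R).
Local Notation mu2 := (mu \x mu)%E.

(** An affine function takes at a midpoint the mean of its end values, so each interpolation
    condition says that the error has opposite values at the two ends of an edge. *)
Lemma P1_interpolant_affine (s t : R) (u : R * R -> R) : 0 < s -> s <= t -> t < 1 ->
  exists al be ga, [/\ P1_interpolant s t u = affine al be ga,
    u (1, 0) - affine al be ga (1, 0) = - (u (0, 0) - affine al be ga (0, 0)),
    u (1 - s, s) - affine al be ga (1 - s, s) = u (0, 0) - affine al be ga (0, 0) &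
    u (0, t) - affine al be ga (0, t) = - (u (0, 0) - affine al be ga (0, 0))].
Proof.
move=> s0 st t1.
set m1 := (u (A1 R) + u (A2 R)) / 2.
set m2 := (u (A2 R) + u (A3 s)) / 2.
set m5 := (u (A5 t) + u (A1 R)) / 2.
have D0 : 0 < t + s * (1 - t).
  by rewrite ltr_pwDl ?(lt_le_trans s0)// mulr_ge0 ?ltW// subr_gt0.
pose D := t + s * (1 - t).
have Dn : D != 0 by rewrite gt_eqF.
(* The midpoint conditions on A1 A2 and A5 A1 give [b - c * t = 2 * (m1 - m5)]; substituting in the
   third leaves an equation for [c] with coefficient [D], the determinant met in
   [corner_algebra]. *)
pose c := 2 * (m2 - m1 - (1 - s) * (m1 - m5)) / D.
have cD : c * D = 2 * (m2 - m1 - (1 - s) * (m1 - m5)) by rewrite /c divfK.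
pose b := c * t + 2 * (m1 - m5).
pose a := m1 - b / 2.
have ex : exists f, [/\ P1 f,
        f (midpoint (A1 R) (A2 R)) = m1, f (midpoint (A2 R) (A3 s)) = m2
      & f (midpoint (A5 t) (A1 R)) = m5].
  exists (affine a b c); split; first by exists a, b, c.
  - by rewrite /affine /a /midpoint /A1 /A2 /= /GRing.scale /=; field.
  - rewrite /affine /a /midpoint /A2 /A3 /= /GRing.scale /=.
    have := cD; rewrite /D => cD'.
    have : c * s - c * s * t + c * t = 2 * (m2 - m1 - (1 - s) * (m1 - m5)) by rewrite -cD'; ring.
    rewrite /b => E.
    transitivity (m1 + (1 - s) * (m1 - m5) + (c * s - c * s * t + c * t) / 2); first by field.
    by rewrite E; field.
  - by rewrite /affine /a /b /midpoint /A5 /A1 /= /GRing.scale /=; field.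
have := xgetPex (fun=> 0) ex.
rewrite -/(P1_interpolant s t u) => -[[al [be [ga E]]]].
have -> : P1_interpolant s t u = affine al be ga by apply/funext.
rewrite /affine /midpoint /m1 /m2 /m5 /A1 /A2 /A3 /A5 /= /GRing.scale /= => e1 e2 e5.
exists al, be, ga; split => //=; move: e1 e2 e5.
- move: (u (0, 0)) (u (1, 0)) => u0 u1; lra.
- move: (u (0, 0)) (u (1, 0)) (u (1 - s, s)) => u0 u1 u2.
  by move=> e1 e2 _; lra.
- move: (u (0, 0)) (u (1, 0)) (u (0, t)) => u0 u1 u2; lra.
Qed.

Lemma polygon_finite (s t : R) : 0 < s -> s <= t -> t < 1 -> (mu2 (polygon s t) < +oo)%E.
Proof.
move=> s0 st t1; have [_ mQ _ _] := lower_open_polygon s0 st t1.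
have sub : polygon s t `<=` `[0, 1] `*` `[0, 1].
  move=> p /(polygon_sub s0 st t1) [/andP[x0 x1] /andP[y0 yt]].
  split; rewrite /= in_itv /=; apply/andP; split; apply: ltW => //.
  exact: lt_trans yt t1.
have mB : measurable (`[0, 1] `*` `[0, 1] : set (R * R)) by exact: measurableX.
have E : mu2 (`[0%R, 1%R] `*` `[0%R, 1%R]) = (mu `[0%R, 1%R]%classic * mu `[0%R, 1%R]%classic)%E.
  by apply: product_measure1E; exact: measurable_itv.
have le : (mu2 (polygon s t) <= mu2 (`[0%R, 1%R] `*` `[0%R, 1%R]))%E.
  by apply: le_measure => //; rewrite inE.
apply: le_lt_trans le _; apply: (@eq_ind_r _ _ (fun x => (x < +oo)%E) _ _ E).
rewrite lebesgue_measure_itv /= lte_fin ltr01 oppr0 adde0 mule1.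
exact: ltry.
Qed.

Section bound.
Variables (s t n al be ga l : R) (v u G H P S T : R * R -> R).
Local Notation Q := (polygon s t).
Local Notation pi := (affine al be ga).
Hypotheses (s0 : 0 < s) (st : s <= t) (t1 : t < 1) (n0 : 0 < n).
Hypotheses (L2v : L2 Q v) (L2P : L2 Q P) (L2S : L2 Q S) (L2T : L2 Q T).
Hypotheses (iG : mu2.-integrable Q (EFin \o G)) (iH : mu2.-integrable Q (EFin \o H)).
Hypotheses (wG : tensor_weak Q 1 0 (v \- pi) G) (wH : tensor_weak Q 0 1 (v \- pi) H).
Hypotheses (wP : tensor_weak Q 2 0 v P) (wS : tensor_weak Q 1 1 v S)
  (wT : tensor_weak Q 0 2 v T).
Hypotheses (Pn : L2norm Q P ^+ 2 < n) (Sn : L2norm Q S ^+ 2 < n) (Tn : L2norm Q T ^+ 2 < n).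
Hypothesis uv : continuous_representative Q v u.
Hypotheses (u1 : u (0, 0) - pi (0, 0) = l) (u2 : u (1, 0) - pi (1, 0) = - l)
  (u3 : u (1 - s, s) - pi (1 - s, s) = l) (u5 : u (0, t) - pi (0, t) = - l).

Lemma interpolation_gradient :
  (\int[mu2]_p ((G \_ Q) p ^+ 2)%:E <= (10806 * n)%:E)%E /\
  (\int[mu2]_p ((H \_ Q) p ^+ 2)%:E <= (10806 * n)%:E)%E.
Proof.
have [_ mQ _ _] := lower_open_polygon s0 st t1.
have Qoo := polygon_finite s0 st t1.
have Q1 p : Q p -> `|p.1| <= 1 /\ `|p.2| <= 1.
  move=> /(polygon_sub s0 st t1) [/andP[x0 x1] /andP[y0 yt]].
  by rewrite !gtr0_norm// !ltW// (lt_trans yt).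
have [cu [M [mM M0 PM]]] := uv.
have vu p : Q p -> ~ M p -> (v \- pi) p = (u \- pi) p.
  move=> Qp Mp; rewrite /=; congr (_ - _).
  by apply: contrapT => h; apply: Mp; apply: PM => /= /(_ Qp) /esym.
have ipi (a b c : R) : mu2.-integrable Q (EFin \o affine a b c).
  exact: integrable_affine.
have i0 : mu2.-integrable Q (EFin \o cst (0 : R)).
  have := ipi 0 0 0; apply: eq_integrable => // p _.
  by rewrite /= /affine !mul0r !addr0.
have iL2 f : L2 Q f -> mu2.-integrable Q (EFin \o f) by exact: L2_integrable.
have iv := iL2 _ L2v.
have iw : mu2.-integrable Q (EFin \o (v \- pi)).
  exact: integrable_sub mQ iv (ipi al be ga).
(* Affine functions have vanishing derivatives of order at least 2, so those of [v] serve for the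
   error. *)
have w2 i j g : (1 < i + j)%N -> L2 Q g -> tensor_weak Q i j v g ->
    tensor_weak Q i j (v \- pi) (g \_ Q).
  move=> ij L2g vg; apply: tensor_weak_restrict.
  have piW : tensor_weak Q i j pi (cst 0) by exact: tensor_weak_affine_0.
  have := tensor_weakB mQ iv (iL2 _ L2g) (ipi al be ga) i0 vg piW.
  by congr tensor_weak; apply/funext => p /=; rewrite subr0.
have mr (f : R * R -> R) : mu2.-integrable Q (EFin \o f) -> measurable_fun setT (f \_ Q).
  by move=> /measurable_int /measurable_EFinP mf; exact: (measurable_restrictT f mQ).1.
have ir (f : R * R -> R) : mu2.-integrable Q (EFin \o f) -> mu2.-integrable Q (EFin \o (f \_ Q)).
  exact: (integrable_restrict_dom mQ).
have sq f : L2 Q f -> L2norm Q f ^+ 2 < n -> (\int[mu2]_p ((f \_ Q) p ^+ 2)%:E < n%:E)%E.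
  by move=> L2f fn; rewrite integral_sqr_L2norm// lte_fin.
have cv X Y w : u (X, Y) - pi (X, Y) = w -> corner_value Q (u \- pi) X Y w.
  by move=> <-; apply: corner_valueB; exact: corner_value_continuous.
have full (f : R * R -> R) : (\int[mu2]_(p in Q) ((f \_ Q) p ^+ 2)%:E = \int[mu2]_p ((f \_ Q) p ^+ 2)%:E)%E.
  rewrite integral_mkcond; apply: eq_integral => p _; rewrite !patchE.
  case: ifP => [->//|_]; transitivity ((0 : R) ^+ 2)%:E; last by [].
  by rewrite expr0n.
(* Nothing is prescribed at the foot [(1 - s, 0)]: the last corner value is whatever [u \- pi] is
   there, hence [erefl]. *)
have := gradient_bound s0 st t1 n0 (mr _ iG) (mr _ iH) (mr _ (iL2 _ L2P))
  (mr _ (iL2 _ L2S)) (mr _ (iL2 _ L2T)) iw (ir _ iG) (ir _ iH) (ir _ (iL2 _ L2P))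
  (ir _ (iL2 _ L2S)) (ir _ (iL2 _ L2T)) (tensor_weak_restrict wG) (tensor_weak_restrict wH)
  (w2 2%N 0%N _ isT L2P wP) (w2 1%N 1%N _ isT L2S wS) (w2 0%N 2%N _ isT L2T wT)
  (sq _ L2P Pn) (sq _ L2S Sn) (sq _ L2T Tn) mM M0 vu (cv _ _ _ u1) (cv _ _ _ u2)
  (cv _ _ _ u3) (cv _ _ _ u5) (cv _ _ _ erefl).
by rewrite !full.
Qed.

End bound.

End interpolation.

(** * Chosen weak derivatives, and the final estimate in semi-norms *)

Lemma chosen_wpartial (R : realType) (Q : set (R * R)) i j (v : R * R -> R) :
  (exists g, weak_partial Q i j v g) -> weak_partial Q i j v (wpartial Q i j v).
Proof. exact: xgetPex. Qed.

Theorem lemma3p6 (R : realType) :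
  exists C : R, 0 < C /\
    forall s t : R, 0 < s -> s <= t -> t < 1 ->
    forall v : R * R -> R, sobolevH 2 (Qhat s t) v ->
    forall u : R * R -> R, continuous_representative (Qhat s t) v u ->
      sobolev_seminorm 1 (Qhat s t) (v \- P1_interpolant s t u)
        <= C * sobolev_seminorm 2 (Qhat s t) v.
Proof.
(* Each component of the gradient contributes at most [10806 * m], and
   [2 * 10806 = 21612 <= 150 ^+ 2 = 22500]. *)
exists 150; split => // s t s0 st t1 v + u; rewrite (Qhat_polygon s0 st t1).
move=> [L2v Hv] uv; set Q := polygon s t in L2v Hv uv *.
have [_ mQ _ _] := lower_open_polygon s0 st t1.
have Qoo := polygon_finite s0 st t1.
have Q1 p : Q p -> `|p.1| <= 1 /\ `|p.2| <= 1.
  move=> /(polygon_sub s0 st t1) [/andP[x0 x1] /andP[y0 yt]].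
  by rewrite !gtr0_norm// !ltW// (lt_trans yt).
have [al [be [ga [-> u2 u3 u5]]]] := P1_interpolant_affine u s0 st t1.
set pi := affine al be ga; set w := v \- pi.
have iv := L2_integrable mQ Qoo L2v.
have ipi a b c := integrable_affine a b c mQ Qoo Q1.
have chosen i j : (i + j <= 2)%N ->
    exists g, wpartial Q i j v = g /\ weak_partial Q i j v g.
  move=> ij; exists (wpartial Q i j v).
  exact: (conj erefl (chosen_wpartial (Hv _ _ ij))).
have [P [PE [L2P wP]]] := chosen 2%N 0%N isT.
have [S [SE [L2S wS]]] := chosen 1%N 1%N isT.
have [T [TE [L2T wT]]] := chosen 0%N 2%N isT.
have [Gv Gv1] := Hv 1%N 0%N isT; have [Hv' Hv1] := Hv 0%N 1%N isT.
have icst c : (@lebesgue_measure R \x @lebesgue_measure R)%E.-integrable Q (EFin \o cst c).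
  have := ipi c 0 0; apply: eq_integrable => // p _.
  by rewrite /= /affine !mul0r !addr0.
have iL2 f : L2 Q f -> (@lebesgue_measure R \x @lebesgue_measure R)%E.-integrable Q (EFin \o f).
  exact: L2_integrable.
have iG := integrable_sub mQ (iL2 _ Gv1.1) (icst be).
have iH := integrable_sub mQ (iL2 _ Hv1.1) (icst ga).
have wG : tensor_weak Q 1 0 w (Gv \- cst be).
  have piG : tensor_weak Q 1 0 pi (cst be) by exact: tensor_weak_affine_x.
  exact: (tensor_weakB mQ iv (iL2 _ Gv1.1) (ipi al be ga) (icst be)
    (weak_partial_tensor Gv1) piG).
have wH : tensor_weak Q 0 1 w (Hv' \- cst ga).
  have piH : tensor_weak Q 0 1 pi (cst ga) by exact: tensor_weak_affine_y.
  exact: (tensor_weakB mQ iv (iL2 _ Hv1.1) (ipi al be ga) (icst ga)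
    (weak_partial_tensor Hv1) piH).
have P0 : 0 <= L2norm Q P ^+ 2 by exact: sqr_ge0.
have S0 : 0 <= L2norm Q S ^+ 2 by exact: sqr_ge0.
have T0 : 0 <= L2norm Q T ^+ 2 by exact: sqr_ge0.
pose m := L2norm Q P ^+ 2 + L2norm Q S ^+ 2 + L2norm Q T ^+ 2.
have m0 : 0 <= m by exact: addr_ge0 (addr_ge0 P0 S0) T0.
have [k kE] : exists k : R, k = 10806 by exists 10806.
have k0 : 0 < k by rewrite kE ltr0n.
have sum2 (F : nat -> R) : \sum_(i < 2) F i = F 0%N + F 1%N.
  by rewrite !big_ord_recr big_ord0 /= add0r.
have semi2 : sobolev_seminorm 2 Q v = Num.sqrt m.
  rewrite /sobolev_seminorm.
  transitivity (Num.sqrt (L2norm Q T ^+ 2 + L2norm Q S ^+ 2 + L2norm Q P ^+ 2)).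
    rewrite big_ord_recr (sum2 (fun i => L2norm Q (wpartial Q i (2 - i) v) ^+ 2)).
    by rewrite /= TE SE PE.
  by congr Num.sqrt; rewrite /m; ring.
(* Stated for arbitrary [G] and [H] because the semi-norm uses a chosen derivative of [w], which
   need not be [Gv \- cst be]. The slack [e] supplies the strict bounds and covers [m = 0]. *)
have bound G H : (@lebesgue_measure R \x @lebesgue_measure R)%E.-integrable Q (EFin \o G) ->
    (@lebesgue_measure R \x @lebesgue_measure R)%E.-integrable Q (EFin \o H) ->
    tensor_weak Q 1 0 w G -> tensor_weak Q 0 1 w H -> forall e, 0 < e ->
    (\int[(@lebesgue_measure R \x @lebesgue_measure R)%E]_p ((G \_ Q) p ^+ 2)%:E <=
     (k * (m + e))%:E)%E /\
    (\int[(@lebesgue_measure R \x @lebesgue_measure R)%E]_p ((H \_ Q) p ^+ 2)%:E <=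
     (k * (m + e))%:E)%E.
  move=> iG' iH' wG' wH' e e0; have me : 0 < m + e by rewrite ltr_wpDl.
  rewrite kE; apply: (interpolation_gradient s0 st t1 me L2v L2P L2S L2T iG' iH' wG' wH'
    (weak_partial_tensor (conj L2P wP)) (weak_partial_tensor (conj L2S wS))
    (weak_partial_tensor (conj L2T wT)) _ _ _ uv erefl u2 u3 u5); rewrite /m; lra.
have norm_le i j : (weak_partial Q i j w (wpartial Q i j w) -> forall e, 0 < e ->
    (\int[(@lebesgue_measure R \x @lebesgue_measure R)%E]_p
       ((wpartial Q i j w \_ Q) p ^+ 2)%:E <= (k * (m + e))%:E)%E) ->
    L2norm Q (wpartial Q i j w) ^+ 2 <= k * m.
  (* When [w] has no weak derivative, [wpartial] is the junk value 0. *)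
  have [ex|nex] := pselect (exists g, weak_partial Q i j w g); last first.
    move=> _; rewrite /wpartial xgetPN.
      by rewrite L2norm0 expr0n; exact: mulr_ge0 (ltW k0) m0.
    by move=> g wg; apply: nex; exists g.
  have wp := chosen_wpartial ex; move=> /(_ wp) h.
  apply/ler_addgt0Pr => e e0; have e1 : 0 < e / k by exact: divr_gt0.
  have := h _ e1; rewrite integral_sqr_L2norm ?lee_fin//; last by case: wp.
  by rewrite mulrDr [_ * (e / _)]mulrC divfK// gt_eqF.
(* The chosen horizontal derivative is paired with the explicit vertical one, and conversely
   below. *)
have nG : L2norm Q (wpartial Q 1 0 w) ^+ 2 <= k * m.
  apply: norm_le => wp e e0.
  by have [] := bound _ _ (iL2 _ wp.1) iH (weak_partial_tensor wp) wH e e0.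
have nH : L2norm Q (wpartial Q 0 1 w) ^+ 2 <= k * m.
  apply: norm_le => wp e e0.
  by have [] := bound _ _ iG (iL2 _ wp.1) wG (weak_partial_tensor wp) e e0.
rewrite semi2 /sobolev_seminorm (sum2 (fun i => L2norm Q (wpartial Q i (1 - i) w) ^+ 2)).
apply: sqrtr_le; first by rewrite mulr_ge0 ?sqrtr_ge0.
rewrite exprMn sqr_sqrtr//; apply: le_trans (lerD nH nG) _.
by clear -m0 kE; rewrite kE; lra.
Qed.
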